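(* Let $n\ge1$ and let $(\psi,\tilde\psi)=(\psi^{(\epsilon)},\tilde\psi^{(\epsilon)})$ be any one of the pairs of generators of a pair of band-limited biorthogonal Riesz wavelet bases of $L^2(\mathbb{R}^n)$ with Riesz bounds $A,B$ (see context), with $\psi\in M^\tau$ and $\tilde\psi\in\mathcal{D}_\sigma$ for some $\tau>0$ and $\sigma>2n$. Fix $j\in\mathbb{Z}$, a finite set $\Lambda\subset\mathbb{Z}^n$, and coefficients $\{c_{j,k}\}_{k\in\Lambda}\subset\mathbb{C}$, and set $r^{(j)}_\Lambda:=\sum_{k\in\Lambda}c_{j,k}\psi_{j,k}$. Then, for every $1<p<\infty$ and every $w\in A_p$, $$c\,[w]_{A_p}^{-\theta(p)}\,2^{jn/2}\Bigl(\sum_{k\in\Lambda}|c_{j,k}|^p\,w(Q_{j,k})\Bigr)^{1/p}\le\bigl\|r^{(j)}_\Lambda\bigr\|_{L^p_w}\le C\,[w]_{A_p}^{\theta(p)}\,2^{jn/2}\Bigl(\sum_{k\in\Lambda}|c_{j,k}|^p\,w(Q_{j,k})\Bigr)^{1/p},$$ where $\theta(p)=\frac12\max\{1,(p-1)^{-1}\}$. The constants $c,C>0$ depend only on $n$, $p$, the Riesz bounds $A,B$, and the decay parameters $\tau,\sigma$ (in the sense explained in the context), and are independent of $j$, $\Lambda$, and $\{c_{j,k}\}$.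
   Context: Conventions. $\hat f(\xi)=\int_{\mathbb{R}^n} f(x)e^{-2\pi i x\cdot\xi}dx$. $\langle f,g\rangle=\int f\,\overline{g}$. For a function $h$, $h_{j,k}(x):=2^{jn/2}h(2^jx-k)$ for $j\in\mathbb{Z}$, $k\in\mathbb{Z}^n$. $Q_{j,k}:=2^{-j}(k+[0,1)^n)$, $w(E):=\int_E w$, $\|g\|_{L^p_w}:=(\int|g|^pw)^{1/p}$. Wavelet system. For a fixed integer $L\ge1$, generators $\psi^{(1)},\dots,\psi^{(L)}$ and dual generators $\tilde\psi^{(1)},\dots,\tilde\psi^{(L)}$ have Fourier transforms in $C_c^\infty(\mathbb{R}^n)$ supported in $\{a\le|\xi|\le b\}$ for fixed $0<a<b$ (band-limited). Each of the systems $\{\psi^{(\epsilon)}_{j,k}\}$, $\{\tilde\psi^{(\epsilon)}_{j,k}\}$ ($1\le\epsilon\le L$, $j\in\mathbb{Z}$, $k\in\mathbb{Z}^n$) is a Riesz basis of $L^2(\mathbb{R}^n)$: closed linear span $L^2$ and $A\sum|c|^2\le\|\sum c^{(\epsilon)}_{j,k}\psi^{(\epsilon)}_{j,k}\|_{L^2}^2\le B\sum|c|^2$ for finitely supported coefficients (Riesz bounds $A,B>0$), similarly for the dual system; $\langle\psi^{(\epsilon)}_{j,k},\tilde\psi^{(\epsilon')}_{j',k'}\rangle=\delta_{\epsilon,\epsilon'}\delta_{j,j'}\delta_{k,k'}$; and every $f\in L^2$ satisfies $f=\sum_{\epsilon,j,k}\langle f,\tilde\psi^{(\epsilon)}_{j,k}\rangle\psi^{(\epsilon)}_{j,k}$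 in $L^2$. Weights. A weight is a locally integrable, a.e. positive function on $\mathbb{R}^n$; $w\in A_p$ iff $[w]_{A_p}:=\sup_Q(\frac1{|Q|}\int_Qw)(\frac1{|Q|}\int_Qw^{-1/(p-1)})^{p-1}<\infty$, sup over cubes with sides parallel to the axes. Decay classes. $\psi\in M^\tau$ iff $|\psi|_{M^\tau}:=\sup_x(1+|x|)^{2n+\tau}|\psi(x)|<\infty$; $\tilde\psi\in\mathcal{D}_\sigma$ iff $|\tilde\psi|_{\mathcal{D}_\sigma}:=\int(1+|x|^\sigma)|\tilde\psi(x)|dx<\infty$. A constant ''depends on the decay parameter $\tau$'' if it depends on $\tau$ and $|\psi|_{M^\tau}$; it ''depends on the decay parameter $\sigma$'' if it depends on $\sigma$, $|\tilde\psi|_{\mathcal{D}_\sigma}$ and the annulus radii $a,b$ (in both cases the maximum of the quantity over the labels $\epsilon$ is taken). *)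

(* Defs.v *)
From HB Require Import structures.
From mathcomp Require Import all_boot all_order all_algebra finmap.
From mathcomp Require Import all_classical all_reals all_analysis.
From mathcomp Require Import complex.

Set Implicit Arguments.
Unset Strict Implicit.
Unset Printing Implicit Defensive.

Import Order.TTheory GRing.Theory Num.Theory.
Import numFieldNormedType.Exports.

Local Open Scope classical_set_scope.
Local Open Scope ring_scope.

Definition rV_display : measure_display -> measure_display.
Proof. exact. Qed.

(* The sigma-algebra on row vectors generated by the coordinates; for vectors
   of reals this is the Borel sigma-algebra of R^n. *)
Section measurable_rV.
Context {d : measure_display} {T : measurableType d} {n : nat}.

Definition rV_coord (i : 'I_n) (x : 'rV[T]_n) : T := x ord0 i.

Let rV_set0 : g_sigma_preimage rV_coord set0.
Proof. exact: sigma_algebra0. Qed.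

Let rV_setC A : g_sigma_preimage rV_coord A -> g_sigma_preimage rV_coord (~` A).
Proof. exact: sigma_algebraC. Qed.

Let rV_bigcup (F : (set 'rV[T]_n)^nat) :
  (forall i, g_sigma_preimage rV_coord (F i)) ->
  g_sigma_preimage rV_coord (\bigcup_i (F i)).
Proof. exact: sigma_algebra_bigcup. Qed.

HB.instance Definition _ := @isMeasurable.Build (rV_display d)
  'rV[T]_n (g_sigma_preimage rV_coord) rV_set0 rV_setC rV_bigcup.

Lemma measurable_rV_coord (i : 'I_n) : measurable_fun [set: 'rV[T]_n] (rV_coord i).
Proof.
move=> _ Y mY; rewrite setTI; apply: sub_sigma_algebra => /=.
rewrite -bigcup_seq/=; exists i => /=; first by rewrite mem_index_enum.
by exists Y => //; rewrite setTI.
Qed.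

Lemma measurable_fun_rVP d' (S : measurableType d') (f : S -> 'rV[T]_n) :
  (forall i, measurable_fun [set: S] (rV_coord i \o f)) ->
  measurable_fun [set: S] f.
Proof.
move=> mf _ Y mY; move: mY.
pose G := image_set_system [set: S] f measurable.
suff : g_sigma_preimage rV_coord `<=` G by move=> /(_ Y) /[apply].
apply: smallest_sub.
  exact/sigma_algebra_image/sigma_algebra_measurable.
rewrite -bigcup_seq => A [i _ [B mB <-]].
by rewrite /G /image_set_system /= setTI; exact: mf.
Qed.

End measurable_rV.

Section lebesgue_rV.
Context {R : realType}.

Definition rV_cons (n : nat) (p : 'rV[R]_n * R) : 'rV[R]_n.+1 :=
  \row_i oapp (p.1 ord0) p.2 (unlift ord0 i).

Lemma measurable_rV_cons (n : nat) : measurable_fun setT (@rV_cons n).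
Proof.
apply: measurable_fun_rVP => i.
have [j ->|->] := unliftP ord0 i.
  rewrite (_ : _ \o _ = rV_coord j \o fst).
    by apply: measurableT_comp => //; exact: measurable_rV_coord.
  by apply/funext => p; rewrite /rV_coord /= mxE liftK.
rewrite (_ : _ \o _ = snd) //.
by apply/funext => p; rewrite /rV_coord /= mxE unlift_none.
Qed.

Definition lebesgue_rV_step (n : nat) (m : {measure set 'rV[R]_n -> \bar R}) :
    set 'rV[R]_n.+1 -> \bar R :=
  pushforward (m \x @lebesgue_measure R)%E (@rV_cons n).

Section measure_step.
Local Open Scope ereal_scope.
Context {n : nat} (m : {measure set 'rV[R]_n -> \bar R}).

Let step0 : lebesgue_rV_step m set0 = 0.
Proof. by rewrite /lebesgue_rV_step /pushforward preimage_set0 measure0. Qed.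

Let step_ge0 A : 0 <= lebesgue_rV_step m A.
Proof. exact: integral_ge0. Qed.

Let step_sigma_additive : semi_sigma_additive (lebesgue_rV_step m).
Proof.
have mc : forall A, measurable A -> measurable (@rV_cons n @^-1` A).
  by move=> A mA; rewrite -[X in measurable X]setTI; exact: measurable_rV_cons.
move=> F mF tF mUF; rewrite /lebesgue_rV_step /pushforward preimage_bigcup.
apply: measure_semi_sigma_additive.
- by move=> k; exact: mc.
- apply/trivIsetP => /= i j _ _ ij; rewrite -preimage_setI.
  by move/trivIsetP : tF => /(_ _ _ _ _ ij) ->//; rewrite preimage_set0.
- by rewrite -preimage_bigcup; exact: mc.
Qed.

HB.instance Definition _ := isMeasure.Build _ _ _ (lebesgue_rV_step m)
  step0 step_ge0 step_sigma_additive.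

End measure_step.

(* Lebesgue measure on R^n, as the n-fold product of the Lebesgue measure of
   the line (R^0 is a point of mass 1). *)
Fixpoint lebesgue_rV (n : nat) : {measure set 'rV[R]_n -> \bar R} :=
  match n with
  | 0 => \d_(0 : 'rV[R]_0)
  | n'.+1 => lebesgue_rV_step (lebesgue_rV n')
  end.

End lebesgue_rV.

Local Open Scope complex_scope.

Section complex_functions.
Context {R : realType} {n : nat}.
Implicit Types (f g h : 'rV[R]_n -> R[i]) (x y xi : 'rV[R]_n).
Local Notation mu := (@lebesgue_rV R n).

(* The norm of the library's normed space ['rV[R]_n] is the sup norm, hence a
   separate Euclidean norm. *)
Definition enorm x : R := Num.sqrt (\sum_i x ord0 i ^+ 2).

Definition edot x y : R := \sum_i x ord0 i * y ord0 i.

Definition absC (z : R[i]) : R := complex.Re `|z|.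

Definition cis (t : R) : R[i] := cos t +i* sin t.

Definition cmeasurable f :=
  measurable_fun setT (@complex.Re R \o f) /\
  measurable_fun setT (@complex.Im R \o f).

Definition cintegrable f :=
  mu.-integrable setT (EFin \o @complex.Re R \o f) /\
  mu.-integrable setT (EFin \o @complex.Im R \o f).

Definition cintegral f : R[i] :=
  (\int[mu]_x complex.Re (f x)) +i* (\int[mu]_x complex.Im (f x)).

Definition fourier f xi : R[i] :=
  cintegral (fun x => f x * cis (- (2 * pi * edot x xi))).

Definition inner f g : R[i] := cintegral (fun x => f x * (g x)^*).

Definition L2norm f : \bar R := 'N[mu]_2%:E[EFin \o @absC \o f].

Definition L2 f := cmeasurable f /\ (L2norm f < +oo)%E.

(* C^k through continuity of all iterated partial derivatives of order <= k. *)
Fixpoint Ck (k : nat) (u : 'rV[R]_n -> R) : Prop :=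
  continuous u /\
  if k is k'.+1 then
    forall i : 'I_n, (forall x, derivable u x (delta_mx ord0 i)) /\
      Ck k' (fun x => 'D_(delta_mx ord0 i) u x)
  else True.

Definition smooth f :=
  forall k, Ck k (@complex.Re R \o f) /\ Ck k (@complex.Im R \o f).

Definition supp f : set 'rV[R]_n := closure [set x | f x != 0].

Definition Cc_smooth f := smooth f /\ compact (supp f).

(* Integrability makes the integral defining the Fourier transform meaningful. *)
Definition band_limited (a b : R) f :=
  [/\ cintegrable f, Cc_smooth (fourier f) &
      supp (fourier f) `<=` [set xi | a <= enorm xi <= b]].

Definition Mnorm (tau : R) f : \bar R :=
  ereal_sup (range (fun x =>
    ((1 + enorm x) `^ (2 * n%:R + tau) * absC (f x))%:E)).

Definition Dnorm (sigma : R) f : \bar R :=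
  (\int[mu]_x ((1 + enorm x `^ sigma) * absC (f x))%:E)%E.

Definition in_M tau f := (Mnorm tau f < +oo)%E.

Definition in_D sigma f := (Dnorm sigma f < +oo)%E.

Definition zvec (k : 'rV[int]_n) : 'rV[R]_n := map_mx intr k.

Definition dilate h (j : int) (k : 'rV[int]_n) x : R[i] :=
  (2 `^ (j%:~R * n%:R / 2))%:C * h ((2 : R) ^ j *: x - zvec k).

Definition dyadic_cube (j : int) (k : 'rV[int]_n) : set 'rV[R]_n :=
  [set (2 : R) ^ (- j) *: (zvec k + u) |
     u in [set u : 'rV[R]_n | forall i, 0 <= u ord0 i < 1]].

End complex_functions.

Section wavelets.
Context {R : realType} {n : nat} {L : nat}.
Implicit Types (psi psit : 'I_L -> 'rV[R]_n -> R[i]).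

Definition wav_index : Type := ('I_L * int * 'rV[int]_n)%type.
HB.instance Definition _ := Choice.on wav_index.

Definition wav psi (i : wav_index) : 'rV[R]_n -> R[i] :=
  dilate (psi i.1.1) i.1.2 i.2.

Definition wav_comb psi (S : {fset wav_index}) (c : wav_index -> R[i]) :
    'rV[R]_n -> R[i] :=
  fun x => \sum_(i <- S) c i * wav psi i x.

Definition Riesz_basis (A B : R) psi :=
  [/\ forall i, L2 (wav psi i),
      forall f, L2 f -> forall e : R, 0 < e ->
        exists (S : {fset wav_index}) (c : wav_index -> R[i]),
          (L2norm (f \- wav_comb psi S c)%R < e%:E)%E
    & forall (S : {fset wav_index}) (c : wav_index -> R[i]),
        ((A * \sum_(i <- S) absC (c i) ^+ 2)%:E <= L2norm (wav_comb psi S c) ^+ 2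
          <= (B * \sum_(i <- S) absC (c i) ^+ 2)%:E)%E].

Definition biorthogonal psi psit :=
  forall i i' : wav_index, inner (wav psi i) (wav psit i') = (i == i')%:R.

(* Convergence in L^2 of the net of finite partial sums. *)
Definition wavelet_expansion psi psit :=
  forall f, L2 f -> forall e : R, 0 < e ->
    exists S0 : {fset wav_index}, forall S : {fset wav_index},
      (S0 `<=` S)%fset ->
      (L2norm (f \- wav_comb psi S (fun i => inner f (wav psit i)))%R
        < e%:E)%E.

Record wavelet_system (a b A B : R) psi psit : Prop := {
  wavelet_labels : (1 <= L)%N ;
  wavelet_band : forall e, band_limited a b (psi e) ;
  wavelet_band_dual : forall e, band_limited a b (psit e) ;
  wavelet_Riesz : Riesz_basis A B psi ;
  wavelet_Riesz_dual : Riesz_basis A B psit ;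
  wavelet_biorthogonal : biorthogonal psi psit ;
  wavelet_reconstruction : wavelet_expansion psi psit
}.

End wavelets.

Section weights.
Context {R : realType} {n : nat}.
Implicit Types (w u : 'rV[R]_n -> R) (Q : set 'rV[R]_n).
Local Notation mu := (@lebesgue_rV R n).
Local Open Scope ereal_scope.

Record weight w : Prop := {
  weight_measurable : measurable_fun setT w ;
  weight_locally_integrable :
    forall K : set 'rV[R]_n, compact K -> \int[mu]_(x in K) `|w x|%:E < +oo ;
  weight_ae_gt0 : {ae mu, forall x, (0 < w x)%R}
}.

Definition weight_mass w Q : \bar R := \int[mu]_(x in Q) (w x)%:E.

Definition cube (x : 'rV[R]_n) (l : R) : set 'rV[R]_n :=
  [set y | forall i, (x ord0 i <= y ord0 i < x ord0 i + l)%R].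

Definition average Q u : \bar R :=
  ((fine (mu Q))^-1)%:E * \int[mu]_(x in Q) (u x)%:E.

Definition Ap_const (p : R) w : \bar R :=
  ereal_sup [set average Q w *
      (average Q (fun x => w x `^ (- (p - 1)^-1))%R) `^ (p - 1) |
    Q in [set Q | exists x l, (0 < l)%R /\ Q = cube x l]].

Definition Ap (p : R) w := weight w /\ Ap_const p w < +oo.

Definition Lpw_norm (p : R) w (g : 'rV[R]_n -> R[i]) : \bar R :=
  (\int[mu]_x (absC (g x) `^ p * w x)%:E) `^ p^-1.

End weights.

Definition theta {R : realType} (p : R) : R := 2^-1 * Num.max 1 (p - 1)^-1.

(* Main.v *)
Require Import Defs.
From HB Require Import structures.
From mathcomp Require Import all_boot all_order all_algebra finmap.
From mathcomp Require Import all_classical all_reals all_analysis.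
From mathcomp Require Import measurable_realfun complex.
From mathcomp Require Import zify ring lra.
Set Implicit Arguments.
Unset Strict Implicit.
Unset Printing Implicit Defensive.
Import Order.TTheory GRing.Theory Num.Theory.
Import numFieldNormedType.Exports.
Local Open Scope classical_set_scope.
Local Open Scope ring_scope.
Local Open Scope complex_scope.

(* Since [w]_{A_p} >= 1 and theta(p) >= 1/p, it suffices to prove both bounds with
   [w]_{A_p}^{1/p}.  Write Q_m for the dyadic cubes of side 2^-j and |.| for the sup
   norm.  Hoelder's inequality and the A_p condition on a cube containing Q_k and Q_m
   give, for f >= 0,
     w(Q_k) (int_{Q_m} f)^p <= [w]_{A_p} (2^{-jn} (1 + |k - m|)^n)^p int_{Q_m} f^p w.
   This growth is absorbed by kernels decaying like (1 + |k - m|)^{-2n-e}: for the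
   upper bound |psi_{j,k}| on Q_m is such a kernel, and f = 1; for the lower bound
   c_{j,k} = <r, psit_{j,k}> by biorthogonality, and f = |r|.
   Pointwise decay of psit from int (1 + |x|^sigma) |psit| < oo comes from
   band-limitation: an integrable g with Fourier support in the sup-norm ball of
   radius B satisfies |g| <= C B^n ||g||_1 almost everywhere, and this is applied to
   (e^{2 pi i h x_i} - 1)^N psit with h ~ 1/|x_i|.  The L1-L^oo bound is proved without
   Fourier inversion: the indicator of a box is a limit of trigonometric polynomials
   whose frequencies outside the Fourier support of g do not contribute. *)

(** * Moduli and characters *)

(** The exponent 2n has two halves. A cube containing Q_k and Q_m can be taken of side 2^-j (1 + |k
    - m|), so passing from one to the other through A_p costs one power n of 1 + |k - m|; a second
    power n, with a surplus, makes what remains of the kernel summable over Z^n. The surplus is tau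
    in the upper bound and sigma - 2n in the lower one. The A_p constant enters only through pairs
    of cubes of the one scale 2^-j, linearly in an inequality between p-th powers, whence the
    exponent 1/p. The obstacle is that membership in D_sigma is integral information, whereas the
    Schur test needs a pointwise kernel. The L1-L^oo bound is reached through integrals of g over
    dyadic cubes, which are at most a constant times the volume of the cube. The passage from these
    averages to g itself compares two measures on dyadic cubes and then on all Borel sets. Its
    conclusion holds only almost everywhere, so the modulation steps h are restricted to powers of
    2: the countably many exceptional null sets can then be discarded together. *)

Section absC.
Context {R : realType}.
Implicit Types z w : R[i].

Lemma absCE z : absC z = Num.sqrt (complex.Re z ^+ 2 + complex.Im z ^+ 2).
Proof. by rewrite /absC normc_def. Qed.

Lemma norm_absC z : `|z| = (absC z)%:C.
Proof. by rewrite absCE normc_def. Qed.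

Lemma absC_ge0 z : 0 <= absC z. Proof. by rewrite absCE sqrtr_ge0. Qed.

Lemma absC0 : absC (0 : R[i]) = 0. Proof. by rewrite /absC normr0. Qed.

Lemma absC1 : absC (1 : R[i]) = 1. Proof. by rewrite /absC normr1. Qed.

Lemma absCM z w : absC (z * w) = absC z * absC w.
Proof. by apply: complexI; rewrite rmorphM/= -!norm_absC normrM. Qed.

Lemma absCD z w : absC (z + w) <= absC z + absC w.
Proof. by rewrite -lecR rmorphD/= -!norm_absC ler_normD. Qed.

Lemma absCN z : absC (- z) = absC z.
Proof. by rewrite /absC normrN. Qed.

Lemma absC_sum (I : Type) (s : seq I) (P : pred I) (F : I -> R[i]) :
  absC (\sum_(i <- s | P i) F i) <= \sum_(i <- s | P i) absC (F i).
Proof.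
elim/big_rec2: _ => [|i x z _ h]; first by rewrite absC0.
by rewrite (le_trans (absCD _ _))// lerD2l.
Qed.

Lemma absCX z k : absC (z ^+ k) = absC z ^+ k.
Proof. by elim: k => [|k ih]; rewrite ?expr0 ?absC1// !exprS absCM ih. Qed.

Lemma absC_real (x : R) : absC x%:C = `|x|.
Proof. by rewrite absCE/= expr0n addr0 sqrtr_sqr. Qed.

Lemma absCJ z : absC (z^*) = absC z.
Proof. by case: z => a b; rewrite !absCE/= sqrrN. Qed.

Lemma sqr_absC z : absC z ^+ 2 = complex.Re z ^+ 2 + complex.Im z ^+ 2.
Proof. by rewrite absCE sqr_sqrtr// addr_ge0// sqr_ge0. Qed.

Lemma sqr_absC_conj z : (absC z ^+ 2)%:C = z * z^*.
Proof.
rewrite sqr_absC; case: z => a b; apply/eqP; rewrite eq_complex/=.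
by apply/andP; split; apply/eqP; ring.
Qed.

Lemma norm_Re_le z : `|complex.Re z| <= absC z.
Proof. by rewrite absCE -sqrtr_sqr ler_sqrt ?lerDl ?addr_ge0 ?sqr_ge0. Qed.

Lemma norm_Im_le z : `|complex.Im z| <= absC z.
Proof. by rewrite absCE -sqrtr_sqr ler_sqrt ?lerDr ?addr_ge0 ?sqr_ge0. Qed.

Lemma absC_le z : absC z <= `|complex.Re z| + `|complex.Im z|.
Proof.
rewrite -(@ler_pXn2r _ 2) ?nnegrE ?absC_ge0 ?addr_ge0//.
rewrite sqr_absC sqrrD !real_normK ?num_real// lerD2r lerDl.
by rewrite mulrn_wge0// mulr_ge0.
Qed.

Lemma absC_cis (t : R) : absC (cis t) = 1.
Proof. by rewrite absCE/= cos2Dsin2 sqrtr1. Qed.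

Lemma cisD (s t : R) : cis (s + t) = cis s * cis t.
Proof.
rewrite /cis cosD sinD; apply/eqP; rewrite eq_complex/=.
by apply/andP; split; apply/eqP; ring.
Qed.

Lemma cis0 : cis (0 : R) = 1.
Proof. by rewrite /cis cos0 sin0. Qed.

Lemma cisN (t : R) : cis (- t) = (cis t)^*.
Proof. by rewrite /cis cosN sinN. Qed.

Lemma cisMn (t : R) k : cis (k%:R * t) = cis t ^+ k.
Proof.
elim: k => [|k ih]; first by rewrite mul0r cis0 expr0.
by rewrite -natr1 mulrDl mul1r cisD ih exprSr.
Qed.

Lemma cis_nat k : cis (2 * pi * k%:R : R) = 1.
Proof.
rewrite mulrC cisMn (_ : cis _ = 1) ?expr1n//.
by rewrite /cis mulrC mulr_natr cos2pi sin2pi.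
Qed.

Lemma sqr_absC_cisB1 (t : R) : absC (cis t - 1) ^+ 2 = 2 - 2 * cos t.
Proof.
rewrite sqr_absC/= oppr0 addr0.
have := cos2Dsin2 t; move: (cos t) (sin t) => c s h; lra.
Qed.

(** The cosine is nonpositive between a quarter turn and three quarters of a turn, so the squared
    chord 2 - 2 cos is at least 2. *)
Lemma absC_cisB1_ge1 (u : R) : 1/4 <= u <= 3/4 -> 1 <= absC (cis (2 * pi * u) - 1).
Proof.
move=> /andP[u1 u2]; have p0 := @pi_gt0 R.
have c0 : cos (2 * pi * u) <= 0.
  have -> : 2 * pi * u = (2 * pi * u - pi) + pi by ring.
  rewrite cosDpi oppr_le0 cos_ge0_pihalf//; apply/andP; split; nra.
rewrite -(@ler_pXn2r _ 2) ?nnegrE ?absC_ge0// sqr_absC_cisB1 expr1n; lra.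
Qed.

Lemma absC_expB1_le z k : absC z = 1 -> absC (z ^+ k - 1) <= k%:R * absC (z - 1).
Proof.
move=> z1; rewrite subrX1 absCM mulrC ler_wpM2r ?absC_ge0//.
rewrite (le_trans (absC_sum _ _ _))//.
under eq_bigr do rewrite absCX z1 expr1n.
by rewrite sumr_const card_ord.
Qed.

(* Some multiple [k * u] of a small [u] lies in [1/4, 3/4], where the chord
   has length at least 1, and [|z^k - 1| <= k |z - 1|]. *)
Lemma absC_cisB1_ge (u : R) : 0 < u <= 3/4 -> u <= absC (cis (2 * pi * u) - 1).
Proof.
move=> /andP[u0 u34]; have [u1|u1] := leP (1/4) u.
  by rewrite (le_trans _ (@absC_cisB1_ge1 u _)) ?u1//; lra.
(* The largest [k] with k u <= 1/2; since u < 1/4, the next multiple exceeding 1/2 forces k u >=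
   1/4. *)
pose k := (Num.truncn ((2 * u)^-1)).
have i2 : 2 < (2 * u)^-1 by rewrite -[2]invrK ltf_pV2 ?posrE; lra.
have /andP[k1 k2] : k%:R <= (2 * u)^-1 < k.+1%:R.
  by apply: truncn_itv; lra.
have h1 : k%:R * u <= 1/2.
  by move: k1; rewrite invfM -ler_pdivlMr// => /le_trans; apply; lra.
have h2 : 1/4 <= k%:R * u.
  have : 1/2 < k.+1%:R * u.
    by rewrite -ltr_pdivrMr// (le_lt_trans _ k2)// invfM; lra.
  rewrite -(natr1 k) mulrDl; lra.
have k0 : 0 < k%:R :> R.
  by rewrite ltr0n lt0n; apply: contraTN h2 => /eqP ->; rewrite mul0r -ltNge; lra.
have := absC_cisB1_ge1 (u := k%:R * u); rewrite h2 (le_trans h1)//; last by lra.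
move=> /(_ isT) h3.
have := absC_expB1_le k (absC_cis (2 * pi * u)).
rewrite -cisMn mulrCA => h4.
have h5 := le_trans h3 h4.
by rewrite -(ler_pM2l k0) (le_trans _ h5)//; lra.
Qed.

Lemma absC_cisB1_ge_norm (u : R) : u != 0 -> `|u| <= 3/4 ->
  `|u| <= absC (cis (2 * pi * u) - 1).
Proof.
move=> u0; have [u1|u1] := ger0P u => u2.
  by apply: absC_cisB1_ge; rewrite lt0r u0 u1.
have := @absC_cisB1_ge (- u); rewrite oppr_gt0 u1 u2 => /(_ isT) /le_trans; apply.
by rewrite mulrN -(@ler_pXn2r _ 2) ?nnegrE ?absC_ge0// !sqr_absC_cisB1 cosN.
Qed.

Lemma norm_sin_le (x : R) : `|sin x| <= `|x|.
Proof.
wlog x0 : x / 0 <= x.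
  move=> h; have [/h//|x0] := leP 0 x.
  by rewrite -normrN -sinN -(normrN x) h// oppr_ge0 ltW.
have [->|xn0] := eqVneq x 0; first by rewrite sin0.
have xp : 0 < x by rewrite lt0r xn0.
have [|c _ h] := @MVT R sin cos 0 x xp (fun y _ => is_derive_sin y).
  by apply: continuous_subspaceT; exact: continuous_sin.
move: h; rewrite sin0 !subr0 => ->.
by rewrite normrM ler_piMl// cos_max.
Qed.

Lemma absC_cisB1_le (t : R) : absC (cis t - 1) <= `|t|.
Proof.
rewrite -(@ler_pXn2r _ 2) ?nnegrE ?absC_ge0// sqr_absC_cisB1.
have -> : cos t = 1 - 2 * sin (t / 2) ^+ 2.
  have {1}-> : t = (t / 2) *+ 2 by rewrite -mulr_natr; field.
  by rewrite cos_mulr2n cos2sin2 -mulr_natr; ring.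
have : `|sin (t / 2)| ^+ 2 <= `|t / 2| ^+ 2.
  by rewrite ler_pXn2r ?nnegrE// norm_sin_le.
rewrite !real_normK ?num_real// expr_div_n; lra.
Qed.

Lemma absC_cisB1_le2 (t : R) : absC (cis t - 1) <= 2.
Proof. by rewrite (le_trans (absCD _ _))// absCN absC1 absC_cis; lra. Qed.

End absC.

(** * A discrete Schur test on the lattice *)

Section powR_facts.
Context {R : realType}.
Implicit Types (x y p r : R).

(** Young's inequality for [x] and l^(p-1) with exponents p and p/(p-1): the convex function x^p
    lies above its tangent at [l]. *)
Lemma powR_tangent x l p : 0 <= x -> 0 < l -> 1 < p ->
  p * l `^ (p - 1) * x <= x `^ p + (p - 1) * l `^ p.
Proof.
move=> x0 l0 p1; have p0 : 0 < p by lra.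
have q0 : 0 < p / (p - 1) by rewrite divr_gt0//; lra.
have /= := @conjugate_powR _ x (l `^ (p - 1)) p (p / (p - 1)) x0 (powR_ge0 _ _) p0 q0.
rewrite -powRrM (_ : (p - 1) * (p / (p - 1)) = p); last by field; lra.
move=> h; have : p^-1 + (p / (p - 1))^-1 = 1 by field; lra.
move=> /h; rewrite -(ler_pM2l p0).
rewrite (_ : p * (_ / _ + _) = x `^ p + (p - 1) * l `^ p); last by field; lra.
by move=> /le_trans h2; rewrite -mulrA [_ * x]mulrC h2.
Qed.

Lemma jensen_powR (I : eqType) (s : seq I) (om u : I -> R) p : 1 < p ->
  (forall i, 0 <= om i) -> (forall i, 0 <= u i) ->
  (\sum_(i <- s) om i * u i) `^ p <=
  (\sum_(i <- s) om i) `^ (p - 1) * \sum_(i <- s) om i * u i `^ p.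
Proof.
move=> p1 om0 u0; have p0 : 0 < p by lra.
set T := \sum_(i <- s) om i * u i; set O := \sum_(i <- s) om i.
have T0 : 0 <= T by apply: sumr_ge0 => i _; rewrite mulr_ge0.
have O0 : 0 <= O by apply: sumr_ge0.
have [Tz|Tn] := eqVneq T 0.
  rewrite Tz powR0; last lra.
  by rewrite mulr_ge0 ?powR_ge0// sumr_ge0// => i _; rewrite mulr_ge0 ?powR_ge0.
have Tp : 0 < T by rewrite lt0r Tn.
have [Oz|On] := eqVneq O 0.
  suff : T = 0 by move=> /eqP; rewrite (negbTE Tn).
  move/eqP : Oz; rewrite /O psumr_eq0// /T.
  elim: (s) => [|i r ih]/=; first by rewrite big_nil.
  by move=> /andP[/eqP i0 /ih h]; rewrite big_cons h i0 mul0r addr0.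
have Op : 0 < O by rewrite lt0r On.
(* The tangent inequality is summed at the weighted mean [l], where it is sharp; the weights need
   not have sum 1, which produces the factor O^(p-1). *)
pose l := T / O; have l0 : 0 < l by rewrite divr_gt0.
have : \sum_(i <- s) om i * (p * l `^ (p - 1) * u i) <=
       \sum_(i <- s) om i * (u i `^ p + (p - 1) * l `^ p).
  by apply: ler_sum => i _; rewrite ler_wpM2l// powR_tangent.
under eq_bigr do rewrite mulrCA.
under [X in _ <= X]eq_bigr do rewrite mulrDr.
rewrite big_split/= -mulr_sumr -mulr_suml -/T -/O.
set W := \sum_(i <- s) _.
have lT : l * O = T by rewrite /l mulfVK.
have -> : l `^ p = l * l `^ (p - 1) by rewrite mulr_powRB1// ltW.
have {1}-> : T = l * O by [].
have OO : O `^ (p - 1) * l `^ (p - 1) = T `^ (p - 1).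
  by rewrite -powRM ?lT ?(ltW l0)// mulrC lT.
have -> : T `^ p = T * T `^ (p - 1) by rewrite mulr_powRB1.
rewrite -OO -{1}lT => h.
have h2 : O * l * l `^ (p - 1) <= W by move: h; lra.
have := ler_wpM2l (powR_ge0 O (p - 1)) h2.
by apply: le_trans; rewrite le_eqVlt; apply/orP; left; apply/eqP; ring.
Qed.

(** With y = 1 + q and t = 1/y <= 1, the claim is a lower bound on 1 - (1+t)^(-d). It follows from
    (1+t)^d >= 1 + d t/2, a consequence of ln(1+t) >= t/2 and exp x >= 1 + x; replacing t by 1 in
    the denominator gives the constant. *)
Lemma powR_telescope d (q : nat) : 0 < d ->
  (1 + q%:R) `^ (- (1 + d)) <=
  (2 * (1 + d / 2) / d) * ((1 + q%:R) `^ (- d) - (1 + q.+1%:R) `^ (- d)) :> R.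
Proof.
move=> d0; set y : R := 1 + q%:R.
have y1 : 1 <= y by rewrite /y lerDl ler0n.
have -> : 1 + q.+1%:R = y * (1 + y^-1) :> R.
  by rewrite /y -natr1; field; apply: lt0r_neq0; rewrite /y in y1; lra.
have yi0 : 0 < y^-1 by rewrite invr_gt0; lra.
have yi1 : y^-1 <= 1 by rewrite invf_le1//; lra.
rewrite powRM//; [|lra..].
have -> : y `^ (- (1 + d)) = y `^ (- d) * y^-1.
  rewrite -powR_inv1; last lra.
  rewrite -powRD; last by apply/implyP => _; apply: lt0r_neq0; lra.
  by congr (_ `^ _); ring.
rewrite -[X in _ * (X - _)]mulr1 -mulrBr mulrCA.
apply: ler_wpM2l; first exact: powR_ge0.
move: yi0 yi1; set t := y^-1 => t0 t1.
(* From ln(1+t) = - ln(1 - t/(1+t)) >= t/(1+t), and 1 + t <= 2. *)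
have hln : t / 2 <= ln (1 + t).
  have e : - t / (1 + t) = (1 + t)^-1 - 1 by field; lra.
  have := @le_ln1Dx R (- t / (1 + t)).
  rewrite e addrCA subrr addr0 lnV ?posrE; last lra.
  have i0 : 0 < (1 + t)^-1 by rewrite invr_gt0; lra.
  rewrite ltrBDr addrC subrr => /(_ i0).
  have : t / 2 <= t / (1 + t).
    by rewrite ler_pM2l// lef_pV2 ?posrE; lra.
  have : t / (1 + t) = 1 - (1 + t)^-1 by field; lra.
  lra.
have -> : (1 + t) `^ (- d) = (expR (d * ln (1 + t)))^-1.
  rewrite /powR ifF; last by apply/negP => /eqP; lra.
  by rewrite mulNr expRN.
have : 1 + d * (t / 2) <= expR (d * ln (1 + t)).
  rewrite (le_trans _ (expR_ge1Dx _))// lerD2l ler_pM2l//.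
set E := expR _ => hE.
have pE : 0 < 1 + d * (t / 2) by rewrite addr_gt0// mulr_gt0// divr_gt0.
have : E^-1 <= (1 + d * (t / 2))^-1 by rewrite lef_pV2 ?posrE// (lt_le_trans pE).
have : d * t / (2 * (1 + d / 2)) <= 1 - (1 + d * (t / 2))^-1.
  have -> : 1 - (1 + d * (t / 2))^-1 = d * t / (2 * (1 + d * (t / 2))).
    by field; lra.
  have dt : 0 < d * t by rewrite mulr_gt0.
  rewrite ler_pM2l// lef_pV2 ?posrE; [|nra..].
  by rewrite ler_pM2l// lerD2l; nra.
move=> h1 h2; have {h1 h2}h : d * t / (2 * (1 + d / 2)) <= 1 - E^-1 by lra.
have c0 : 0 < 2 * (1 + d / 2) / d by rewrite divr_gt0//; lra.
have := ler_wpM2l (ltW c0) h.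
apply: le_trans; rewrite le_eqVlt; apply/orP; left; apply/eqP; field.
by apply/andP; split; lra.
Qed.

Lemma sum_powR_bounded d : 0 < d -> exists2 Z : R, 0 < Z &
  forall N, \sum_(0 <= q < N) (1 + q%:R) `^ (- (1 + d)) <= Z.
Proof.
move=> d0; exists (2 * (1 + d / 2) / d); first by rewrite divr_gt0//; lra.
move=> N; have c0 : 0 <= 2 * (1 + d / 2) / d by rewrite divr_ge0//; lra.
apply: (le_trans (ler_sum _ (fun q _ => powR_telescope q d0))).
rewrite -mulr_sumr; under eq_bigr do rewrite -opprB.
rewrite sumrN telescope_sumr// opprB addr0 powR1 ler_piMr// lerBlDr lerDl powR_ge0.
Qed.

End powR_facts.

(** * Summability over Z^n and the Schur test *)

Section lattice_sums.
Context {R : realType} {n : nat}.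
Implicit Types (k m d : 'rV[int]_n) (s : seq 'rV[int]_n).

Definition supn d : nat := \max_(i < n) absz (d ord0 i).

Lemma le_supn d i : (absz (d ord0 i) <= supn d)%N.
Proof. exact: (leq_bigmax (F := fun i => absz (d ord0 i))). Qed.

Lemma supnN d : supn (- d) = supn d.
Proof. by apply: eq_bigr => i _; rewrite mxE abszN. Qed.

(** Points of [-N, N)^n are encoded by finite functions so that a sum of products over the box
    becomes a product of one-dimensional sums. *)
Definition box_point N (f : {ffun 'I_n -> 'I_(N + N)}) : 'rV[int]_n :=
  \row_i ((f i)%:Z - N%:Z).

Definition box_seq N : seq 'rV[int]_n :=
  [seq box_point f | f <- index_enum {ffun 'I_n -> 'I_(N + N)}].

Lemma box_point_inj N : injective (@box_point N).
Proof.
move=> f g /rowP h; apply/ffunP => i; apply: val_inj.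
by have := h i; rewrite !mxE => /eqP; rewrite (inj_eq (addIr _)) => /eqP[].
Qed.

Lemma box_seq_uniq N : uniq (box_seq N).
Proof. by rewrite map_inj_uniq ?index_enum_uniq//; exact: box_point_inj. Qed.

Lemma mem_box_seq N d :
  (d \in box_seq N) = [forall i, (- N%:Z <= d ord0 i) && (d ord0 i < N%:Z)].
Proof.
apply/mapP/forallP => [[f _ ->] i|h].
  by rewrite !mxE; case: (f i) => x xN /=; lia.
have h2 i : (absz (d ord0 i + N%:Z)%R < N + N)%N by have := h i; lia.
exists [ffun i => Ordinal (h2 i)]; first by rewrite mem_index_enum.
by apply/rowP => i; rewrite mxE ffunE/=; have := h i; rewrite [ord0]ord1; lia.
Qed.

Lemma sub_box_seq s : {subset s <= box_seq (\max_(d <- s) supn d).+1}.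
Proof.
move=> d ds; rewrite mem_box_seq; apply/forallP => i.
have := le_supn d i; have : (supn d <= \max_(d <- s) supn d)%N.
  by apply: (leq_bigmax_seq (P := xpredT) (F := supn)).
lia.
Qed.

Lemma ler_sum_subset (I : eqType) (s t : seq I) (F : I -> R) :
  uniq s -> uniq t -> {subset s <= t} -> (forall i, 0 <= F i) ->
  \sum_(i <- s) F i <= \sum_(i <- t) F i.
Proof.
move=> us ut st F0.
have p : perm_eq s [seq i <- t | i \in s].
  apply: uniq_perm => //; first exact: filter_uniq.
  by move=> i; rewrite mem_filter; case: (boolP (i \in s)) => // /st ->.
rewrite (perm_big _ p)/= big_filter [leRHS](bigID (mem s))/= lerDl.
exact: sumr_ge0.
Qed.

(** Since the sup norm dominates every coordinate, the summand is at most the product over i of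
    (1+|d_i|)^(-(1+e/n)); the sum over a box then factors into n convergent one-dimensional sums. *)
Lemma lattice_sum_bounded (e : R) : 0 < e -> (0 < n)%N ->
  exists2 Z : R, 0 < Z & forall s, uniq s ->
    \sum_(d <- s) (1 + (supn d)%:R) `^ (- (n%:R + e)) <= Z.
Proof.
move=> e0 n0; have n0' : 0 < n%:R :> R by rewrite ltr0n.
have de0 : 0 < e / n%:R by rewrite divr_gt0.
have [Z Z0 hZ] := sum_powR_bounded de0.
pose g (t : int) : R := (1 + (absz t)%:R) `^ (- (1 + e / n%:R)).
have g0 t : 0 <= g t by exact: powR_ge0.
(* The integers from -N to N-1 are split at 0; each half is a partial sum of the one-sided series,
   the negative one starting at 1. *)
have gN N : \sum_(i < N + N) g (i%:Z - N%:Z) <= 2 * Z.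
  rewrite big_split_ord/= mulr2n mulrDl mul1r; apply: lerD; last first.
    apply: le_trans (hZ N); rewrite big_mkord; apply: ler_sum => i _.
    by rewrite /g (_ : absz _ = i)//; lia.
  apply: le_trans (hZ N.+1); rewrite big_nat_recl// ler_wpDl ?powR_ge0//.
  rewrite -(big_mkord xpredT (fun i => g (i%:Z - N%:Z))).
  rewrite big_nat_rev/= add0n; apply: ler_sum_nat => i /andP[_ iN].
  by rewrite /g (_ : absz _ = i.+1)//; lia.
exists ((2 * Z) ^+ n); first by rewrite exprn_gt0// mulr_gt0.
move=> s us.
pose h d : R := \prod_(i < n) g (d ord0 i).
have h0 d : 0 <= h d by apply: prodr_ge0.
have le_h d : (1 + (supn d)%:R) `^ (- (n%:R + e)) <= h d.
  have -> : - (n%:R + e) = - (1 + e / n%:R) * n%:R by field; lra.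
  rewrite powRrM powR_mulrn ?powR_ge0//.
  rewrite -[n in _ ^+ n]card_ord -prodr_const; apply: ler_prod => i _.
  rewrite powR_ge0/= /g !powRN lef_pV2 ?posrE ?powR_gt0//.
  apply: ge0_ler_powR; rewrite ?nnegrE ?addr_ge0// ?(ltW de0)//.
  by rewrite lerD2l ler_nat le_supn.
apply: (le_trans (ler_sum _ (fun d _ => le_h d))).
apply: (le_trans (ler_sum_subset us (box_seq_uniq _) (@sub_box_seq s) h0)).
move: (\max_(_ <- s) _).+1 => N; rewrite big_map.
under eq_bigr => f _ do (rewrite /h; under eq_bigr => i _ do rewrite mxE).
rewrite -(bigA_distr_bigA (fun (i : 'I_n) (j : 'I_(N + N)) => g (j%:Z - N%:Z))).
rewrite -[n in _ ^+ n]card_ord -prodr_const; apply: ler_prod => i _.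
by rewrite gN andbT sumr_ge0.
Qed.

(* One factor [(1 + |k - m|)^(-n)] of the kernel absorbs the growth allowed by the
   hypothesis on [W], [v] and [F]; Jensen's inequality for the summable remaining
   factor [(1 + |k - m|)^(-n - e)] does the rest. *)
Lemma lattice_schur (p e : R) : 0 < e -> (0 < n)%N -> 1 < p ->
  exists2 Z : R, 0 < Z &
  forall (G : R) (W v F : 'rV[int]_n -> R) (s t : seq 'rV[int]_n),
    0 <= G -> (forall k, 0 <= W k) -> (forall k, 0 <= v k) -> (forall k, 0 <= F k) ->
    uniq s -> uniq t ->
    (forall k m, W k * v m `^ p <= G * (1 + (supn (k - m))%:R) `^ (n%:R * p) * F m) ->
    \sum_(k <- s) W k *
       (\sum_(m <- t) (1 + (supn (k - m))%:R) `^ (- (2 * n%:R + e)) * v m) `^ p <=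
    Z * G * \sum_(m <- t) F m.
Proof.
move=> e0 n0 p1; have [Z Z0 hZ] := lattice_sum_bounded e0 n0.
have p0 : 0 < p by lra.
exists (Z `^ (p - 1) * Z); first by rewrite mulr_gt0// powR_gt0.
move=> G W v F s t G0 W0 v0 F0 us ut H.
pose D k m : R := 1 + (supn (k - m))%:R.
have D0 k m : 0 < D k m by rewrite /D ltr_wpDr.
pose om k m := D k m `^ (- (n%:R + e)).
have om0 k m : 0 <= om k m by exact: powR_ge0.
have sum_om_l k : \sum_(m <- t) om k m <= Z.
  rewrite -(big_map (fun m => k - m) xpredT (fun d => (1 + (supn d)%:R) `^ (- (n%:R + e)))).
  by apply: hZ; rewrite map_inj_uniq// => x y /addrI /oppr_inj.
have sum_om_r m : \sum_(k <- s) om k m <= Z.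
  rewrite -(big_map (fun k => k - m) xpredT (fun d => (1 + (supn d)%:R) `^ (- (n%:R + e)))).
  by apply: hZ; rewrite map_inj_uniq// => x y /addIr.
have step k : W k * (\sum_(m <- t) D k m `^ (- (2 * n%:R + e)) * v m) `^ p <=
    Z `^ (p - 1) * \sum_(m <- t) om k m * (G * F m).
  pose u m := D k m `^ (- n%:R) * v m.
  have u0 m : 0 <= u m by rewrite mulr_ge0// powR_ge0.
  have -> : \sum_(m <- t) D k m `^ (- (2 * n%:R + e)) * v m = \sum_(m <- t) om k m * u m.
    apply: eq_bigr => m _; rewrite /om /u mulrA -powRD; last first.
      by apply/implyP => _; rewrite lt0r_neq0.
    by congr (_ `^ _ * _); ring.
  have := jensen_powR t p1 (om0 k) u0.
  move=> /(ler_wpM2l (W0 k)) /le_trans; apply.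
  rewrite [leLHS]mulrCA [W k * _]mulr_sumr; apply: ler_pM.
  - exact: powR_ge0.
  - by apply: sumr_ge0 => m _; rewrite !mulr_ge0 ?powR_ge0.
  - apply: ge0_ler_powR; rewrite ?nnegrE//; [lra| |lra].
    exact: sumr_ge0.
  - apply: ler_sum => m _; rewrite mulrCA ler_wpM2l//.
    rewrite /u powRM ?powR_ge0// mulrCA -powRrM.
    have := ler_wpM2l (powR_ge0 (D k m) (- n%:R * p)) (H k m).
    move=> /le_trans; apply; rewrite mulrA [_ * (G * _)]mulrCA -powRD; last first.
      by apply/implyP => _; rewrite lt0r_neq0.
    by rewrite (_ : - n%:R * p + n%:R * p = 0) ?powRr0 ?mulr1//; ring.
apply: (le_trans (ler_sum _ (fun k _ => step k))).
rewrite -mulr_sumr -!mulrA ler_wpM2l ?powR_ge0//.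
rewrite exchange_big/= mulrA mulr_sumr; apply: ler_sum => m _.
by rewrite -mulr_suml -mulrA ler_wpM2r// mulr_ge0.
Qed.

End lattice_sums.

(** * Boxes and dyadic cubes *)

Section boxes.
Context {R : realType} {n : nat}.
Implicit Types (al be x : 'rV[R]_n) (k : 'rV[int]_n) (j : int).

Definition box al be : set 'rV[R]_n :=
  [set x | forall i, al ord0 i <= x ord0 i < be ord0 i].

Lemma measurable_coord_lt (i : 'I_n) (c : R) :
  measurable [set x : 'rV[R]_n | x ord0 i < c].
Proof.
have := measurable_rV_coord (T := R) i measurableT (measurable_itv `]-oo, c[).
rewrite setTI; congr measurable; apply/seteqP; split => x /=; by rewrite in_itv/=.
Qed.

(** Induction principle for Borel sets: the rays ]-oo, c[ generate the Borel sets of the line, so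
    their preimages under the coordinates generate those of R^n. *)
Lemma rV_measurable_ind (S : set (set 'rV[R]_n)) : sigma_algebra setT S ->
  (forall (i : 'I_n) (c : R), S [set x | x ord0 i < c]) ->
  forall A, measurable A -> S A.
Proof.
move=> SS hS; apply: smallest_sub => //.
rewrite -bigcup_seq => A [i _ [B mB <-]]; rewrite setTI.
have [S0 SC SU] := SS.
have : [set X : set R | S (rV_coord i @^-1` X)] B; last by [].
have {mB} : (@measurable_realfun.RGenInftyO.G R).-sigma.-measurable B.
  by rewrite -measurable_realfun.RGenInftyO.measurableE.
move: B.
apply: smallest_sub; first split.
- by rewrite /= preimage_set0.
- move=> X /= hX; rewrite setTD preimage_setC -setTD; exact: SC.
- by move=> F hF /=; rewrite preimage_bigcup; exact: SU.
move=> X [c ->].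
have e : rV_coord i @^-1` `]-oo, c[%classic = [set x : 'rV[R]_n | x ord0 i < c].
  by apply/seteqP; split => x /=; rewrite in_itv.
by rewrite /mkset e; exact: hS.
Qed.

Lemma boxE al be : box al be =
  \big[setI/setT]_(i < n) (~` [set x | x ord0 i < al ord0 i] `&` [set x | x ord0 i < be ord0 i]).
Proof.
rewrite -bigcap_seq; apply/seteqP; split => x h.
  move=> i _; have /andP[h1 h2] := h i; split => //=.
  by apply/negP; rewrite -leNgt.
move=> i; have [/= h1 h2] := h i (mem_index_enum _).
by rewrite h2 andbT leNgt; apply/negP.
Qed.

Lemma measurable_box al be : measurable (box al be).
Proof.
rewrite boxE; elim/big_ind: _ => [|A B mA mB|i _].
- exact: measurableT.
- exact: measurableI.
apply: measurableI.
  by apply: measurableC; exact: measurable_coord_lt.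
exact: measurable_coord_lt.
Qed.

Definition is_box : set (set 'rV[R]_n) := [set A | exists al be, A = box al be].

Lemma setI_closed_box : setI_closed is_box.
Proof.
move=> _ _ [a [b ->]] [c [d ->]].
exists (\row_i Num.max (a ord0 i) (c ord0 i)), (\row_i Num.min (b ord0 i) (d ord0 i)).
apply/seteqP; split => x /=.
  move=> [h1 h2] i; rewrite !mxE ge_max lt_min.
  by have /andP[-> ->] := h1 i; have /andP[-> ->] := h2 i.
move=> h; split => i; have := h i; rewrite !mxE ge_max lt_min.
  by move=> /andP[/andP[-> _] /andP[-> _]].
by move=> /andP[/andP[_ ->] /andP[_ ->]].
Qed.

Definition cbox (N : nat) : set 'rV[R]_n := box (const_mx (- N%:R)) (const_mx N%:R).

Lemma mem_cbox N x : cbox N x <-> forall i, - N%:R <= x ord0 i < N%:R.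
Proof. by split => h i; have := h i; rewrite !mxE. Qed.

Lemma exists_nat_coord_lt x : exists N : nat, forall i, `|x ord0 i| < N%:R.
Proof.
exists (Num.truncn (\sum_i `|x ord0 i|)).+1 => i.
have h : 0 <= \sum_i `|x ord0 i| by apply: sumr_ge0.
apply: le_lt_trans (truncnS_gt _).
by rewrite (bigD1 i)//= lerDl sumr_ge0.
Qed.

Lemma bigcup_cbox : \bigcup_N cbox N = setT.
Proof.
apply/seteqP; split => // x _; have [N hN] := exists_nat_coord_lt x.
exists N => //; apply/mem_cbox => i; have := hN i; rewrite ltr_norml.
by move=> /andP[/ltW -> ->].
Qed.

Lemma measurable_rV_box : @measurable _ 'rV[R]_n = <<s is_box >>.
Proof.
apply/seteqP; split; last first.
  apply: smallest_sub; first exact: sigma_algebra_measurable.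
  by move=> _ [a [b ->]]; exact: measurable_box.
move=> A; apply: rV_measurable_ind; first exact: smallest_sigma_algebra.
move=> i c; have [_ _ sU] := smallest_sigma_algebra setT is_box.
suff -> : (fun x => [set x0 : 'rV[R]_n | x0 ord0 i < c] x) = \bigcup_N
    box (const_mx (- N%:R)) (\row_l if l == i then c else N%:R).
  by apply: sU => N; apply: sub_sigma_algebra; do 2 eexists.
apply/seteqP; split => x /=.
  move=> xc; have [N hN] := exists_nat_coord_lt x; exists N => //= l.
  rewrite !mxE; have := hN l; rewrite ltr_norml => /andP[/ltW -> h2] /=.
  by case: eqP => [->|].
by move=> [N _ /(_ i)]; rewrite !mxE eqxx => /andP[].
Qed.

(** Half-open boxes are stable under intersection, generate the measurable sets and contain an
    exhausting sequence, so the uniqueness theorem for measures applies. *)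
Lemma measure_rV_unique (m1 m2 : {measure set 'rV[R]_n -> \bar R}) :
  (forall al be, m1 (box al be) = m2 (box al be)) ->
  (forall al be, (m1 (box al be) < +oo)%E) ->
  forall A, measurable A -> m1 A = m2 A.
Proof.
move=> h hoo A mA; apply: (measure_unique is_box cbox) => //.
- exact: measurable_rV_box.
- exact: setI_closed_box.
- by move=> N; do 2 eexists.
- exact: bigcup_cbox.
- by move=> _ [a [b ->]].
- by move=> k; exact: hoo.
Qed.

End boxes.

Section box_measure.
Context {R : realType}.
Local Open Scope ereal_scope.

Lemma lebesgue_rV_box n (al be : 'rV[R]_n) : (forall i, al ord0 i <= be ord0 i)%R ->
  lebesgue_rV n (box al be) = (\prod_(i < n) (be ord0 i - al ord0 i))%:E.
Proof.
elim: n al be => [|n ih] al be h.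
  rewrite big_ord0 /= diracE mem_set//; by case.
rewrite /= /lebesgue_rV_step /pushforward.
pose al' : 'rV[R]_n := \row_i al ord0 (lift ord0 i).
pose be' : 'rV[R]_n := \row_i be ord0 (lift ord0 i).
rewrite (_ : _ @^-1` _ = box al' be' `*` `[al ord0 ord0, be ord0 ord0[%classic); last first.
  apply/seteqP; split => -[y t] /=.
    move=> H; split.
      by move=> i; have := H (lift ord0 i); rewrite !mxE liftK.
    by rewrite in_itv/=; have := H ord0; rewrite mxE unlift_none.
  rewrite in_itv/= => -[H1 H2] i; rewrite mxE.
  have [l ->|->] := unliftP ord0 i; rewrite /=; last by [].
  by have := H1 l; rewrite !mxE.
rewrite product_measure1E; [|exact: measurable_box|exact: measurable_itv].
rewrite ih; last by move=> i; rewrite !mxE.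
rewrite [X in _ * X](lebesgue_measure_itv `[al ord0 ord0, be ord0 ord0[)/= big_ord_recl.
rewrite (eq_bigr (fun i : 'I_n => be ord0 (lift ord0 i) - al ord0 (lift ord0 i))%R); last first.
  by move=> i _; rewrite !mxE.
case: ifPn => [_|]; first by rewrite -EFinB -EFinM mulrC.
rewrite lte_fin -leNgt => h0; have -> : be ord0 ord0 = al ord0 ord0.
  by apply/eqP; rewrite eq_le h0 h.
by rewrite mule0 subrr mul0r.
Qed.

Lemma lebesgue_rV_box_lty n (al be : 'rV[R]_n) : lebesgue_rV n (box al be) < +oo.
Proof.
pose be' := \row_i Num.max (al ord0 i) (be ord0 i) : 'rV[R]_n.
have h : lebesgue_rV n (box al be) <= lebesgue_rV n (box al be').
  apply: le_measure; rewrite ?inE; [exact: measurable_box..|].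
  by move=> x h i; have := h i; rewrite mxE lt_max => /andP[-> ->]; rewrite orbT.
apply: (le_lt_trans h); rewrite lebesgue_rV_box ?ltry// => i.
by rewrite mxE le_max lexx.
Qed.

Lemma lebesgue_rV_cube n (x : 'rV[R]_n) (l : R) : (0 <= l)%R ->
  lebesgue_rV n (cube x l) = (l ^+ n)%:E.
Proof.
move=> l0; have -> : cube x l = box x (x + const_mx l).
  by apply/seteqP; split => y h i; have := h i; rewrite !mxE.
rewrite lebesgue_rV_box => [|i]; last by rewrite !mxE lerDl.
under eq_bigr do rewrite !mxE addrAC subrr add0r.
by rewrite prodr_const card_ord.
Qed.

Lemma measurable_cube n (x : 'rV[R]_n) (l : R) : measurable (cube x l).
Proof.
have -> : cube x l = box x (x + const_mx l); last exact: measurable_box.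
by apply/seteqP; split => y h i; have := h i; rewrite !mxE.
Qed.

End box_measure.

(** * Dyadic cubes and their unions *)

Section dyadic_cubes.
Context {R : realType} {n : nat}.
Implicit Types (x : 'rV[R]_n) (k : 'rV[int]_n) (j : int).

Lemma pow2_gt0 j : 0 < (2 : R) ^ j.
Proof. by rewrite exprz_gt0. Qed.

Definition dyadic_index j x : 'rV[int]_n := \row_i Num.floor ((2 : R) ^ j * x ord0 i).

Lemma dyadic_indexP j k x : dyadic_index j x = k <->
  forall i, (k ord0 i)%:~R <= (2 : R) ^ j * x ord0 i < (k ord0 i)%:~R + 1.
Proof.
split => [<- i|h]; first by rewrite mxE; have := real_floor_itv (num_real ((2 : R) ^ j * x ord0 i)); rewrite intrD.
apply/rowP => i; rewrite mxE; apply/floor_def; rewrite intrD.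
exact: h.
Qed.

Lemma dyadic_cubeP j k x : dyadic_cube j k x <-> dyadic_index j x = k.
Proof.
rewrite dyadic_indexP; have p0 := pow2_gt0 j; split.
  move=> [u /= hu <-] i; rewrite !mxE -invr_expz mulVKf ?gt_eqF//.
  by have /andP[h1 h2] := hu i; rewrite lerDl h1 ltrD2l h2.
move=> h; exists ((2 : R) ^ j *: x - zvec k).
  move=> i /=; have := h i; rewrite !mxE subr_ge0 ltrBlDl.
  by move=> /andP[-> ->].
by rewrite addrC subrK scalerA -invr_expz mulVf ?gt_eqF// scale1r.
Qed.

Lemma dyadic_cube_cube j k :
  dyadic_cube j k = cube ((2 : R) ^ (- j) *: zvec k) ((2 : R) ^ (- j)).
Proof.
have e (P y z : R) : 0 < P ->
    (P^-1 * z <= y < P^-1 * z + P^-1) = (z <= P * y < z + 1).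
  move=> P0; rewrite ler_pdivrMl//; congr (_ && _).
  by rewrite -[X in _ * _ + X]mulr1 -mulrDr ltr_pdivlMl.
apply/seteqP; split => x.
  move=> /dyadic_cubeP/dyadic_indexP h i; have := h i.
  by rewrite !mxE -invr_expz e// pow2_gt0.
move=> h; apply/dyadic_cubeP/dyadic_indexP => i; have := h i.
by rewrite !mxE -invr_expz e// pow2_gt0.
Qed.

Lemma measurable_dyadic_cube j k : measurable (dyadic_cube j k : set 'rV[R]_n).
Proof. by rewrite dyadic_cube_cube; exact: measurable_cube. Qed.

Lemma lebesgue_rV_dyadic j k :
  lebesgue_rV n (dyadic_cube j k : set 'rV[R]_n) = (((2 : R) ^ (- j)) ^+ n)%:E.
Proof. by rewrite dyadic_cube_cube lebesgue_rV_cube// ltW// pow2_gt0. Qed.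

Lemma trivIset_dyadic_cube j (D : set 'rV[int]_n) :
  trivIset D (dyadic_cube j : _ -> set 'rV[R]_n).
Proof. by move=> k m _ _ [x [/dyadic_cubeP <- /dyadic_cubeP <-]]. Qed.

(** Written as a preimage under [dyadic_index], so that Boolean operations on index sets and on
    unions of cubes agree by computation. *)
Definition dyadic_set j (Z : set 'rV[int]_n) : set 'rV[R]_n :=
  [set x | Z (dyadic_index j x)].

Lemma dyadic_setE j Z : dyadic_set j Z = \bigcup_(k in Z) dyadic_cube j k.
Proof.
apply/seteqP; split => [x h|x [k Zk /dyadic_cubeP e]]; last first.
  by rewrite /dyadic_set/= e.
by exists (dyadic_index j x) => //; exact/dyadic_cubeP.
Qed.

Lemma measurable_dyadic_set j Z : measurable (dyadic_set j Z).
Proof.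
rewrite dyadic_setE bigcup_mkcond; apply: countable_bigcupT_measurable.
  exact: countableP.
by move=> k; case: ifP => _; [exact: measurable_dyadic_cube|exact: measurable0].
Qed.

Lemma dyadic_setI j Z Z' : dyadic_set j Z `&` dyadic_set j Z' = dyadic_set j (Z `&` Z').
Proof. by []. Qed.

Lemma dyadic_set_refine (m l : nat) Z : (m <= l)%N ->
  exists Z', dyadic_set m Z = dyadic_set l Z'.
Proof.
(* The coarse index is the fine one divided by 2^(l-m); Euclidean division rounds down for negative
   indices too, in agreement with the floor. *)
move=> ml; pose f k : 'rV[int]_n := \row_i (k ord0 i %/ 2 ^+ (l - m))%Z.
exists (f @^-1` Z); apply/seteqP.
suff e x : dyadic_index m x = f (dyadic_index l x) by split => x; rewrite /dyadic_set/= e.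
have p0 : 0 < (2 : R) ^+ (l - m) by rewrite exprn_gt0.
apply/dyadic_indexP => i; rewrite !mxE -!exprnP.
set t : R := x ord0 i.
have e2 : (2 : R) ^+ l * t = 2 ^+ (l - m) * (2 ^+ m * t).
  by rewrite mulrA -exprD subnK.
have /andP[] := real_floor_itv (num_real ((2 : R) ^+ l * t)).
move: (Num.floor _) => q q1 q2.
set b : int := 2 ^+ (l - m).
have b0 : 0 < b by rewrite /b; lia.
have bR : b%:~R = 2 ^+ (l - m) :> R by rewrite /b rmorphXn.
have h1 : (q %/ b)%Z * b <= q by apply: lez_floor; rewrite gt_eqF.
have h2 : q + 1 <= ((q %/ b)%Z + 1) * b by have := ltz_ceil q b0; lia.
apply/andP; split.
  by rewrite -(ler_pM2l p0) -e2 (le_trans _ q1)// -bR -intrM ler_int mulrC.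
rewrite -(ltr_pM2l p0) -e2 (lt_le_trans q2)// -bR.
have <- : ((q %/ b)%Z + 1)%:~R = (q %/ b)%Z%:~R + 1 :> R by rewrite intrD.
by rewrite -intrM ler_int mulrC.
Qed.

End dyadic_cubes.

(** * Affine changes of variable *)

Section affine_change.
Context {R : realType} {n : nat}.
Local Notation mu := (@lebesgue_rV R n).
Local Open Scope ereal_scope.

Lemma box_empty (al be : 'rV[R]_n) i : (be ord0 i < al ord0 i)%R -> box al be = set0.
Proof.
move=> h; apply/seteqP; split => x // /(_ i) /andP[h1 h2].
by have := le_lt_trans h1 (lt_trans h2 h); rewrite ltxx.
Qed.

Lemma measurable_affine (s : R) (c : 'rV[R]_n) :
  measurable_fun setT (fun x : 'rV[R]_n => s *: x - c)%R.
Proof.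
apply: measurable_fun_rVP => i.
rewrite (_ : _ \o _ = (fun x => s * rV_coord i x - c ord0 i)%R); last first.
  by apply/funext => x; rewrite /= /rV_coord !mxE.
apply: measurable_funB => //; apply: measurable_funM => //.
exact: measurable_rV_coord.
Qed.

Lemma lebesgue_rV_affine (s : R) (c : 'rV[R]_n) (A : set 'rV[R]_n) : (0 < s)%R ->
  measurable A ->
  mu ((fun x => s *: x - c)%R @^-1` A) = ((s ^+ n)^-1)%:E * mu A.
Proof.
move=> s0 mA; have sn0 : (0 <= (s ^+ n)^-1)%R by rewrite invr_ge0 exprn_ge0// ltW.
pose phi := (fun x => s *: x - c)%R : 'rV[R]_n -> 'rV[R]_n.
have mphi : measurable_fun setT phi by exact: measurable_affine.
pose M1 : {measure set 'rV[R]_n -> \bar R} :=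
  measure_function_pushforward__canonical__measure_function_Measure mu mphi.
pose m2 := mscale (NngNum sn0) mu.
have boxEq al be : pushforward mu phi (box al be) = m2 (box al be).
  have [h|] := pselect (forall i, al ord0 i <= be ord0 i)%R; last first.
    move=> /existsNP[i /negP]; rewrite -ltNge => h.
    by rewrite (box_empty h) !measure0.
  rewrite /m2 /mscale/= lebesgue_rV_box// /pushforward.
  rewrite (_ : _ @^-1` _ = box (s^-1 *: (al + c))%R (s^-1 *: (be + c))%R); last first.
    have e x : (box al be (phi x) <-> forall i, ((s^-1 *: (al + c)) ord0 i <=
        x ord0 i < (s^-1 *: (be + c)) ord0 i)%R).
      by split => hx l; have := hx l; rewrite /phi !mxE lerBrDr ltrBlDr
        ler_pdivrMl// ltr_pdivlMl.
    by apply/seteqP; split => x /e.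
  rewrite lebesgue_rV_box => [|i]; last first.
    by rewrite !mxE ler_pM2l ?invr_gt0// lerD2r h.
  rewrite -EFinM; congr _%:E.
  rewrite -[n in (s ^+ n)%R]card_ord -prodr_const -prodfV -big_split/=.
  by apply: eq_bigr => i _; rewrite !mxE; ring.
apply: (@measure_rV_unique _ _ M1 m2 boxEq _ A mA) => al be.
by rewrite [M1 _]boxEq /m2 /mscale/= lte_mul_pinfty//; exact: lebesgue_rV_box_lty.
Qed.

Lemma ae_lebesgue_rV_affine (s : R) (c : 'rV[R]_n) (P : 'rV[R]_n -> Prop) : (0 < s)%R ->
  {ae mu, forall x, P x} -> {ae mu, forall x, P (s *: x - c)%R}.
Proof.
move=> s0 [N [mN N0 PN]]; exists ((fun x => s *: x - c)%R @^-1` N); split.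
- by rewrite -[X in measurable X]setTI; exact: measurable_affine.
- by rewrite lebesgue_rV_affine// N0 mule0.
- by move=> x /= h; apply: PN.
Qed.

End affine_change.

(** * Approximation of Borel sets by unions of dyadic cubes *)

Section dyadic_approximation.
Context {R : realType} {n : nat}.
Local Open Scope ereal_scope.
Implicit Types (A B D : set 'rV[R]_n).

Let sd A B := (A `\` B) `|` (B `\` A).

Let measurable_sd A B : measurable A -> measurable B -> measurable (sd A B).
Proof. by move=> mA mB; apply: measurableU; exact: measurableD. Qed.

Variables (nu : {measure set 'rV[R]_n -> \bar R}).
Hypothesis nu_fin : nu setT < +oo.

Let nu_lty A : measurable A -> nu A < +oo.
Proof.
move=> mA; apply: le_lt_trans nu_fin.
by apply: le_measure; rewrite ?inE//; exact: measurableT.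
Qed.

Let approx A := measurable A /\ forall e : R, (0 < e)%R ->
  exists (m : nat) (Z : set 'rV[int]_n), nu (sd A (dyadic_set m Z)) < e%:E.

Let approxU A B : approx A -> approx B -> approx (A `|` B).
Proof.
move=> [mA hA] [mB hB]; split; first exact: measurableU.
move=> e e0; have e20 : (0 < e / 2)%R by rewrite divr_gt0.
have [m [Z hZ]] := hA _ e20; have [l [Y hY]] := hB _ e20.
have [Z' eZ] := dyadic_set_refine Z (leq_maxl m l) (R := R).
have [Y' eY] := dyadic_set_refine Y (leq_maxr m l) (R := R).
exists (maxn m l), (Z' `|` Y').
rewrite (_ : dyadic_set _ (Z' `|` Y') = dyadic_set m Z `|` dyadic_set l Y); last first.
  by rewrite eZ eY.
have mZ := @measurable_dyadic_set R n m Z; have mY := @measurable_dyadic_set R n l Y.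
have : nu (sd A (dyadic_set m Z)) + nu (sd B (dyadic_set l Y)) < e%:E.
  by rewrite [e in X in _ < X]splitr EFinD; apply: lteD.
apply: le_lt_trans.
have mAZ := measurable_sd mA mZ; have mBY := measurable_sd mB mY.
apply: (le_trans _ (measureU2 nu mAZ mBY)).
apply: le_measure; rewrite ?inE//.
- by apply: measurable_sd; exact: measurableU.
- exact: measurableU.
by move=> x; rewrite /sd /=; tauto.
Qed.

(** Complements leave the symmetric difference unchanged. A countable union is first replaced by a
    finite one, the remainder being small by continuity from above, which is where finiteness of
    [nu] enters; finite unions are refined to a common scale. *)
Let approx_sigma : sigma_algebra setT approx.
Proof.
have a0 : approx set0.
  split; first exact: measurable0.
  move=> e e0; exists 0%N, set0; rewrite (_ : sd _ _ = set0) ?measure0//.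
  by apply/seteqP; split => x; rewrite /sd /dyadic_set/=; tauto.
split => //.
  move=> A [mA hA]; split; first by rewrite setTD; exact: measurableC.
  move=> e e0; have [m [Z hZ]] := hA _ e0; exists m, (~` Z).
  rewrite (_ : sd _ _ = sd A (dyadic_set m Z))//.
  apply/seteqP; split => x; rewrite /sd /dyadic_set/=.
    by case: (pselect (A x)); case: (pselect (Z (dyadic_index m x))); tauto.
  by tauto.
move=> F hF; have mF i : measurable (F i) by case: (hF i).
split; first exact: bigcupT_measurable.
move=> e e0; have e20 : (0 < e / 2)%R by rewrite divr_gt0.
set U := \bigcup_k F k; pose B N := \big[setU/set0]_(i < N) F i.
have aB N : approx (B N).
  by rewrite /B; elim/big_ind: _ => [//||i _]; [exact: approxU|exact: hF].
have mB N : measurable (B N) by case: (aB N).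
have mU : measurable U by exact: bigcupT_measurable.
pose G N := U `\` B N.
have mG N : measurable (G N) by exact: measurableD.
have G0 : \bigcap_N G N = set0.
  apply/seteqP; split => // x hx; have [[i _ Fi] _] := hx 0%N I.
  have [_] := hx i.+1 I; apply; rewrite /B big_ord_recr /=; by right.
have cG : nu (G N) @[N --> \oo] --> nu (\bigcap_N G N).
  apply: nonincreasing_cvg_mu => //.
  - exact: nu_lty.
  - by rewrite G0; exact: measurable0.
  - move=> p q pq; apply/subsetPset; apply: setDS.
    by rewrite /B; exact: subset_bigsetU.
rewrite G0 measure0 in cG.
have : \forall N \near \oo, nu (G N) < (e / 2)%:E.
  apply: (cG [set x | x < (e / 2)%:E]).
  by apply: open_nbhs_nbhs; split; [exact: open_ereal_lt_ereal|rewrite /= lte_fin].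
move=> [N _ /(_ N (leqnn _))/= hN].
have [m [Z hZ]] := (aB N).2 _ e20.
exists m, Z.
have : nu (G N) + nu (sd (B N) (dyadic_set m Z)) < e%:E.
  by rewrite [e in X in _ < X]splitr EFinD; apply: lteD.
have mZ := @measurable_dyadic_set R n m Z.
have mBZ := measurable_sd (mB N) mZ.
apply: le_lt_trans; apply: (le_trans _ (measureU2 nu (mG N) mBZ)).
apply: le_measure; rewrite ?inE//.
- exact: measurable_sd.
- exact: measurableU.
have BU : B N `<=` U.
  by rewrite /B -bigcup_mkord => x [i _ Fi]; exists i.
move=> x; have := BU x; rewrite /sd /G /=.
by case: (pselect (B N x)); tauto.
Qed.

Let approx_dyadic m Z : approx (dyadic_set (Posz m) Z).
Proof.
split; first exact: measurable_dyadic_set.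
move=> e e0; exists m, Z; rewrite (_ : sd _ _ = set0) ?measure0//.
by rewrite /sd setDv setU0.
Qed.

(** Once 2^m (c - x_i) > 1, the integer parts of 2^m x_i and 2^m c differ, so the half-space is a
    countable union, over the scales, of dyadic sets. *)
Let approx_lt (i : 'I_n) (c : R) : approx [set x | (x ord0 i < c)%R].
Proof.
suff -> : (fun x => [set x0 : 'rV[R]_n | (x0 ord0 i < c)%R] x) =
    \bigcup_(m : nat) dyadic_set m [set k | (k ord0 i < Num.floor ((2 : R) ^ m%:Z * c))%R].
  have [_ _] := approx_sigma; apply => m; exact: approx_dyadic.
apply/seteqP; split => x /=.
  move=> xc; pose m := Num.truncn ((c - x ord0 i)^-1)%R.
  have d0 : (0 < c - x ord0 i)%R by rewrite subr_gt0.
  exists m => //=; rewrite /dyadic_set /= mxE.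
  set p := (2 : R) ^ m%:Z.
  have p0 : (0 < p)%R by exact: pow2_gt0.
  have hp : (1 < p * (c - x ord0 i))%R.
    rewrite -ltr_pdivrMr// mul1r.
    apply: (lt_le_trans (truncnS_gt _)).
    rewrite /p -exprnP -natrX ler_nat; exact: ltn_expl.
  have /andP[a1 a2] := real_floor_itv (num_real (p * c)).
  have /andP[b1 b2] := real_floor_itv (num_real (p * x ord0 i)).
  have : ((Num.floor (p * x ord0 i))%:~R + 1 < (Num.floor (p * c) + 1)%:~R :> R)%R.
    apply: (le_lt_trans (y := p * x ord0 i + 1)%R); first by rewrite lerD2r.
    apply: lt_trans a2; move: hp; rewrite mulrBr; lra.
  by rewrite intrD ltrD2r ltr_int.
move=> [m _]; rewrite /dyadic_set/= mxE; apply: contraTT; rewrite -!leNgt => cx.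
by apply: le_floor; rewrite ler_pM2l// pow2_gt0.
Qed.

Lemma dyadic_approx A : measurable A -> forall e : R, (0 < e)%R ->
  exists (m : nat) (Z : set 'rV[int]_n),
    nu (A `\` dyadic_set m Z) < e%:E /\ nu (dyadic_set m Z `\` A) < e%:E.
Proof.
move=> mA e e0.
have [_ /(_ _ e0)[m [Z h]]] := rV_measurable_ind approx_sigma approx_lt mA.
have mZ := @measurable_dyadic_set R n m Z; exists m, Z.
have mAZ := measurable_sd mA mZ.
split; apply: le_lt_trans h; apply: le_measure; rewrite ?inE//.
- exact: measurableD.
- by move=> x hx; left.
- exact: measurableD.
- by move=> x hx; right.
Qed.

End dyadic_approximation.

(** * Comparison of measures through dyadic cubes *)

Section dyadic_comparison.
Context {R : realType} {n : nat}.
Local Notation mu := (@lebesgue_rV R n).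
Local Open Scope ereal_scope.

Lemma cbox_dyadic_set (N m : nat) :
  cbox N = dyadic_set m [set` box_seq (2 ^ m * N)] :> set 'rV[R]_n.
Proof.
have p0 : (0 < (2 : R) ^+ m)%R by rewrite exprn_gt0.
have e : ((2 ^ m * N)%N%:Z)%:~R = (2 ^+ m * N%:R)%R :> R by rewrite -pmulrn natrM natrX.
have H (t : R) : ((- (2 ^ m * N)%N%:Z <= Num.floor (2 ^+ m * t) < (2 ^ m * N)%N%:Z) =
    (- N%:R <= t < N%:R))%R.
  rewrite floor_ge_int_tmp// floor_lt_int// mulrNz e -mulrN ler_pM2l//.
  by rewrite ltr_pM2l.
apply/seteqP; split => x.
  move=> /mem_cbox h; rewrite /dyadic_set/= mem_box_seq; apply/forallP => i.
  by rewrite mxE -exprnP H h.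
rewrite /dyadic_set/= mem_box_seq => /forallP h; apply/mem_cbox => i.
by have := h i; rewrite mxE -exprnP H.
Qed.

Lemma measure_le_dyadic (m1 m2 : {measure set 'rV[R]_n -> \bar R}) :
  (forall (m : nat) k, m1 (dyadic_cube m k) <= m2 (dyadic_cube m k)) ->
  forall N, m1 (cbox N) < +oo -> m2 (cbox N) < +oo ->
  forall A, measurable A -> A `<=` cbox N -> m1 A <= m2 A.
Proof.
move=> h N oo1 oo2 A mA AN.
have mB : measurable (cbox N : set 'rV[R]_n) by exact: measurable_box.
(* A single finite measure controls both [m1] and [m2], so that one dyadic set approximates [A] for
   the two at once. *)
pose nu := measure_add (mrestr m1 mB) (mrestr m2 mB).
have nuE B : nu B = m1 (B `&` cbox N) + m2 (B `&` cbox N).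
  by rewrite /nu measure_addE.
have nufin : nu setT < +oo by rewrite nuE setTI lte_add_pinfty.
(* Inside [cbox N], itself a finite union of cubes of scale m, only finitely many cubes remain, and
   finite additivity suffices. *)
have D12 m Z : m1 (dyadic_set (Posz m) Z `&` cbox N) <= m2 (dyadic_set (Posz m) Z `&` cbox N).
  rewrite (cbox_dyadic_set N m) dyadic_setI dyadic_setE.
  have fin : finite_set (Z `&` [set` box_seq (2 ^ m * N)]).
    exact: finite_setIr.
  rewrite !measure_fin_bigcup//; try exact: trivIset_dyadic_cube;
    try by move=> k _; exact: measurable_dyadic_cube.
  by apply: lee_fsum => // k _; exact: h.
apply/lee_addgt0Pr => e e0.
have e20 : (0 < e / 2)%R by rewrite divr_gt0.
have [m [Z []]] := dyadic_approx nufin mA e20.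
have mZ := @measurable_dyadic_set R n m Z.
set D := dyadic_set m Z in mZ * => d1' d2'.
have d1 : m1 ((A `\` D) `&` cbox N) + m2 ((A `\` D) `&` cbox N) < (e / 2)%:E.
  by rewrite -nuE; exact: d1'.
have d2 : m1 ((D `\` A) `&` cbox N) + m2 ((D `\` A) `&` cbox N) < (e / 2)%:E.
  by rewrite -nuE; exact: d2'.
have mAD : measurable (A `\` D) by exact: measurableD.
have mDA : measurable (D `\` A) by exact: measurableD.
have mDN : measurable (D `&` cbox N) by exact: measurableI.
have s1 : m1 A <= m1 (D `&` cbox N) + m1 ((A `\` D) `&` cbox N).
  apply: (le_trans _ (measureU2 _ _ _)) => //; last exact: measurableI.
  apply: le_measure; rewrite ?inE//.
    by apply: measurableU => //; exact: measurableI.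
  move=> x Ax; have Nx := AN x Ax; case: (pselect (D x)) => Dx; [left|right]; by split.
have s2 : m2 (D `&` cbox N) <= m2 A + m2 ((D `\` A) `&` cbox N).
  apply: (le_trans _ (measureU2 _ _ _)) => //; last exact: measurableI.
  apply: le_measure; rewrite ?inE//.
    by apply: measurableU => //; exact: measurableI.
  move=> x [Dx Nx]; case: (pselect (A x)) => Ax; [left|right] => //; by split.
have t1 : m1 ((A `\` D) `&` cbox N) <= (e / 2)%:E.
  by apply: le_trans (ltW d1); rewrite leeDl.
have t2 : m2 ((D `\` A) `&` cbox N) <= (e / 2)%:E.
  by apply: le_trans (ltW d2); rewrite leeDr.
apply: (le_trans s1); apply: (le_trans (leeD (D12 m Z) t1)).
apply: (le_trans (leeD s2 (lexx _))); rewrite [e in X in _ <= X]splitr EFinD addeA.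
by rewrite -!addeA leeD2l// leeD2r.
Qed.

End dyadic_comparison.

Section density.
Context d (T : measurableType d) (R : realType).
Variables (mu : {measure set T -> \bar R}) (f : T -> R).
Local Open Scope ereal_scope.

(** Packaged below as a measure, so that additivity and continuity along monotone sequences apply to
    integrals over varying sets. *)
Definition density (A : set T) : \bar R := \int[mu]_(x in A) (f x)%:E.

Hypotheses (mf : measurable_fun setT f) (f0 : forall x, (0 <= f x)%R).

Let density0 : density set0 = 0. Proof. exact: integral_set0. Qed.

Let density_ge0 A : 0 <= density A.
Proof. by apply: integral_ge0 => x _; rewrite lee_fin. Qed.

Let density_sigma_additive : semi_sigma_additive density.
Proof.
move=> F mF tF mUF; rewrite /density ge0_integral_bigcup//.
- apply: is_cvg_ereal_nneg_natsum_cond => k _ _; exact: density_ge0.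
- by apply/measurable_EFinP; exact: measurable_funTS.
- by move=> x _; rewrite lee_fin.
Qed.

HB.instance Definition _ := isMeasure.Build _ _ _ density
  density0 density_ge0 density_sigma_additive.

Definition density_measure : {measure set T -> \bar R} := density.

End density.

Section dyadic_ae.
Context {R : realType} {n : nat}.
Local Notation mu := (@lebesgue_rV R n).
Local Open Scope ereal_scope.

(** As [u] may change sign, the hypothesis is read as a comparison of the measures with nonnegative
    densities u^+ and u^- + K on dyadic cubes. Extended to Borel sets and evaluated on the part of
    {u > K} in a box, it makes that part null. *)
Lemma ae_le_of_dyadic (u : 'rV[R]_n -> R) (K : R) : (0 <= K)%R ->
  mu.-integrable setT (EFin \o u) ->
  (forall (m : nat) k, (\int[mu]_(x in dyadic_cube m k) u x <=
    K * ((2 : R) ^ (- m%:Z)) ^+ n)%R) ->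
  {ae mu, forall x, (u x <= K)%R}.
Proof.
move=> K0 iu hQ.
have mu' : measurable_fun setT u.
  by case/integrableP : iu => /measurable_EFinP.
pose up x := Num.max (u x) 0%R; pose un x := (Num.max (- u x) 0 + K)%R.
have mup : measurable_fun setT up by apply: measurable_maxr.
have mun : measurable_fun setT un.
  by apply: measurable_funD => //; apply: measurable_maxr => //; exact: measurable_funN.
have up0 x : (0 <= up x)%R by rewrite le_max lexx orbT.
have un0 x : (0 <= un x)%R by rewrite addr_ge0// le_max lexx orbT.
pose m1 := density_measure mu mup up0; pose m2 := density_measure mu mun un0.
have iuD D : measurable D -> mu.-integrable D (EFin \o u).
  by move=> mD; apply: integrableS iu => //; exact: measurableT.
have upE D : measurable D -> \int[mu]_(x in D) (up x)%:E = \int[mu]_(x in D) (EFin \o u)^\+ x.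
  by move=> mD; apply: eq_integral => x _; rewrite funeposE /= EFin_max.
have unE D : measurable D -> \int[mu]_(x in D) (un x)%:E =
    \int[mu]_(x in D) (EFin \o u)^\- x + K%:E * mu D.
  move=> mD; rewrite -integral_cst// -ge0_integralD//=.
  - by apply: eq_integral => x _; rewrite funenegE/= EFinD EFin_max.
  - apply: measurable_funeneg; apply/measurable_EFinP; exact: measurable_funTS.
have lupoo D : measurable D -> \int[mu]_(x in D) (EFin \o u)^\+ x < +oo.
  move=> mD; have /integrable_funepos/integrable_lty := iuD D mD; exact.
have lunoo D : measurable D -> \int[mu]_(x in D) (EFin \o u)^\- x < +oo.
  move=> mD; have /integrable_funeneg/integrable_lty := iuD D mD; exact.
have h12 (m : nat) k : m1 (dyadic_cube m k) <= m2 (dyadic_cube m k).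
  have mQ := @measurable_dyadic_cube R n m k.
  rewrite /m1 /m2 /= /density upE// unE// lebesgue_rV_dyadic.
  have fp : \int[mu]_(x in dyadic_cube m k) (EFin \o u)^\+ x \is a fin_num.
    by rewrite ge0_fin_numE ?lupoo//; apply: integral_ge0.
  have fn : \int[mu]_(x in dyadic_cube m k) (EFin \o u)^\- x \is a fin_num.
    by rewrite ge0_fin_numE ?lunoo//; apply: integral_ge0.
  have := hQ m k; rewrite /Rintegral integralE.
  rewrite -(fineK fp) -(fineK fn) -!EFinM -!EFinD lee_fin /=; lra.
have fincbox N : m1 (cbox N) < +oo /\ m2 (cbox N) < +oo.
  have mN : measurable (cbox N : set 'rV[R]_n) by exact: measurable_box.
  rewrite /m1 /m2 /= /density upE// unE//; split; first exact: lupoo.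
  rewrite lte_add_pinfty ?lunoo// lte_mul_pinfty//; exact: lebesgue_rV_box_lty.
pose A N : set 'rV[R]_n := [set x | (K < u x)%R] `&` cbox N.
have mA N : measurable (A N).
  apply: measurableI; last exact: measurable_box.
  have := mu' measurableT `]K, +oo[%classic (measurable_itv _).
  rewrite setTI; congr (measurable _); apply/seteqP; split => x /=;
    by rewrite in_itv/= andbT.
have A0 N : mu (A N) = 0.
  have [f1 f2] := fincbox N.
  have AN : A N `<=` cbox N by move=> x [].
  have := measure_le_dyadic h12 f1 f2 (mA N) AN.
  rewrite /m1 /m2 /= /density.
  (* On [A N] the densities are K and |u - K| + K; cancelling the finite term K mu(A N) leaves that
     the integral of |u - K| is at most 0. *)
  have -> : \int[mu]_(x in A N) (un x)%:E = \int[mu]_(x in A N) K%:E.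
    apply: eq_integral => x /[!inE] -[/= Kx _]; congr _%:E.
    rewrite /un; have -> : Num.max (- u x)%R 0%R = 0%R; last by rewrite add0r.
    by apply/max_idPr; rewrite oppr_le0 (le_trans K0)// ltW.
  have -> : \int[mu]_(x in A N) (up x)%:E =
      \int[mu]_(x in A N) (`|u x - K|)%:E + \int[mu]_(x in A N) K%:E.
    rewrite -ge0_integralD//=.
    - apply: eq_integral => x /[!inE] -[/= Kx _]; rewrite -EFinD; congr _%:E.
      rewrite ger0_norm ?subr_ge0 1?ltW// subrK; apply/max_idPl.
      by rewrite (le_trans K0)// ltW.
    - apply/measurable_EFinP; apply: measurableT_comp => //.
      by apply: measurable_funB => //; exact: measurable_funTS.
  rewrite integral_cst//.
  have fA : mu (A N) < +oo.
    apply: (@le_lt_trans _ _ (mu (cbox N))); last exact: lebesgue_rV_box_lty.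
    by apply: le_measure; rewrite ?inE//; exact: measurable_box.
  have finA : K%:E * mu (A N) \is a fin_num.
    by rewrite fin_numM// ge0_fin_numE.
  rewrite -[X in _ <= X]add0e leeD2rE// => le0.
  have : ae_eq mu (A N) (EFin \o (fun x => u x - K)%R) (cst 0).
    apply/ae_eq_integral_abs => //.
      by apply/measurable_EFinP; apply: measurable_funB => //; exact: measurable_funTS.
    apply/eqP; rewrite eq_le le0 /=; exact: integral_ge0.
  move=> [M [mM M0 hM]]; apply: (subset_measure0 (mA N) mM _ M0) => x Ax; apply: hM => /(_ Ax) /=.
  move=> []; apply/eqP; rewrite subr_eq0 gt_eqF//; by case: Ax.
exists (\bigcup_N A N); split.
- exact: bigcupT_measurable.
- apply/eqP; rewrite -measure_le0; apply: le_trans (measure_sigma_subadditive _ mA _ _) _ => //.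
    exact: bigcupT_measurable.
  by rewrite eseries0.
move=> x /= /negP; rewrite -ltNge => Kx.
have : (\bigcup_N cbox N) x by rewrite bigcup_cbox.
by move=> [N _ hN]; exists N.
Qed.

End dyadic_ae.

(** * Trigonometric approximation of interval indicators *)

Section counting.
Context {R : realType}.

Lemma count_ge_le (y : R) N :
  \sum_(c < N) (y <= c%:R)%R%:R <= Num.max 0 (N%:R - y) :> R.
Proof.
elim: N => [|N ih]; first by rewrite big_ord0 le_max lexx.
rewrite big_ord_recr/= -natr1; have [yN|yN] := leP y N%:R.
  move: ih; rewrite (max_idPr _) ?subr_ge0// => ih.
  by rewrite le_max; apply/orP; right; rewrite addrAC lerD2r.
rewrite addr0; apply: (le_trans ih); rewrite ge_max !le_max lexx/=.
by apply/orP; left; lra.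
Qed.

(** A window of length [L] contains at most L + 1 integers; the induction discards the indices
    beyond y + L, after which only the lower constraint has to be counted. *)
Lemma count_window_le (y L : R) N : 0 <= L ->
  \sum_(c < N) (y <= c%:R <= y + L)%R%:R <= L + 1.
Proof.
move=> L0; elim: N => [|N ih]; first by rewrite big_ord0; lra.
have [yN|yN] := leP (N%:R) (y + L); last first.
  by rewrite big_ord_recr/= (lt_geF yN) andbF addr0.
apply: (@le_trans _ _ (\sum_(c < N.+1) (y <= c%:R)%R%:R)).
  by apply: ler_sum => c _; rewrite ler_nat; case: (_ <= _)%R; case: (_ <= _)%R.
apply: (le_trans (count_ge_le _ _)); rewrite ge_max -natr1; lra.
Qed.

End counting.

Section fejer.
Context {R : realType}.
Implicit Types (t u th : R).

Definition dirichlet_sum N th : R[i] := \sum_(a < N) cis (2 * pi * th) ^+ a.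

Lemma dirichlet_sum_le N th : th != 0 -> `|th| <= 3/4 ->
  absC (dirichlet_sum N th) <= 2 / `|th|.
Proof.
move=> th0 th34; have a0 : 0 < `|th| by rewrite normr_gt0.
rewrite ler_pdivlMr//.
have := absC_cisB1_ge_norm th0 th34 => h.
apply: (le_trans (ler_wpM2l (absC_ge0 _) h)).
rewrite -absCM mulrC -subrX1 -cisMn (le_trans (absCD _ _))//.
by rewrite absCN absC1 absC_cis.
Qed.

Lemma cis_neq1 u : 0 < `|u| < 1 -> cis (2 * pi * u) != 1.
Proof.
wlog u0 : u / 0 < u.
  move=> h /andP[u0 u1]; have [up|un] := ltP 0 u; first by apply: h => //; rewrite u0.
  have ul : u < 0 by rewrite lt_neqAle un andbT -normr_gt0.
  have := h (- u); rewrite oppr_gt0 normrN u0 u1 => /(_ ul isT).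
  apply: contraNN => /eqP e; rewrite mulrN cisN e; apply/eqP.
  by rewrite conjc1.
rewrite (gtr0_norm u0) => /andP[_ u1].
apply/negP => /eqP e.
have [h|h] := leP u (3/4).
  have := absC_cisB1_ge (u := u); rewrite u0 h e subrr absC0 => /(_ isT); lra.
(* For u > 3/4 the angle u - 1 gives the same character and is nonzero of modulus below 1/4, within
   reach of the chord estimate. *)
have un : u - 1 != 0 by lra.
have := absC_cisB1_ge_norm un; rewrite mulrBr cisD e cisN.
have -> : cis (2 * pi * 1) = 1 :> R[i] by have := @cis_nat R 1.
rewrite conjc1 mul1r subrr absC0 normr_le0 (negbTE un) => /implyP.
by rewrite implybF; case: ltrgt0P => //; lra.
Qed.

(** Orthogonality of the characters of Z/N: off the diagonal the sum is geometric, with ratio an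
    N-th root of unity other than 1. *)
Lemma sum_cis_roots N (a c : 'I_N) :
  \sum_(l < N) (cis (2 * pi * ((c%:R - a%:R) / N%:R)) : R[i]) ^+ l = (N * (a == c))%:R.
Proof.
have N0 : (0 < N)%N by case: (N) a => // -[].
have NR : N%:R != 0 :> R by rewrite pnatr_eq0 -lt0n.
have [<-|ac] := eqVneq a c.
  rewrite subrr mul0r mulr0 cis0; under eq_bigr do rewrite expr1n.
  by rewrite sumr_const card_ord muln1.
rewrite muln0; set z := cis _.
have z1 : z - 1 != 0.
  rewrite subr_eq0; apply: cis_neq1.
  rewrite normr_gt0 mulf_neq0 ?invr_eq0//=; last first.
    by rewrite subr_eq0 eqr_nat eq_sym.
  rewrite normf_div (ger0_norm (ler0n _ _)) ltr_pdivrMr ?ltr0n// mul1r ltr_norml.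
  have := ltn_ord a; have := ltn_ord c; rewrite -!(ltr_nat R).
  have := ler0n R a; have := ler0n R c; lra.
apply: (mulfI z1); rewrite mulr0 -subrX1 /z -cisMn.
rewrite (_ : N%:R * _ = 2 * pi * (c%:R - a%:R)); last by field.
rewrite mulrBr cisD cisN !cis_nat conjc1 mulr1 subrr//.
Qed.

Lemma sqr_dirichlet_sum N th : (absC (dirichlet_sum N th) ^+ 2)%:C =
  \sum_(a < N) \sum_(c < N) cis (2 * pi * ((a%:R - c%:R) * th)).
Proof.
have E : (dirichlet_sum N th)^* = \sum_(c < N) cis (- (c%:R * (2 * pi * th))).
  rewrite /dirichlet_sum rmorph_sum; apply: eq_bigr => c _.
  by rewrite cisN cisMn.
rewrite sqr_absC_conj [X in _ * X]E mulr_suml; apply: eq_bigr => a _.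
rewrite mulr_sumr; apply: eq_bigr => c _.
by rewrite -cisMn -cisD; congr cis; ring.
Qed.

(** Squared Dirichlet sums are Fejer kernels. Summing over the N equispaced nodes kills every
    off-diagonal frequency, so the translates add up to a constant, whatever [u]. *)
Lemma sum_sqr_dirichlet_sum N u : (0 < N)%N ->
  \sum_(l < N) absC (dirichlet_sum N (u - l%:R / N%:R)) ^+ 2 = N%:R ^+ 2.
Proof.
move=> N0; have NR : N%:R != 0 :> R by rewrite pnatr_eq0 -lt0n.
apply: complexI; rewrite rmorph_sum/=.
under eq_bigr do rewrite sqr_dirichlet_sum.
rewrite exchange_big/=; under eq_bigr do rewrite exchange_big/=.
have e (a c : 'I_N) : \sum_(l < N) cis (2 * pi * ((a%:R - c%:R) * (u - l%:R / N%:R))) =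
    cis (2 * pi * ((a%:R - c%:R) * u)) * (N * (a == c))%:R :> R[i].
  rewrite -sum_cis_roots mulr_sumr; apply: eq_bigr => l _.
  by rewrite -cisMn -cisD; congr cis; field.
under eq_bigr do under eq_bigr do rewrite e.
rewrite (eq_bigr (fun _ => N%:R)) => [|a _].
  by rewrite sumr_const card_ord -[in RHS]/(N%:R ^+ 2) expr2 mulr_natr rmorphMn/= rmorph_nat.
rewrite (bigD1 a)//= eqxx muln1 subrr mul0r mulr0 cis0 mul1r big1 ?addr0// => c ca.
by rewrite eq_sym (negbTE ca) muln0 mulr0.
Qed.

(** With M = m+1 and N = M^5, the nodes y_l = M (l/N - 1/2) fill [-M/2, M/2) with spacing M/N; the
    selected ones lie in the interval shifted left by 1/M. *)
Definition fejer_grid (al be : R) m (l : 'I_(m.+1 ^ 5)) : bool :=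
  al - m.+1%:R^-1 <= m.+1%:R * (l%:R / (m.+1 ^ 5)%:R - 1/2) < be - m.+1%:R^-1.

Definition fejer_angle m t (l : 'I_(m.+1 ^ 5)) : R :=
  t / m.+1%:R + 1/2 - l%:R / (m.+1 ^ 5)%:R.

(* A nonnegative trigonometric polynomial of period [m + 1], bounded by 1,
   approximating the indicator of [al, be[ : partial sums, over the nodes
   in (a slight left shift of) the interval, of a partition of unity made of
   translated Fejer kernels.  The left shift makes the limit exact at the
   endpoints of the half-open interval. *)
Definition fejer_indic (al be : R) m t : R :=
  \sum_(l < m.+1 ^ 5 | fejer_grid al be l)
    (absC (dirichlet_sum (m.+1 ^ 5) (fejer_angle t l)) / (m.+1 ^ 5)%:R) ^+ 2.

Lemma fejer_partition m t : \sum_(l < m.+1 ^ 5)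
    (absC (dirichlet_sum (m.+1 ^ 5) (fejer_angle t l)) / (m.+1 ^ 5)%:R) ^+ 2 = 1 :> R.
Proof.
have N0 : (0 < m.+1 ^ 5)%N by rewrite expn_gt0.
have NR : (m.+1 ^ 5)%:R != 0 :> R by rewrite pnatr_eq0 -lt0n.
under eq_bigr do rewrite expr_div_n.
by rewrite -mulr_suml sum_sqr_dirichlet_sum// mulfV// expf_neq0.
Qed.

Lemma fejer_indic_ge0 al be m t : 0 <= fejer_indic al be m t.
Proof. by apply: sumr_ge0 => l _; rewrite sqr_ge0. Qed.

Lemma fejer_indic_le1 al be m t : fejer_indic al be m t <= 1.
Proof.
rewrite -(fejer_partition m t) [leRHS](bigID (fejer_grid al be (m := m)))/= lerDl.
by apply: sumr_ge0 => l _; rewrite sqr_ge0.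
Qed.

(** Put M = m+1. At distance at least 1/M from the node the angle is at least M^-2, so the Dirichlet
    sum is at most 2 M^2 and the term at most (2 M^2 / M^5)^2 = 4 / M / M^5. The power 5 is what
    makes all M^5 such terms together at most 4/M. The condition 4|t| <= M keeps the angle below
    3/4, away from the next period. *)
Lemma fejer_term_le m t (l : 'I_(m.+1 ^ 5)) : 4 * `|t| <= m.+1%:R ->
  m.+1%:R^-1 <= `|t - m.+1%:R * (l%:R / (m.+1 ^ 5)%:R - 1/2)| ->
  (absC (dirichlet_sum (m.+1 ^ 5) (fejer_angle t l)) / (m.+1 ^ 5)%:R) ^+ 2 <=
  4 / m.+1%:R / (m.+1 ^ 5)%:R.
Proof.
set M : R := m.+1%:R => tM yt.
have M1 : 1 <= M by rewrite /M ler1n.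
set x : R := l%:R / _ in yt *.
have th : fejer_angle t l = (t - M * (x - 1/2)) / M.
  by rewrite /fejer_angle -/x -/M; field; lra.
have x0 : 0 <= x by rewrite divr_ge0.
have x1 : x <= 1.
  by rewrite ler_pdivrMr ?ltr0n ?expn_gt0// mul1r ler_nat ltnW.
set w : R := fejer_angle t l in th *.
have w1 : M^-1 ^+ 2 <= `|w|.
  rewrite th normf_div (gtr0_norm (x := M)); last lra.
  by rewrite expr2 ler_pM2r// invr_gt0; lra.
have Mi : 0 < M^-1 by rewrite invr_gt0; lra.
have w2 : `|w| <= 3/4.
  have -> : w = t / M + (1/2 - x) by rewrite th; field; lra.
  apply: (le_trans (ler_normD _ _)).
  have : `|t / M| <= 1/4.
    rewrite normf_div (gtr0_norm (x := M)); last lra.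
    by rewrite ler_pdivrMr; lra.
  have : `|1/2 - x| <= 1/2 by rewrite ler_norml; lra.
  lra.
have w0 : 0 < `|w| by apply: lt_le_trans w1; rewrite exprn_gt0.
have wn0 : w != 0 by rewrite -normr_gt0.
have h := dirichlet_sum_le (m.+1 ^ 5) wn0 w2.
have h2 : absC (dirichlet_sum (m.+1 ^ 5) w) <= 2 * M ^+ 2.
  apply: (le_trans h); rewrite ler_pM2l// -[M ^+ 2]invrK lef_pV2 ?posrE//.
    by rewrite -exprVn.
  by rewrite invr_gt0 exprn_gt0//; lra.
have h3 : absC (dirichlet_sum (m.+1 ^ 5) w) ^+ 2 <= (2 * M ^+ 2) ^+ 2.
  by rewrite ler_pXn2r ?nnegrE ?absC_ge0// mulr_ge0// exprn_ge0//; lra.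
rewrite expr_div_n natrX -/M.
apply: (@le_trans _ _ ((2 * M ^+ 2) ^+ 2 / (M ^+ 5) ^+ 2)).
  by rewrite ler_pM2r// invr_gt0 !exprn_gt0//; lra.
by rewrite le_eqVlt; apply/orP; left; apply/eqP; field; lra.
Qed.

Lemma fejer_sum_le m (P : pred 'I_(m.+1 ^ 5)) t : 4 * `|t| <= m.+1%:R ->
  (forall l, P l -> m.+1%:R^-1 <= `|t - m.+1%:R * (l%:R / (m.+1 ^ 5)%:R - 1/2)|) ->
  \sum_(l < m.+1 ^ 5 | P l)
    (absC (dirichlet_sum (m.+1 ^ 5) (fejer_angle t l)) / (m.+1 ^ 5)%:R) ^+ 2 <=
  4 / m.+1%:R.
Proof.
move=> tM hP; have M0 : 0 < m.+1%:R :> R by rewrite ltr0n.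
have N0 : 0 < (m.+1 ^ 5)%:R :> R by rewrite ltr0n expn_gt0.
apply: (@le_trans _ _ (\sum_(l < m.+1 ^ 5 | P l) 4 / m.+1%:R / (m.+1 ^ 5)%:R)).
  by apply: ler_sum => l /hP; exact: fejer_term_le.
apply: (@le_trans _ _ (\sum_(l < m.+1 ^ 5) 4 / m.+1%:R / (m.+1 ^ 5)%:R)).
  by rewrite [leRHS](bigID P)/= lerDl; apply: sumr_ge0 => l _; rewrite !divr_ge0.
by rewrite sumr_const card_ord -[leLHS]mulr_natr mulfVK// gt_eqF.
Qed.

Lemma fejer_indic_err al be t : exists m0, forall m, (m0 <= m)%N ->
  `|fejer_indic al be m t - (al <= t < be)%R%:R| <= 4 / m.+1%:R.
Proof.
have [m1 hm1] : exists m1, forall m, (m1 <= m)%N -> 4 * `|t| <= m.+1%:R.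
  exists (Num.truncn (4 * `|t|)) => m mm.
  by rewrite ltW// (lt_le_trans (truncnS_gt _))// ler_nat ltnS.
(* Factor 2: one 1/M is lost to the left shift of the nodes, another is the distance required by
   [fejer_sum_le]. *)
have inv0 (d : R) : 0 < d -> exists m2, forall m, (m2 <= m)%N -> 2 * m.+1%:R^-1 <= d.
  move=> d0; exists (Num.truncn (2 / d)) => m mm.
  rewrite ler_pdivrMr ?ltr0n// mulrC -ler_pdivrMr//.
  by rewrite ltW// (lt_le_trans (truncnS_gt _))// ler_nat ltnS.
have Mp m : 0 < m.+1%:R^-1 :> R by rewrite invr_gt0 ltr0n.
have F0 m : 0 <= 4 / m.+1%:R :> R by rewrite divr_ge0.
have [tal|tal] := leP al t; last first.
  have [m2 hm2] := inv0 (al - t) ltac:(lra).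
  exists (maxn m1 m2) => m; rewrite geq_max => /andP[/hm1 a1 /hm2 a2].
  rewrite subr0 ger0_norm ?fejer_indic_ge0//; apply: (fejer_sum_le a1) => l.
  have := Mp m; move: a2; rewrite /fejer_grid; move: (m.+1%:R * _) (m.+1%:R^-1) => y i.
  move=> a2 i0 /andP[b1 b2]; rewrite ler_normr; apply/orP; right; lra.
have [tbe|tbe] := ltP t be; last first.
  exists m1 => m /hm1 a1; rewrite subr0 ger0_norm ?fejer_indic_ge0//.
  apply: (fejer_sum_le a1) => l.
  have := Mp m; rewrite /fejer_grid; move: (m.+1%:R * _) (m.+1%:R^-1) => y i.
  move=> i0 /andP[b1 b2]; rewrite ler_normr; apply/orP; left; lra.
have [m2 hm2] := inv0 (be - t) ltac:(lra).
exists (maxn m1 m2) => m; rewrite geq_max => /andP[/hm1 a1 /hm2 a2] /=.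
(* Inside the interval the error is the part of the partition of unity carried by the unselected
   nodes, which are far from [t]. *)
rewrite distrC -[X in `|X - _|](fejer_partition m t) [X in `|X - _|](bigID (fejer_grid al be (m := m)))/=.
rewrite addrAC subrr add0r ger0_norm; last by apply: sumr_ge0 => l _; rewrite sqr_ge0.
apply: (fejer_sum_le (P := fun l => ~~ fejer_grid al be l)) => // l.
have := Mp m; move: a2; rewrite /fejer_grid; move: (m.+1%:R * _) (m.+1%:R^-1) => y i.
move=> a2 i0; rewrite negb_and -!ltNge ler_normr => /orP[b|b]; apply/orP; [left|right]; lra.
Qed.

Lemma cvg_fejer_indic al be t :
  fejer_indic al be m t @[m --> \oo] --> ((al <= t < be)%R%:R : R).
Proof.
apply/cvgrPdist_le => e e0.
have [m0 h] := fejer_indic_err al be t.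
near=> m; rewrite distrC (le_trans (h m _))//; first by near: m; exists m0.
rewrite ler_pdivrMr ?ltr0n// mulrC -ler_pdivrMr// ltW//.
apply: (lt_le_trans (truncnS_gt (4 / e))); rewrite ler_nat ltnS.
by near: m; exists (Num.truncn (4 / e)).
Unshelve. all: by end_near. Qed.

Lemma fejer_grid_count al be m : al <= be ->
  \sum_(l < m.+1 ^ 5) (fejer_grid al be l)%:R <=
    (be - al) / m.+1%:R * (m.+1 ^ 5)%:R + 1 :> R.
Proof.
move=> ab; set M : R := m.+1%:R; set N : R := (m.+1 ^ 5)%:R.
have M0 : 0 < M by rewrite /M ltr0n.
have N0 : 0 < N by rewrite /N ltr0n expn_gt0.
pose y := ((al - M^-1) / M + 1/2) * N; pose L := (be - al) / M * N.
have L0 : 0 <= L by rewrite mulr_ge0// ?divr_ge0// ?subr_ge0// ltW.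
apply: le_trans (count_window_le y (m.+1 ^ 5) L0).
apply: ler_sum => l _; rewrite ler_nat /fejer_grid -/M -/N.
case: (boolP (_ && _)) => // /andP[h1 h2].
have e (c : R) : l%:R - (c / M + 1/2) * N = (M * (l%:R / N - 1/2) - c) * (N / M).
  by field; lra.
have NM : 0 < N / M by rewrite divr_gt0.
have -> : y <= l%:R.
  by rewrite -subr_ge0 e pmulr_lge0// subr_ge0.
have -> : l%:R <= y + L; last by [].
have -> : y + L = ((be - M^-1) / M + 1/2) * N by rewrite /y /L; field; lra.
by rewrite -subr_le0 e pmulr_lle0// subr_le0 ltW.
Qed.

End fejer.

(** * Band-limited functions *)

Section complex_integral.
Context {R : realType} {n : nat}.
Local Notation mu := (@lebesgue_rV R n).
Implicit Types (f g h : 'rV[R]_n -> R[i]) (u : 'rV[R]_n -> R).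

Lemma measurable_absC f : cmeasurable f -> measurable_fun setT (fun x => absC (f x)).
Proof.
move=> [m1 m2].
rewrite (_ : (fun x => _) = (@Num.sqrt R) \o
    (fun x => (@complex.Re R \o f) x ^+ 2 + (@complex.Im R \o f) x ^+ 2)); last first.
  by apply/funext => x; rewrite /= absCE.
apply: measurableT_comp.
  by apply: continuous_measurable_fun; exact: sqrt_continuous.
by apply: measurable_funD; exact: measurable_funX.
Qed.

Lemma cmeasurable_real u : measurable_fun setT u -> cmeasurable (fun x => (u x)%:C).
Proof.
move=> mu'; split; first by rewrite (_ : _ \o _ = u).
by rewrite (_ : _ \o _ = cst 0).
Qed.

Lemma cmeasurable_cst (c : R[i]) : cmeasurable (fun _ : 'rV[R]_n => c).
Proof. by split; exact: measurable_cst. Qed.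

Lemma cmeasurableD f g : cmeasurable f -> cmeasurable g -> cmeasurable (fun x => f x + g x).
Proof.
move=> [f1 f2] [g1 g2]; split.
  rewrite (_ : _ \o _ = (@complex.Re R \o f) \+ (@complex.Re R \o g))%R.
    exact: measurable_funD.
  by apply/funext => x /=; case: (f x) (g x) => ? ? [].
rewrite (_ : _ \o _ = (@complex.Im R \o f) \+ (@complex.Im R \o g))%R.
  exact: measurable_funD.
by apply/funext => x /=; case: (f x) (g x) => ? ? [].
Qed.

Lemma cmeasurableM f g : cmeasurable f -> cmeasurable g -> cmeasurable (fun x => f x * g x).
Proof.
move=> [f1 f2] [g1 g2]; split.
  rewrite (_ : _ \o _ = (fun x => (@complex.Re R \o f) x * (@complex.Re R \o g) x -
      (@complex.Im R \o f) x * (@complex.Im R \o g) x)).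
    by apply: measurable_funB; exact: measurable_funM.
  by apply/funext => x /=; case: (f x) (g x) => ? ? [].
rewrite (_ : _ \o _ = (fun x => (@complex.Re R \o f) x * (@complex.Im R \o g) x +
    (@complex.Im R \o f) x * (@complex.Re R \o g) x)).
  by apply: measurable_funD; exact: measurable_funM.
by apply/funext => x /=; case: (f x) (g x) => ? ? [].
Qed.

Lemma cmeasurable_conj f : cmeasurable f -> cmeasurable (fun x => (f x)^*).
Proof.
move=> [f1 f2]; split.
  rewrite (_ : _ \o _ = @complex.Re R \o f)//.
  by apply/funext => x /=; case: (f x).
rewrite (_ : _ \o _ = \- (@complex.Im R \o f))%R; first exact: measurable_funN.
by apply/funext => x /=; case: (f x).
Qed.

Lemma cmeasurable_cis u : measurable_fun setT u -> cmeasurable (fun x => cis (u x)).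
Proof.
move=> mu'; split.
  rewrite (_ : _ \o _ = @cos R \o u)//; apply: measurableT_comp => //.
  by apply: continuous_measurable_fun; exact: continuous_cos.
rewrite (_ : _ \o _ = @sin R \o u)//; apply: measurableT_comp => //.
by apply: continuous_measurable_fun; exact: continuous_sin.
Qed.

Lemma cmeasurable_sum (I : Type) (s : seq I) (F : I -> 'rV[R]_n -> R[i]) :
  (forall i, cmeasurable (F i)) -> cmeasurable (fun x => \sum_(i <- s) F i x).
Proof.
move=> mF; elim: s => [|i s ih].
  by under eq_fun do rewrite big_nil; exact: cmeasurable_cst.
by under eq_fun do rewrite big_cons; exact: cmeasurableD.
Qed.

Lemma cintegrable_cmeasurable f : cintegrable f -> cmeasurable f.
Proof.
by move=> [/integrableP[/measurable_EFinP ? _] /integrableP[/measurable_EFinP ? _]].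
Qed.

Lemma le_cintegrable f (u : 'rV[R]_n -> R) : cmeasurable f ->
  (forall x, absC (f x) <= u x) -> mu.-integrable setT (EFin \o u) -> cintegrable f.
Proof.
move=> [m1 m2] fu iu; split; apply: le_integrable iu => //; try exact/measurable_EFinP.
  move=> x _ /=; rewrite lee_fin (le_trans (norm_Re_le _))//.
  by rewrite (le_trans (fu x))// ler_norm.
move=> x _ /=; rewrite lee_fin (le_trans (norm_Im_le _))//.
by rewrite (le_trans (fu x))// ler_norm.
Qed.

Lemma cintegrable_absC f : cintegrable f ->
  mu.-integrable setT (EFin \o (fun x => absC (f x))).
Proof.
move=> cf; have [i1 i2] := cf.
have := integrableD measurableT (integrable_norm i1) (integrable_norm i2).
apply: le_integrable => //.
  by apply/measurable_EFinP; apply: measurable_absC; exact: cintegrable_cmeasurable.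
move=> x _ /=; rewrite lee_fin ger0_norm ?absC_ge0// (le_trans (absC_le _))//.
exact: ler_norm.
Qed.

Lemma cintegrable_bounded f h (M : R) : cintegrable f -> cmeasurable h ->
  (forall x, absC (h x) <= M) -> cintegrable (fun x => f x * h x).
Proof.
move=> cf mh hM; apply: (@le_cintegrable _ (fun x => M * absC (f x))).
- by apply: cmeasurableM => //; exact: cintegrable_cmeasurable.
- by move=> x; rewrite absCM mulrC ler_wpM2r ?absC_ge0.
- exact: (integrableZl measurableT M (cintegrable_absC cf)).
Qed.

Lemma cintegrableD f g : cintegrable f -> cintegrable g -> cintegrable (fun x => f x + g x).
Proof.
move=> cf cg; apply: (@le_cintegrable _ (fun x => absC (f x) + absC (g x))).
- by apply: cmeasurableD; exact: cintegrable_cmeasurable.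
- by move=> x; exact: absCD.
- exact: (integrableD measurableT (cintegrable_absC cf) (cintegrable_absC cg)).
Qed.

Lemma cintegralD f g : cintegrable f -> cintegrable g ->
  cintegral (fun x => f x + g x) = cintegral f + cintegral g.
Proof.
move=> [f1 f2] [g1 g2]; rewrite /cintegral.
apply/eqP; rewrite eq_complex/= -!RintegralD//; apply/andP; split; apply/eqP;
  by apply: eq_Rintegral => x _; case: (f x) (g x) => ? ? [].
Qed.

Lemma cintegrableZr (c : R[i]) f : cintegrable f -> cintegrable (fun x => f x * c).
Proof.
move=> cf; apply: (cintegrable_bounded cf (cmeasurable_cst c) (M := absC c)) => //.
Qed.

Lemma cintegralZr (c : R[i]) f : cintegrable f ->
  cintegral (fun x => f x * c) = cintegral f * c.
Proof.
move=> [f1 f2]; case: c => a b; rewrite /cintegral.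
have Zr u (r : R) : mu.-integrable setT (EFin \o u) ->
    mu.-integrable setT (EFin \o (fun x => u x * r)).
  move=> iu; have := integrableZl measurableT r iu; congr (_.-integrable _ _).
  by apply/funext => x /=; rewrite mulrC.
apply/eqP; rewrite eq_complex/= -!RintegralZr// -RintegralB ?Zr// -RintegralD ?Zr//.
by apply/andP; split; apply/eqP; apply: eq_Rintegral => x _ /=; case: (f x).
Qed.

Lemma cintegrable_sum (I : Type) (s : seq I) (F : I -> 'rV[R]_n -> R[i]) :
  (forall i, cintegrable (F i)) -> cintegrable (fun x => \sum_(i <- s) F i x).
Proof.
move=> mF; elim: s => [|i s ih].
  under eq_fun do rewrite big_nil.
  by split; exact: integrable0.
by under eq_fun do rewrite big_cons; exact: cintegrableD.
Qed.

Lemma cintegral_sum (I : Type) (s : seq I) (F : I -> 'rV[R]_n -> R[i]) :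
  (forall i, cintegrable (F i)) ->
  cintegral (fun x => \sum_(i <- s) F i x) = \sum_(i <- s) cintegral (F i).
Proof.
move=> mF; elim: s => [|i s ih].
  under eq_fun do rewrite big_nil; rewrite big_nil /cintegral.
  by rewrite /Rintegral integral0.
under eq_fun do rewrite big_cons.
by rewrite cintegralD ?ih ?big_cons//; exact: cintegrable_sum.
Qed.

(** The factor 2 comes from estimating real and imaginary parts separately; it reappears in the
    later constants. *)
Lemma absC_cintegral_le f : cintegrable f ->
  absC (cintegral f) <= 2 * \int[mu]_x absC (f x).
Proof.
move=> cf; have [i1 i2] := cf; have ia := cintegrable_absC cf.
rewrite mulr2n mulrDl mul1r (le_trans (absC_le _))//= lerD//.
  apply: (le_trans (le_normr_Rintegral measurableT i1)).
  apply: le_Rintegral => //; first exact: integrable_norm.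
  by move=> x _; exact: norm_Re_le.
apply: (le_trans (le_normr_Rintegral measurableT i2)).
apply: le_Rintegral => //; first exact: integrable_norm.
by move=> x _; exact: norm_Im_le.
Qed.

(** Dominated convergence for the real and imaginary parts, dominated by |Re f| and |Im f|; the
    modulus is then a continuous function of the two limits. *)
Lemma absC_cintegral_limit f (v : nat -> 'rV[R]_n -> R) (w : 'rV[R]_n -> R)
    (c : nat -> R) (l : R) :
  cintegrable f -> (forall m, measurable_fun setT (v m)) -> measurable_fun setT w ->
  (forall m x, `|v m x| <= 1) -> (forall x, v m x @[m --> \oo] --> w x) ->
  (forall m, absC (cintegral (fun x => f x * (v m x)%:C)) <= c m) -> c m @[m --> \oo] --> l ->
  absC (cintegral (fun x => f x * (w x)%:C)) <= l.
Proof.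
move=> [f1 f2] mv mw v1 vw hc cl.
have key (u : 'rV[R]_n -> R) : mu.-integrable setT (EFin \o u) ->
    (\int[mu]_x (u x * v m x)) @[m --> \oo] --> \int[mu]_x (u x * w x).
  move=> iu; have mu' : measurable_fun setT u.
    by case/integrableP : iu => /measurable_EFinP.
  have [] := @dominated_convergence _ _ R mu setT measurableT
    (fun m x => (u x * v m x)%:E) (fun x => (u x * w x)%:E) (fun x => `|u x|%:E).
  - by move=> m; apply/measurable_EFinP; exact: measurable_funM.
  - by apply/measurable_EFinP; exact: measurable_funM.
  - apply: aeW => x _; apply: cvg_EFin; first by near=> m.
    by apply: cvgM; [exact: cvg_cst|exact: vw].
  - exact: integrable_norm.
  - apply: aeW => x m _; rewrite lee_fin normrM ler_piMr//.
  move=> iw _ h; apply: fine_cvg; rewrite fineK; first exact: h.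
  exact: integrable_fin_num.
have reE (u : 'rV[R]_n -> R) x : complex.Re (f x * (u x)%:C) = complex.Re (f x) * u x.
  by case: (f x) => a b /=; rewrite mulr0 subr0.
have imE (u : 'rV[R]_n -> R) x : complex.Im (f x * (u x)%:C) = complex.Im (f x) * u x.
  by case: (f x) => a b /=; rewrite mulr0 add0r.
have c1 := key _ f1; have c2 := key _ f2.
pose X u := (\int[mu]_x ((@complex.Re R \o f) x * u x)) ^+ 2 +
     (\int[mu]_x ((@complex.Im R \o f) x * u x)) ^+ 2.
have cX : X (v m) @[m --> \oo] --> X w.
  by apply: cvgD; rewrite ?expr2; under eq_fun do rewrite expr2; exact: cvgM.
have sq : Num.sqrt (X (v m)) @[m --> \oo] --> Num.sqrt (X w).
  exact: (cvg_comp _ _ cX (@sqrt_continuous R (X w))).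
have E u : absC (cintegral (fun x => f x * (u x)%:C)) = Num.sqrt (X u).
  rewrite absCE /cintegral/=; congr (Num.sqrt (_ ^+ 2 + _ ^+ 2));
    by apply: eq_Rintegral => x _ /=; rewrite ?reE ?imE.
rewrite E; apply: (@ler_cvg_to _ _ _ _ _ _ _ _ sq cl).
by near=> m; rewrite -E.
Unshelve. all: by end_near. Qed.

End complex_integral.

(** * Integrals over slabs *)

Section slab.
Context {R : realType} {n : nat}.
Local Notation mu := (@lebesgue_rV R n).
Implicit Types (f g h : 'rV[R]_n -> R[i]).

Lemma measurable_rV_coord0 (i : 'I_n) : measurable_fun setT (fun x : 'rV[R]_n => x ord0 i).
Proof. exact: measurable_rV_coord. Qed.

Lemma cmeasurable_character (u : 'rV[R]_n -> R) (c : R) : measurable_fun setT u ->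
  cmeasurable (fun x => cis (- (2 * pi * (u x * c)))).
Proof.
move=> mu'; apply: cmeasurable_cis; apply: measurable_funN.
apply: measurable_funM; first exact: measurable_cst.
by apply: measurable_funM => //; exact: measurable_cst.
Qed.

(** Expanding the squared moduli exhibits the frequencies (c - a)/(m+1), each coefficient having
    modulus at most (m+1)^-10. *)
Lemma fejer_indicE (al be : R) m t : (fejer_indic al be m t)%:C =
  \sum_(l < m.+1 ^ 5) \sum_(a < m.+1 ^ 5) \sum_(c < m.+1 ^ 5)
    cis (- (2 * pi * (t * ((c%:R - a%:R) / m.+1%:R)))) *
    (((fejer_grid al be l)%:R / (m.+1 ^ 5)%:R ^+ 2)%:C *
      cis (2 * pi * ((a%:R - c%:R) * (1/2 - l%:R / (m.+1 ^ 5)%:R)))).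
Proof.
rewrite /fejer_indic big_mkcond/= rmorph_sum/=; apply: eq_bigr => l _.
case: (fejer_grid _ _ _); last first.
  by rewrite big1 ?rmorph0// => a _; rewrite big1// => c _; rewrite !mul0r mulr0.
rewrite expr_div_n rmorphM/= sqr_dirichlet_sum mulr_suml; apply: eq_bigr => a _.
rewrite mulr_suml; apply: eq_bigr => c _; rewrite [RHS]mulrCA -cisD [RHS]mulrC.
congr (cis _ * _%:C); last by rewrite mul1r.
have M0 : m.+1%:R != 0 :> R by rewrite pnatr_eq0.
have N0 : (m.+1 ^ 5)%:R != 0 :> R by rewrite pnatr_eq0 -lt0n expn_gt0.
by rewrite /fejer_angle; move: (m.+1%:R) ((m.+1 ^ 5)%:R) M0 N0 => M N M0 N0; field; apply/andP.
Qed.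

(** For each [a], the admissible [c] lie in a window of length 2 b (m+1). *)
Lemma sum_window (b s0 : R) m N : 0 <= b ->
  \sum_(a < N) \sum_(c < N) (`|(c%:R - a%:R) / m.+1%:R - s0| <= b)%R%:R <=
  N%:R * (2 * b * m.+1%:R + 1) :> R.
Proof.
move=> b0; have M0 : 0 < m.+1%:R :> R by rewrite ltr0n.
apply: (@le_trans _ _ (\sum_(a < N) (2 * b * m.+1%:R + 1))); last first.
  by rewrite sumr_const card_ord [leRHS]mulr_natl.
apply: ler_sum => a _.
have L0 : 0 <= 2 * b * m.+1%:R by rewrite !mulr_ge0.
apply: le_trans (count_window_le (a%:R + (s0 - b) * m.+1%:R) N L0).
apply: ler_sum => c _; rewrite ler_nat; case: (boolP (_ <= b)) => // h.
have {h} /andP[h1 h2] : - b * m.+1%:R <= c%:R - a%:R - s0 * m.+1%:R <= b * m.+1%:R.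
  have -> : c%:R - a%:R - s0 * m.+1%:R = ((c%:R - a%:R) / m.+1%:R - s0) * m.+1%:R.
    by rewrite [RHS]mulrBl mulfVK// gt_eqF.
  by rewrite !ler_pM2r// -ler_norml.
by rewrite lt0b; apply/andP; split; lra.
Qed.

Lemma measurable_coord_indic (i : 'I_n) (al be : R) :
  measurable_fun setT (fun x : 'rV[R]_n => (al <= x ord0 i < be)%R%:R : R).
Proof.
have mi := measurable_rV_coord0 i.
have h r : measurable_fun setT (fun x : 'rV[R]_n => ((r <= x ord0 i)%R : bool)).
  by apply: measurable_fun_ler => //; exact: measurable_cst.
have h' r : measurable_fun setT (fun x : 'rV[R]_n => ((x ord0 i < r)%R : bool)).
  by apply: measurable_fun_ltr => //; exact: measurable_cst.
rewrite (_ : (fun x => _) = (fun b : bool => b%:R : R) \o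
   (fun x : 'rV[R]_n => (al <= x ord0 i)%R && (x ord0 i < be)%R))//.
by apply: measurableT_comp => //; exact: measurable_and.
Qed.

(* The frequencies of [fejer_indic al be m] form a grid of mesh [1 / (m + 1)]; only
   those within [b] of [s0] contribute to the integral against [G]. *)
Lemma slab_bound G (i : 'I_n) (S b s0 al be : R) : cintegrable G -> 0 <= b -> al <= be ->
  (forall s, absC (cintegral (fun x => G x * cis (- (2 * pi * (x ord0 i * s))))) <= S) ->
  (forall s, b < `|s - s0| -> cintegral (fun x => G x * cis (- (2 * pi * (x ord0 i * s)))) = 0) ->
  absC (cintegral (fun x => G x * ((al <= x ord0 i < be)%R%:R)%:C)) <= 2 * b * (be - al) * S.
Proof.
move=> iG b0 albe hS h0.
have S0 : 0 <= S by exact: le_trans (absC_ge0 _) (hS 0).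
have mi := measurable_rV_coord0 i.
pose I0 s := cintegral (fun x => G x * cis (- (2 * pi * (x ord0 i * s)))).
have iGs s : cintegrable (fun x => G x * cis (- (2 * pi * (x ord0 i * s)))).
  apply: (cintegrable_bounded (M := 1) iG); first exact: cmeasurable_character.
  by move=> x; rewrite absC_cis.
have mH m : measurable_fun setT (fun x : 'rV[R]_n => fejer_indic al be m (x ord0 i)).
  rewrite (_ : (fun x => _) = @complex.Re R \o
      (fun x : 'rV[R]_n => (fejer_indic al be m (x ord0 i))%:C))//.
  apply: proj1; under eq_fun do rewrite fejer_indicE.
  do 3 (apply: cmeasurable_sum => ?); apply: cmeasurableM; last exact: cmeasurable_cst.
  exact: cmeasurable_character.
(* With M = m+1 and N = M^5: at most (be - al) N/M + 1 nodes, N (2 b M + 1) pairs of indices with a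
   contributing frequency, coefficients of modulus 1/N^2 and integrals bounded by S. The limit is 2
   b (be - al) S. *)
pose c m := ((be - al) / m.+1%:R * (m.+1 ^ 5)%:R + 1) * (2 * b * m.+1%:R + 1) * S / (m.+1 ^ 5)%:R.
apply: (@absC_cintegral_limit _ _ G (fun m x => fejer_indic al be m (x ord0 i)) _ c) => //.
- exact: measurable_coord_indic.
- by move=> m x; rewrite ger0_norm ?fejer_indic_ge0 ?fejer_indic_le1.
- by move=> x; exact: cvg_fejer_indic.
- move=> m; pose M : R := m.+1%:R; pose N : R := (m.+1 ^ 5)%:R.
  have N0 : 0 < N by rewrite /N ltr0n expn_gt0.
  have -> : (fun x : 'rV[R]_n => G x * (fejer_indic al be m (x ord0 i))%:C) =
      (fun x => \sum_(l < m.+1 ^ 5) \sum_(a < m.+1 ^ 5) \sum_(c < m.+1 ^ 5)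
        G x * cis (- (2 * pi * (x ord0 i * ((c%:R - a%:R) / M)))) *
        (((fejer_grid al be l)%:R / N ^+ 2)%:C *
          cis (2 * pi * ((a%:R - c%:R) * (1/2 - l%:R / N))))).
    apply/funext => x; rewrite fejer_indicE.
    by do 3 (rewrite mulr_sumr; apply: eq_bigr => ? _); rewrite mulrA.
  have i1 l a c0 : cintegrable (fun x : 'rV[R]_n => G x * cis (- (2 * pi * (x ord0 i * ((c0%:R - a%:R) / M)))) *
        (((@fejer_grid R al be m l)%:R / N ^+ 2)%:C *
          cis (2 * pi * ((a%:R - c0%:R) * (1/2 - l%:R / N))))).
    exact: cintegrableZr.
  rewrite cintegral_sum => [|l]; last by do 2 (apply: cintegrable_sum => ?).
  apply: (le_trans (absC_sum _ _ _)).
  apply: (@le_trans _ _ (\sum_(l < m.+1 ^ 5) (fejer_grid al be l)%:R *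
     ((2 * b * m.+1%:R + 1) * S / N))); last first.
    have -> : c m = ((be - al) / M * N + 1) * ((2 * b * m.+1%:R + 1) * S / N).
      by rewrite /c !mulrA.
    rewrite -mulr_suml ler_wpM2r//; last exact: fejer_grid_count.
    by rewrite !mulr_ge0 ?invr_ge0 ?addr_ge0 ?mulr_ge0// ltW.
  apply: ler_sum => l _.
  rewrite cintegral_sum => [|a]; last by apply: cintegrable_sum => ?.
  apply: (le_trans (absC_sum _ _ _)).
  apply: (@le_trans _ _ (\sum_(a < m.+1 ^ 5) \sum_(c0 < m.+1 ^ 5)
     (`|(c0%:R - a%:R) / m.+1%:R - s0| <= b)%R%:R * ((fejer_grid al be l)%:R * (S / N ^+ 2)))).
    apply: ler_sum => a _; rewrite cintegral_sum//.
    apply: (le_trans (absC_sum _ _ _)); apply: ler_sum => c0 _.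
    rewrite cintegralZr// !absCM absC_cis mulr1 absC_real ger0_norm; last first.
      by rewrite divr_ge0// sqr_ge0.
    have [hb|hb] := leP `|_ - s0| b.
      by rewrite mul1r [leRHS]mulrCA ler_wpM2r// divr_ge0// sqr_ge0.
    by rewrite h0// absC0 !mul0r.
  under eq_bigr do rewrite -mulr_suml; rewrite -mulr_suml mulrCA ler_wpM2l//.
  apply: (le_trans (ler_wpM2r _ (sum_window s0 m (m.+1 ^ 5) b0))).
    by rewrite mulr_ge0// invr_ge0 sqr_ge0.
  by rewrite le_eqVlt; apply/orP; left; apply/eqP; rewrite -/N; clearbody N; field; lra.
- pose d m : R := 2 * b * (be - al) * S + ((be - al) + 2 * b + 1) * S * m.+1%:R^-1.
  have cd : d m @[m --> \oo] --> 2 * b * (be - al) * S.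
    rewrite -[X in _ --> X]addr0; apply: cvgD; first exact: cvg_cst.
    rewrite -[X in _ --> X](mulr0 ((be - al + 2 * b + 1) * S)); apply: cvgM; first exact: cvg_cst.
    exact: cvg_harmonic.
  apply: (squeeze_cvgr _ (cvg_cst _) cd); near=> m.
  have M1 : 1 <= m.+1%:R :> R by rewrite ler1n.
  rewrite /c /d natrX; move: (m.+1%:R) M1 => M M1.
  have Mi0 : 0 < M^-1 by rewrite invr_gt0; lra.
  have Mi1 : M^-1 <= 1 by rewrite invf_le1//; lra.
  have -> : ((be - al) / M * M ^+ 5 + 1) * (2 * b * M + 1) * S / M ^+ 5 =
     2 * b * (be - al) * S + ((be - al) + (2 * b * M^-1 ^+ 3 + M^-1 ^+ 4)) * S * M^-1.
    by field; lra.
  have ba : 0 <= be - al by lra.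
  have q3 : 0 <= M^-1 ^+ 3 <= 1 by rewrite exprn_ge0 ?exprn_ile1//; lra.
  have q4 : 0 <= M^-1 ^+ 4 <= 1 by rewrite exprn_ge0 ?exprn_ile1//; lra.
  have SM : 0 <= S * M^-1 by rewrite mulr_ge0//; lra.
  rewrite -!mulrA lerDl lerD2l; apply/andP; split.
    by rewrite mulr_ge0//; nra.
  by rewrite ler_wpM2r//; nra.
Unshelve. all: by end_near. Qed.

End slab.

(** * L1 to L^oo bounds for band-limited functions *)

Section band.
Context {R : realType} {n : nat}.
Local Notation mu := (@lebesgue_rV R n).
Implicit Types (f g h : 'rV[R]_n -> R[i]).

Lemma absC_le0_eq0 (z : R[i]) : absC z <= 0 -> z = 0.
Proof.
move=> h; apply: normr0_eq0; rewrite norm_absC; congr _%:C.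
by apply: le_anti; rewrite h absC_ge0.
Qed.

(** The frequency support is confined to a cube rather than a ball, since cut-offs and modulations
    act on one coordinate at a time. *)
Definition band (b : R) g := cintegrable g /\
  forall xi : 'rV[R]_n, (exists i, b < `|xi ord0 i|) -> fourier g xi = 0.

Lemma edotD (x y z : 'rV[R]_n) : edot x (y + z) = edot x y + edot x z.
Proof. by rewrite /edot -big_split/=; apply: eq_bigr => i _; rewrite mxE mulrDr. Qed.

Lemma edot_delta (x : 'rV[R]_n) (s : R) i : edot x (s *: delta_mx ord0 i) = x ord0 i * s.
Proof.
rewrite /edot (bigD1 i)//= !mxE !eqxx mulr1 big1 ?addr0// => l li.
by rewrite !mxE (negbTE li) andbF !mulr0.
Qed.

Lemma measurable_edot (xi : 'rV[R]_n) : measurable_fun setT (fun x => edot x xi).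
Proof.
apply: measurable_sum => i; apply: measurable_funM; last exact: measurable_cst.
exact: measurable_rV_coord0.
Qed.

Lemma cmeasurable_fourier_kernel (xi : 'rV[R]_n) :
  cmeasurable (fun x => cis (- (2 * pi * edot x xi))).
Proof.
apply: cmeasurable_cis; apply: measurable_funN.
by apply: measurable_funM; [exact: measurable_cst|exact: measurable_edot].
Qed.

Lemma cintegrable_fourier f xi : cintegrable f ->
  cintegrable (fun x => f x * cis (- (2 * pi * edot x xi))).
Proof.
move=> cf; apply: (cintegrable_bounded (M := 1) cf).
  exact: cmeasurable_fourier_kernel.
by move=> x; rewrite absC_cis.
Qed.

Lemma fourier_shift f (i : 'I_n) (s : R) xi :
  cintegral (fun x => f x * cis (- (2 * pi * edot x xi)) * cis (- (2 * pi * (x ord0 i * s)))) =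
  fourier f (xi + s *: delta_mx ord0 i).
Proof.
rewrite /fourier; congr cintegral; apply/funext => x.
by rewrite -mulrA -cisD edotD edot_delta -opprD -mulrDr.
Qed.

Lemma shift_coord (xi : 'rV[R]_n) (s : R) i l :
  (xi + s *: delta_mx ord0 i) ord0 l = xi ord0 l + s * (l == i)%:R.
Proof. by rewrite !mxE eqxx. Qed.

(* Cutting off one coordinate keeps the Fourier support bounded in the others, so
   that [slab_bound] can be applied coordinate by coordinate. *)
Lemma band_box_bound g (b : R) (al be : 'rV[R]_n) : 0 <= b ->
  (forall i, al ord0 i <= be ord0 i) -> band b g ->
  absC (cintegral (fun x => g x * (\prod_(i < n) (al ord0 i <= x ord0 i < be ord0 i)%R%:R)%:C)) <=
  (\prod_(i < n) (2 * b * (be ord0 i - al ord0 i))) * (2 * \int[mu]_x absC (g x)).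
Proof.
move=> b0 albe [ig g0].
pose ind i (x : 'rV[R]_n) : R := (al ord0 i <= x ord0 i < be ord0 i)%R%:R.
pose gk k x := g x * (\prod_(i < n | (i < k)%N) ind i x)%:C.
pose B k : R := (\prod_(i < n | (i < k)%N) (2 * b * (be ord0 i - al ord0 i))) *
  (2 * \int[mu]_x absC (g x)).
have gkS k (kn : (k < n)%N) x : gk k.+1 x = gk k x * (ind (Ordinal kn) x)%:C.
  rewrite /gk -mulrA -rmorphM/= mulrC -[X in X = _]mulrC; congr (_ * _%:C).
  rewrite (bigD1 (Ordinal kn))//= mulrC; congr (_ * _); apply: eq_bigl => i.
  by rewrite -val_eqE/= ltnS ltn_neqAle andbC.
have BS k (kn : (k < n)%N) : B k.+1 =
    2 * b * (be ord0 (Ordinal kn) - al ord0 (Ordinal kn)) * B k.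
  rewrite /B (bigD1 (Ordinal kn))//= -!mulrA; do 3 congr (_ * _).
  congr (_ * _); apply: eq_bigl => i.
  by rewrite -val_eqE/= ltnS ltn_neqAle andbC.
(* Invariant after k cut-offs: the Fourier transform is bounded by [B k] and still vanishes once an
   uncut coordinate of the frequency exceeds [b]. *)
have key k : (k <= n)%N -> [/\ cintegrable (gk k),
    forall xi, absC (fourier (gk k) xi) <= B k &
    forall xi : 'rV[R]_n, (exists2 i : 'I_n, (k <= i)%N & b < `|xi ord0 i|) -> fourier (gk k) xi = 0].
  elim: k => [_|k ih kn].
    have E : gk 0%N = g.
      by apply/funext => x; rewrite /gk big_pred0 ?mulr1// => i; rewrite ltn0.
    rewrite E /B big_pred0 => [|i]; last by rewrite ltn0.
    rewrite mul1r; split => //.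
      move=> xi; apply: (le_trans (absC_cintegral_le (cintegrable_fourier xi ig))).
      by under eq_Rintegral do rewrite absCM absC_cis mulr1.
    by move=> xi [i _ bi]; apply: g0; exists i.
  have [ik hB h0] := ih (ltnW kn).
  set i0 := Ordinal kn.
  have four xi : fourier (gk k.+1) xi = cintegral (fun x =>
      gk k x * cis (- (2 * pi * edot x xi)) * (ind i0 x)%:C).
    by rewrite /fourier; congr cintegral; apply/funext => x; rewrite (gkS k kn) mulrAC.
  have igS : cintegrable (gk k.+1).
    rewrite (_ : gk k.+1 = (fun x => gk k x * (ind i0 x)%:C)); last first.
      by apply/funext => x; rewrite (gkS k kn).
    apply: (cintegrable_bounded (M := 1) ik).
      by apply: cmeasurable_real; exact: measurable_coord_indic.
    by move=> x; rewrite absC_real /ind; case: (_ <= _ < _); rewrite ?normr1 ?normr0.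
  split => // [xi|xi [i ki bi]].
    rewrite BS four.
    (* Modulation by [s] moves the frequency coordinate to xi_i0 + s, which is in the band only for
       [s] within [b] of -xi_i0. *)
    apply: (@slab_bound _ _ _ i0 (B k) b (- xi ord0 i0)) => //.
    - exact: cintegrable_fourier.
    - by move=> s; rewrite fourier_shift.
    - move=> s hs; rewrite fourier_shift; apply: h0; exists i0 => //=.
      by rewrite shift_coord eqxx mulr1 addrC -[xi ord0 i0]opprK.
  apply: absC_le0_eq0.
  rewrite four; have -> : 0 = 2 * b * (be ord0 i0 - al ord0 i0) * 0 :> R by rewrite mulr0.
  (* A different coordinate out of band is unaffected by shifts along [i0], so [slab_bound] applies
     with bound 0. *)
  have z s : fourier (gk k) (xi + s *: delta_mx ord0 i0) = 0.
    apply: h0; exists i; first exact: ltnW.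
    rewrite shift_coord (_ : (i == i0) = false) ?mulr0 ?addr0//.
    by apply/negP => /eqP e; move: ki; rewrite e /= ltnn.
  apply: (@slab_bound _ _ _ i0 0 b 0) => //.
  - exact: cintegrable_fourier.
  - by move=> s; rewrite fourier_shift z absC0.
  - by move=> s _; rewrite fourier_shift z.
have [_ /(_ 0) h _] := key n (leqnn n).
have allP (F : 'I_n -> R) : \prod_(i < n | (i < n)%N) F i = \prod_(i < n) F i.
  by apply: eq_bigl => i; rewrite ltn_ord.
move: h; rewrite /B allP; congr (absC _ <= _).
rewrite /fourier; congr cintegral; apply/funext => x.
by rewrite /edot big1 ?mulr0 ?oppr0 ?cis0 ?mulr1 /gk ?allP// => i _; rewrite mxE mulr0.
Qed.

Lemma dyadic_cube_indic j k (x : 'rV[R]_n) :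
  \prod_(i < n) (((2 : R) ^ (- j) *: zvec k) ord0 i <= x ord0 i <
    ((2 : R) ^ (- j) *: zvec k + const_mx ((2 : R) ^ (- j))) ord0 i)%R%:R =
  \1_(dyadic_cube j k) x :> R.
Proof.
rewrite dyadic_cube_cube indicE; case: (pselect (cube ((2 : R) ^ (- j) *: zvec k) ((2 : R) ^ (- j)) x)) => h.
  rewrite mem_set// big1// => i _; have := h i.
  by rewrite (mxE _ (fun x y => _ + _)) (mxE _ (fun _ _ => _ ^ _)) => ->.
rewrite memNset//; apply/eqP; rewrite prodf_seq_eq0; apply/hasP.
have [i hi] : exists i, ~ ((((2 : R) ^ (- j) *: zvec k) ord0 i <= x ord0 i <
    ((2 : R) ^ (- j) *: zvec k) ord0 i + (2 : R) ^ (- j))).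
  by apply/existsNP.
exists i; first by rewrite mem_index_enum.
rewrite (mxE _ (fun x y => _ + _)) (mxE _ (fun _ _ => _ ^ _)) /=.
by move/negP/negbTE : hi => ->.
Qed.

Lemma Rintegral_indic_mul (u : 'rV[R]_n -> R) (D : set 'rV[R]_n) :
  \int[mu]_(x in D) u x = \int[mu]_x (u x * \1_D x).
Proof.
rewrite Rintegral_mkcond; apply: eq_Rintegral => x _.
by rewrite patchE indicE; case: ifP; rewrite ?mulr1 ?mulr0.
Qed.

(** The box bound is (2b)^n times the volume times twice the L1 norm, hence a bound on averages over
    dyadic cubes. It is applied to plus and minus the real and imaginary parts; adding the two parts
    gives the factor 4. *)
Lemma band_ae_bounded g (b : R) : 0 <= b -> band b g ->
  {ae mu, forall x, absC (g x) <= 4 * (2 * b) ^+ n * \int[mu]_x absC (g x)}.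
Proof.
move=> b0 bg; have ig := bg.1; have [ire iim] := ig.
pose T := \int[mu]_x absC (g x).
have T0 : 0 <= T by apply: Rintegral_ge0 => x _; exact: absC_ge0.
pose K := (2 * b) ^+ n * (2 * T).
have K0 : 0 <= K by rewrite !mulr_ge0// exprn_ge0// mulr_ge0.
have hQ (m : nat) k : absC (cintegral (fun x => g x * (\1_(dyadic_cube m k) x)%:C)) <=
    K * ((2 : R) ^ (- m%:Z)) ^+ n.
  have := @band_box_bound g b ((2 : R) ^ (- m%:Z) *: zvec k)
    ((2 : R) ^ (- m%:Z) *: zvec k + const_mx ((2 : R) ^ (- m%:Z))) b0.
  under eq_fun do rewrite dyadic_cube_indic.
  have -> : \prod_(i < n) (2 * b * (((2 : R) ^ (- m%:Z) *: zvec k + const_mx ((2 : R) ^ (- m%:Z))) ord0 i -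
      ((2 : R) ^ (- m%:Z) *: zvec k) ord0 i)) = (2 * b) ^+ n * ((2 : R) ^ (- m%:Z)) ^+ n.
    under eq_bigr do rewrite !mxE addrAC subrr add0r.
    by rewrite prodr_const card_ord exprMn.
  move=> h; rewrite /K mulrAC; apply: h => // i.
  by rewrite !mxE lerDl ltW// pow2_gt0.
have reE (u : 'rV[R]_n -> R) x : complex.Re (g x * (u x)%:C) = complex.Re (g x) * u x.
  by case: (g x) => p q /=; rewrite mulr0 subr0.
have imE (u : 'rV[R]_n -> R) x : complex.Im (g x * (u x)%:C) = complex.Im (g x) * u x.
  by case: (g x) => p q /=; rewrite mulr0 add0r.
have hre (m : nat) k : `|\int[mu]_(x in dyadic_cube m k) (@complex.Re R \o g) x| <=
    K * ((2 : R) ^ (- m%:Z)) ^+ n.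
  apply: le_trans (hQ m k); apply: le_trans (norm_Re_le _); rewrite /cintegral/=.
  by rewrite Rintegral_indic_mul; under [in leRHS]eq_Rintegral do rewrite reE.
have him (m : nat) k : `|\int[mu]_(x in dyadic_cube m k) (@complex.Im R \o g) x| <=
    K * ((2 : R) ^ (- m%:Z)) ^+ n.
  apply: le_trans (hQ m k); apply: le_trans (norm_Im_le _); rewrite /cintegral/=.
  by rewrite Rintegral_indic_mul; under [in leRHS]eq_Rintegral do rewrite imE.
have both (u : 'rV[R]_n -> R) : mu.-integrable setT (EFin \o u) ->
    (forall (m : nat) k, `|\int[mu]_(x in dyadic_cube m k) u x| <= K * ((2 : R) ^ (- m%:Z)) ^+ n) ->
    {ae mu, forall x, `|u x| <= K}.
  move=> iu hu.
  have iNu : mu.-integrable setT (EFin \o (fun x => - u x)).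
    by have := integrableN iu; congr (_.-integrable _ _).
  have a1 := @ae_le_of_dyadic R n u K K0 iu (fun m k => le_trans (ler_norm _) (hu m k)).
  have a2 : {ae mu, forall x, - u x <= K}.
    apply: (@ae_le_of_dyadic R n _ K K0 iNu) => m k.
    apply: le_trans (hu m k); rewrite -normrN; apply: le_trans (ler_norm _).
    rewrite -[X in _ <= - X]mul1r -mulNr -RintegralZl.
    - by under [in leRHS]eq_Rintegral do rewrite mulN1r.
    - exact: measurable_dyadic_cube.
    - by apply: integrableS iu => //; exact: measurable_dyadic_cube.
  apply: filterS2 a1 a2 => x h1 h2; by rewrite ler_norml h1 andbT lerNl.
have r := both _ ire hre; have i := both _ iim him.
apply: filterS2 r i => x h1 h2; apply: (le_trans (absC_le _)).
rewrite (_ : 4 * _ * _ = K + K); first exact: lerD.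
by rewrite /K -/T; ring.
Qed.

Lemma fourier_modulation f (i : 'I_n) (s : R) xi : cintegrable f ->
  fourier (fun x => f x * (cis (2 * pi * (x ord0 i * s)) - 1)) xi =
  fourier f (xi - s *: delta_mx ord0 i) - fourier f xi.
Proof.
move=> cf; have cN h : cintegrable h -> cintegral (fun x => - h x) = - cintegral h.
  move=> ch; rewrite -[RHS]mulrN1 -cintegralZr//.
  by congr cintegral; apply/funext => x; rewrite mulrN1.
rewrite -[X in _ - X]/(cintegral _) -cN; last exact: cintegrable_fourier.
rewrite -[X in X + _]/(cintegral _) -cintegralD; last 2 first.
  exact: cintegrable_fourier.
  have := cintegrableZr (-1) (cintegrable_fourier xi cf).
  by congr cintegrable; apply/funext => x; rewrite mulrN1.
rewrite /fourier; congr cintegral; apply/funext => x.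
have -> : edot x (xi - s *: delta_mx ord0 i) = edot x xi - x ord0 i * s.
  by rewrite edotD -scaleNr edot_delta mulrN.
rewrite [2 * pi * (edot x xi - _)]mulrBr opprB cisD; ring.
Qed.

Lemma cmeasurable_modulation (i : 'I_n) (s : R) :
  cmeasurable (fun x : 'rV[R]_n => cis (2 * pi * (x ord0 i * s)) - 1).
Proof.
apply: cmeasurableD; last exact: cmeasurable_cst.
apply: cmeasurable_cis; apply: measurable_funM; first exact: measurable_cst.
apply: measurable_funM; last exact: measurable_cst.
exact: measurable_rV_coord0.
Qed.

(** Each factor replaces the Fourier transform by the difference of it and a translate by [s] along
    one axis, which widens the band by at most [s]. *)
Lemma band_modulation (b s : R) f (i : 'I_n) (N : nat) : 0 <= s -> band b f ->
  band (b + N%:R * s) (fun x => f x * (cis (2 * pi * (x ord0 i * s)) - 1) ^+ N).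
Proof.
move=> s0 bf; elim: N => [|N [ig hg]].
  by rewrite mul0r addr0; under eq_fun do rewrite expr0 mulr1.
pose g x := f x * (cis (2 * pi * (x ord0 i * s)) - 1) ^+ N.
have E : (fun x => f x * (cis (2 * pi * (x ord0 i * s)) - 1) ^+ N.+1) =
    (fun x => g x * (cis (2 * pi * (x ord0 i * s)) - 1)).
  by apply/funext => x; rewrite /g exprSr mulrA.
rewrite E; split.
  apply: (cintegrable_bounded (M := 2) ig); first exact: cmeasurable_modulation.
  by move=> x; exact: absC_cisB1_le2.
move=> xi [l hl]; rewrite fourier_modulation//.
have bN : b + N%:R * s <= b + N.+1%:R * s.
  by rewrite lerD2l ler_wpM2r// ler_nat.
rewrite [X in _ - X]hg ?subr0; last by exists l; exact: le_lt_trans hl.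
apply: hg; exists l; rewrite -scaleNr shift_coord.
have : `|xi ord0 l| <= `|xi ord0 l + - s * (l == i)%:R| + s.
  rewrite -[X in `|X| <= _](subrK (s * (l == i)%:R)) (le_trans (ler_normD _ _))//.
  by rewrite mulNr lerD2l; case: (l == i); rewrite ?mulr1 ?mulr0 ?normr0// ger0_norm.
move: hl; rewrite -natr1 mulrDl mul1r; lra.
Qed.

End band.

Lemma ae_forall_countable d (T : measurableType d) (R : realType)
    (mu : {measure set T -> \bar R}) (I : countType) (P : I -> T -> Prop) :
  (forall i, {ae mu, forall x, P i x}) -> {ae mu, forall x, forall i, P i x}.
Proof.
move=> h; have := @ae_foralln _ _ _ mu (fun k x => if @choice.unpickle I k is Some i then P i x else True).
have h2 k : {ae mu, forall x, if @choice.unpickle I k is Some i then P i x else True}.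
  by case: (choice.unpickle k) => [i|]; [exact: h|exact: aeW].
move=> /(_ h2); apply: filterS => x hx i.
by have := hx (choice.pickle i); rewrite choice.pickleK.
Qed.

(** * Pointwise decay from a weighted L1 bound *)

Section decay.
Context {R : realType} {n : nat}.
Local Notation mu := (@lebesgue_rV R n).
Implicit Types (f g h : 'rV[R]_n -> R[i]).

Lemma le_coord_enorm (x : 'rV[R]_n) i : `|x ord0 i| <= enorm x.
Proof.
rewrite /enorm -sqrtr_sqr ler_sqrt; last by apply: sumr_ge0 => l _; rewrite sqr_ge0.
by rewrite (bigD1 i)//= lerDl; apply: sumr_ge0 => l _; rewrite sqr_ge0.
Qed.

Lemma enorm_ge0 (x : 'rV[R]_n) : 0 <= enorm x. Proof. exact: sqrtr_ge0. Qed.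

Lemma measurable_enorm : measurable_fun setT (@enorm R n).
Proof.
rewrite (_ : @enorm R n = @Num.sqrt R \o (fun x => \sum_i x ord0 i ^+ 2))//.
apply: measurableT_comp.
  by apply: continuous_measurable_fun; exact: sqrt_continuous.
by apply: measurable_sum => i; apply: measurable_funX; exact: measurable_rV_coord0.
Qed.

Lemma band_limited_band a b f : band_limited a b f -> band b f.
Proof.
move=> [cf _ sf]; split => // xi [i bi]; apply/eqP/negPn/negP => fxi.
have /sf /= /andP[_] : supp (fourier f) xi by apply: subset_closure.
by apply/negP; rewrite -ltNge (lt_le_trans bi)// le_coord_enorm.
Qed.

Lemma Rintegral_absC_le_Dnorm f g (sigma c D : R) : cintegrable f -> cintegrable g ->
  0 <= c -> (Dnorm sigma g <= D%:E)%E ->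
  (forall x, absC (f x) <= c * ((1 + enorm x `^ sigma) * absC (g x))) ->
  \int[mu]_x absC (f x) <= c * D.
Proof.
move=> cf cg c0 hD fg.
have W0 x : 0 <= (1 + enorm x `^ sigma) * absC (g x).
  by rewrite mulr_ge0 ?absC_ge0// addr_ge0// powR_ge0.
have mW : measurable_fun setT (fun x => (1 + enorm x `^ sigma) * absC (g x)).
  apply: measurable_funM; last by apply: measurable_absC; exact: cintegrable_cmeasurable.
  apply: measurable_funD; first exact: measurable_cst.
  rewrite (_ : (fun x => _) = (fun r => r `^ sigma) \o (@enorm R n))//.
  by apply: measurableT_comp; [exact: measurable_powR|exact: measurable_enorm].
have fin : (\int[mu]_x (absC (f x))%:E)%E \is a fin_num.
  exact: (integrable_fin_num measurableT (cintegrable_absC cf)).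
rewrite -lee_fin /Rintegral fineK// EFinM.
apply: (@le_trans _ _ (c%:E * Dnorm sigma g)%E); last by rewrite lee_wpmul2l// lee_fin.
rewrite /Dnorm -ge0_integralZl//.
- apply: ge0_le_integral => //.
  + by move=> x _; rewrite lee_fin absC_ge0.
  + by apply/measurable_EFinP; apply: measurable_absC; exact: cintegrable_cmeasurable.
  + by apply/measurable_EFinP; apply: measurable_funM => //; exact: measurable_cst.
  + by move=> x _; rewrite -EFinM lee_fin.
- exact/measurable_EFinP.
- by move=> x _; rewrite lee_fin.
Qed.

(** The minimal q with 2 y <= 2^q. Dyadic scales are dense enough to land in the range where the
    modulation factor is large, and countable enough for almost everywhere statements. *)
Lemma exists_pow2_scale (y : R) : 1/2 <= y -> exists q : nat, 1/4 <= y / 2 ^+ q <= 1/2.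
Proof.
move=> y2; have ex : exists q : nat, 2 * y <= 2 ^+ q.
  exists (Num.truncn (2 * y)).+1; rewrite ltW// (lt_le_trans (truncnS_gt _))//.
  by rewrite -natrX ler_nat ltnW// ltn_expl.
case: (ex_minnP ex) => q hq qmin; exists q.
have p0 : 0 < (2 : R) ^+ q by rewrite exprn_gt0.
rewrite ler_pdivlMr// ler_pdivrMr//; apply/andP; split; last lra.
case: q hq qmin p0 => [|q] hq qmin p0; first by rewrite expr0; lra.
have : ~~ (2 * y <= 2 ^+ q) by apply/negP => /qmin; rewrite ltnn.
by rewrite -ltNge exprS; lra.
Qed.

(** Interpolation between the bounds 2 and 2 pi |u| on the chord v: since v/2 <= 1 and N >= sigma,
    (v/2)^N <= (v/2)^sigma <= (pi |u|)^sigma. *)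
Lemma absC_cisB1_powR (u sigma : R) N : 0 < sigma -> sigma <= N%:R ->
  absC (cis (2 * pi * u) - 1) ^+ N <= 2 ^+ N * pi `^ sigma * `|u| `^ sigma.
Proof.
move=> s0 sN; set v := absC _; have v0 : 0 <= v by exact: absC_ge0.
have v2 : v <= 2 by exact: absC_cisB1_le2.
have vu : v <= 2 * (pi * `|u|).
  rewrite (le_trans (absC_cisB1_le _))// !normrM (ger0_norm (pi_ge0 R)).
  by rewrite ger0_norm// mulrA.
have -> : v ^+ N = 2 ^+ N * (v / 2) ^+ N by rewrite -exprMn mulrC divfK.
rewrite -mulrA ler_pM2l ?exprn_gt0// -powRM ?pi_ge0//.
have [->|vn] := eqVneq v 0.
  by rewrite mul0r expr0n; case: N sN => [|N]; rewrite ?powR_ge0//; lra.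
have vp : 0 < v / 2 by rewrite divr_gt0// lt0r vn.
rewrite -powR_mulrn; last lra.
apply: (@le_trans _ _ ((v / 2) `^ sigma)).
  by apply: ger_powR => //; rewrite vp/=; lra.
by apply: ge0_ler_powR; rewrite ?nnegrE ?mulr_ge0 ?pi_ge0//; lra.
Qed.

(** The band radius becomes at most b + N after N modulations with steps at most 1; 2^N pi^sigma is
    the constant of [absC_cisB1_powR]; 3^sigma bounds ((1 + |x_i|) h)^sigma for |x_i| h <= 1/2 and h
    <= 1. *)
Definition decay_const (b sigma D : R) : R := let N := (Num.truncn sigma).+1 in
  3 `^ sigma * (4 * (2 * (b + N%:R)) ^+ n * (2 ^+ N * pi `^ sigma * D)).

(* On [1/4 <= h |x i| <= 1/2] the factor [|cis (2 pi h x_i) - 1|] is at least 1,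
   so bounding the band-limited function [(cis (2 pi h x_i) - 1)^N g] by its L1
   norm, which is O(h^sigma), gives the decay of [g] itself. *)
Lemma band_decay (b sigma D : R) g : 0 <= b -> 0 < sigma -> band b g ->
  (Dnorm sigma g <= D%:E)%E ->
  {ae mu, forall x : 'rV[R]_n, forall i, (1 + `|x ord0 i|) `^ sigma * absC (g x) <= decay_const b sigma D}.
Proof.
move=> b0 s0 bg hD; have ig := bg.1.
pose N := (Num.truncn sigma).+1; have sN : sigma <= N%:R by rewrite ltW// truncnS_gt.
have D0 : 0 <= D.
  rewrite -lee_fin; apply: le_trans hD; apply: integral_ge0 => x _.
  by rewrite lee_fin mulr_ge0 ?absC_ge0// addr_ge0// powR_ge0.
have p0 : 0 <= pi `^ sigma :> R by exact: powR_ge0.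
pose C1 := 4 * (2 * (b + N%:R)) ^+ n * (2 ^+ N * pi `^ sigma * D).
have L1 : \int[mu]_x absC (g x) <= 1 * D.
  apply: (Rintegral_absC_le_Dnorm ig ig) hD _ => // x.
  by rewrite mul1r ler_peMl ?absC_ge0// lerDl powR_ge0.
(* Serves the points with |x_i| < 1/2; [C1] covers this unmodulated case because 2^N pi^sigma >=
   1. *)
have ptw0 : {ae mu, forall x, absC (g x) <= C1}.
  apply: filterS (band_ae_bounded b0 bg) => x /le_trans; apply.
  apply: ler_pM; rewrite ?mulr_ge0 ?exprn_ge0 ?mulr_ge0//.
  - by apply: Rintegral_ge0 => y _; exact: absC_ge0.
  - by rewrite ler_pM2l// lerXn2r ?nnegrE ?mulr_ge0 ?addr_ge0// ler_pM2l// lerDl.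
  - apply: (le_trans L1); rewrite ler_wpM2r//.
    rewrite -[X in X <= _]mulr1; apply: ler_pM => //.
      by apply: exprn_ege1; lra.
    rewrite -[leLHS](powRr0 pi) ler_powR ?(ltW s0)//.
    by have := pi_ge2 R; lra.
have step (i : 'I_n) (q : nat) : {ae mu, forall x,
    absC (g x) * absC (cis (2 * pi * (x ord0 i * (2 ^+ q)^-1)) - 1) ^+ N <=
    C1 * ((2 ^+ q)^-1) `^ sigma}.
  set h : R := (2 ^+ q)^-1.
  have h0 : 0 < h by rewrite invr_gt0 exprn_gt0.
  have h1 : h <= 1 by rewrite invf_le1 ?exprn_gt0// exprn_ege1//; lra.
  have bm := band_modulation i N (ltW h0) bg.
  have bN0 : 0 <= b + N%:R * h by rewrite addr_ge0// mulr_ge0// ltW.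
  have hh0 : 0 <= h `^ sigma by exact: powR_ge0.
  apply: filterS (band_ae_bounded bN0 bm) => x; rewrite absCM absCX => /le_trans; apply.
  apply: (@le_trans _ _ (4 * (2 * (b + N%:R * h)) ^+ n * ((2 ^+ N * pi `^ sigma * h `^ sigma) * D))).
    rewrite ler_wpM2l//; first by rewrite mulr_ge0// exprn_ge0// mulr_ge0.
    apply: (Rintegral_absC_le_Dnorm bm.1 ig _ hD); first by rewrite !mulr_ge0 ?exprn_ge0.
    move=> y; rewrite absCM absCX [leLHS]mulrC [leRHS]mulrA ler_wpM2r ?absC_ge0//.
    apply: (le_trans (absC_cisB1_powR _ s0 sN)).
    rewrite normrM (gtr0_norm h0) powRM ?(ltW h0)// [_ `^ _ * h `^ _]mulrC mulrA.
    rewrite ler_wpM2l ?mulr_ge0 ?exprn_ge0// (@le_trans _ _ (enorm y `^ sigma))//.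
      by apply: ge0_ler_powR; rewrite ?nnegrE ?enorm_ge0 ?le_coord_enorm ?(ltW s0).
    by rewrite lerDr.
  rewrite (_ : 2 ^+ N * _ * h `^ sigma * D = (2 ^+ N * pi `^ sigma * D) * h `^ sigma); last by ring.
  rewrite mulrA ler_wpM2r// /C1 ler_wpM2r ?mulr_ge0 ?exprn_ge0//.
  rewrite ler_pM2l// lerXn2r ?nnegrE ?mulr_ge0 ?addr_ge0 ?mulr_ge0 ?(ltW h0)//.
  by rewrite ler_pM2l// lerD2l ler_piMr.
have C10 : 0 <= C1 by rewrite !mulr_ge0 ?exprn_ge0 ?mulr_ge0 ?addr_ge0.
have allstep : {ae mu, forall x, forall (iq : 'I_n * nat),
    absC (g x) * absC (cis (2 * pi * (x ord0 iq.1 * (2 ^+ iq.2)^-1)) - 1) ^+ N <=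
    C1 * ((2 ^+ iq.2)^-1) `^ sigma}.
  by apply: ae_forall_countable => -[i q]; exact: step.
apply: filterS2 ptw0 allstep => x hx0 hx i.
rewrite /decay_const -/N -/C1.
have [xi2|xi2] := leP (1/2) `|x ord0 i|; last first.
  apply: ler_pM; rewrite ?powR_ge0 ?absC_ge0//.
  by apply: ge0_ler_powR; rewrite ?nnegrE ?addr_ge0 ?(ltW s0)//; lra.
have [q /andP[q1 q2]] := exists_pow2_scale xi2.
have q0 : 0 < (2 : R) ^+ q by rewrite exprn_gt0.
have c1 : 1 <= absC (cis (2 * pi * (x ord0 i * (2 ^+ q)^-1)) - 1).
  have e : `|x ord0 i * (2 ^+ q)^-1| = `|x ord0 i| / 2 ^+ q.
    by rewrite normrM (gtr0_norm (x := (2 ^+ q)^-1)) ?invr_gt0.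
  have [xp|xn] := leP 0 (x ord0 i * (2 ^+ q)^-1).
    by apply: absC_cisB1_ge1; rewrite -(ger0_norm xp) e q1/=; lra.
  have := @absC_cisB1_ge1 R (- (x ord0 i * (2 ^+ q)^-1)).
  rewrite -(ltr0_norm xn) e q1/= => /(_ ltac:(lra)) h; move: h.
  rewrite -e (ltr0_norm xn) mulrN -(@ler_pXn2r _ 2) ?nnegrE ?absC_ge0// => h.
  rewrite -(@ler_pXn2r _ 2) ?nnegrE ?absC_ge0//; move: h.
  by rewrite !sqr_absC_cisB1 cosN.
have := hx (i, q) => /= h.
have {}h : absC (g x) <= C1 * ((2 ^+ q)^-1) `^ sigma.
  apply: le_trans h; rewrite ler_peMr ?absC_ge0//; exact: exprn_ege1.
have xp : 0 < 1 + `|x ord0 i| by rewrite ltr_pwDl.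
apply: (le_trans (ler_wpM2l (powR_ge0 _ _) h)); rewrite mulrCA mulrC ler_wpM2r//.
rewrite -powRM ?invr_ge0 ?(ltW q0) ?(ltW xp)//.
apply: ge0_ler_powR; rewrite ?nnegrE ?(ltW s0) ?mulr_ge0 ?invr_ge0 ?(ltW q0) ?(ltW xp)//.
have : 0 < (2 ^+ q)^-1 :> R by rewrite invr_gt0.
have : (2 ^+ q)^-1 <= 1 :> R by rewrite invf_le1// exprn_ege1//; lra.
rewrite mulrDl mul1r; lra.
Qed.

End decay.

(** * Muckenhoupt weights on dyadic cubes *)

Section Ap_pair.
Context {R : realType} {n : nat}.
Local Notation mu := (@lebesgue_rV R n).
Variables (p A : R) (w : 'rV[R]_n -> R).
Hypotheses (p1 : 1 < p) (w0 : forall x, 0 < w x) (mw : measurable_fun setT w).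
Hypothesis locw : forall x l, (\int[mu]_(y in cube x l) (w y)%:E < +oo)%E.
Hypothesis ApA : forall x l, 0 < l ->
  (average (cube x l) w * (average (cube x l) (fun x => w x `^ (- (p - 1)^-1))%R) `^ (p - 1)
    <= A%:E)%E.
Local Notation dual := (fun x => w x `^ (- (p - 1)^-1)).

Let w_ge0 x : 0 <= w x. Proof. exact: ltW. Qed.

Lemma measurable_fun_powRc (u : 'rV[R]_n -> R) (r : R) : measurable_fun setT u ->
  measurable_fun setT (fun x => u x `^ r).
Proof.
move=> mu'; rewrite (_ : (fun x => _) = (fun y => y `^ r) \o u)//.
by apply: measurableT_comp => //; exact: measurable_powR.
Qed.

Lemma ge0_integral_le_set (u : 'rV[R]_n -> R) (D E : set 'rV[R]_n) : measurable D ->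
  measurable E -> D `<=` E -> measurable_fun setT u -> (forall x, 0 <= u x) ->
  (\int[mu]_(x in D) (u x)%:E <= \int[mu]_(x in E) (u x)%:E)%E.
Proof.
move=> mD mE DE mu' u0; apply: ge0_subset_integral => //.
  by apply/measurable_EFinP; exact: measurable_funTS.
by move=> x _; rewrite lee_fin.
Qed.

Lemma integral_gt0 (u : 'rV[R]_n -> R) (D : set 'rV[R]_n) : measurable D ->
  measurable_fun setT u -> (forall x, 0 < u x) -> (0 < mu D)%E ->
  (0 < \int[mu]_(x in D) (u x)%:E)%E.
Proof.
move=> mD mu' u0 D0; rewrite lt_neqAle integral_ge0 ?andbT; last first.
  by move=> x _; rewrite lee_fin ltW.
apply/eqP => e.
have : ae_eq mu D (EFin \o u) (cst 0%E).
  apply/ae_eq_integral_abs => //.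
    by apply/measurable_EFinP; exact: measurable_funTS.
  rewrite e; apply: eq_integral => x _ /=; by rewrite ger0_norm// ltW.
move=> [M [mM M0 hM]].
have : mu D = 0%E.
  apply: (subset_measure0 mD mM _ M0) => x Dx; apply: hM => /(_ Dx) [].
  by apply/eqP; rewrite gt_eqF.
by move=> D0'; move: D0; rewrite D0' ltxx.
Qed.

Lemma mass_gt0 x l : 0 < l -> (0 < \int[mu]_(y in cube x l) (w y)%:E)%E.
Proof.
move=> l0; apply: integral_gt0 => //; first exact: measurable_cube.
by rewrite lebesgue_rV_cube ?(ltW l0)// lte_fin exprn_gt0.
Qed.

Let mdual : measurable_fun setT dual. Proof. exact: measurable_fun_powRc. Qed.

(** The A_p inequality cleared of denominators. The dual integral is finite because the mass of the
    cube is positive: an infinite one would make the product infinite. *)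
Lemma Ap_real x l : 0 < l -> (\int[mu]_(y in cube x l) (dual y)%:E < +oo)%E /\
  fine (\int[mu]_(y in cube x l) (w y)%:E) *
  (fine (\int[mu]_(y in cube x l) (dual y)%:E)) `^ (p - 1) <= A * (l ^+ n) `^ p.
Proof.
move=> l0; have V0 : 0 < l ^+ n by rewrite exprn_gt0.
have := ApA x l0; rewrite /average lebesgue_rV_cube ?(ltW l0)//=.
have W0 := mass_gt0 x l0; have Woo := locw x l.
set W := (\int[mu]_(y in cube x l) (w y)%:E)%E in W0 Woo *.
have S0 : (0 <= \int[mu]_(y in cube x l) (dual y)%:E)%E.
  by apply: integral_ge0 => y _; rewrite lee_fin powR_ge0.
move: S0; set S := (\int[mu]_(y in cube x l) (dual y)%:E)%E => S0.
have pm : p - 1 != 0 by rewrite gt_eqF// subr_gt0.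
have Wf : W \is a fin_num by rewrite ge0_fin_numE// ltW.
rewrite -(fineK Wf); have W0' : 0 < fine W by rewrite fine_gt0// W0 Woo.
case: S S0 => [s|_|//]; last first.
  have Vi0 : 0 < (l ^+ n)^-1 by rewrite invr_gt0.
  rewrite gt0_muley ?lte_fin// /poweR (negbTE pm) gt0_muley ?leye_eq//.
  by rewrite -EFinM lte_fin mulr_gt0// invr_gt0.
rewrite lee_fin => s0.
rewrite -!EFinM lee_fin => h; split; first exact: ltry.
move: h; rewrite /= powRM ?invr_ge0 ?(ltW V0)// => h.
have Vp : 0 < (l ^+ n) `^ p by rewrite powR_gt0.
rewrite -ler_pdivrMr//; apply: le_trans h; rewrite le_eqVlt; apply/orP; left; apply/eqP.
rewrite -(mulr_powRB1 (ltW V0) (lt_trans ltr01 p1)).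
rewrite -[(l ^+ n)^-1 in X in _ = X * _]mulr1.
have -> : (l ^+ n)^-1 `^ (p - 1) = ((l ^+ n) `^ (p - 1))^-1.
  by rewrite -[in LHS]powR_inv1 ?(ltW V0)// -powRrM mulN1r powRN.
have Vp1 : 0 < (l ^+ n) `^ (p - 1) by rewrite powR_gt0.
field; apply/andP; split; exact: lt0r_neq0.
Qed.

(** Hoelder's inequality for f = (f w^(1/p)) w^(-1/p) with q = p/(p-1), since w^(-q/p) is the dual
    weight w^(-1/(p-1)). *)
Lemma hoelder_weight (f : 'rV[R]_n -> R) (Q : set 'rV[R]_n) : measurable Q ->
  measurable_fun setT f -> (forall x, 0 <= f x) ->
  (\int[mu]_(x in Q) (f x `^ p * w x)%:E < +oo)%E ->
  (\int[mu]_(x in Q) (dual x)%:E < +oo)%E ->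
  (\int[mu]_(x in Q) (f x)%:E < +oo)%E /\
  (fine (\int[mu]_(x in Q) (f x)%:E)) `^ p <=
    fine (\int[mu]_(x in Q) (f x `^ p * w x)%:E) *
    (fine (\int[mu]_(x in Q) (dual x)%:E)) `^ (p - 1).
Proof.
have p0 : 0 < p by exact: lt_trans p1.
have pn0 : p != 0 by rewrite gt_eqF.
have pm0 : 0 < p - 1 by rewrite subr_gt0.
have pm : p - 1 != 0 by rewrite gt_eqF.
pose q := p / (p - 1).
have q0 : 0 < q by rewrite divr_gt0.
have qn0 : q != 0 by rewrite gt_eqF.
have pq : p^-1 + q^-1 = 1 by rewrite /q; field; apply/andP.
have pqm : - p^-1 * q = - (p - 1)^-1 by rewrite /q; field; apply/andP.
have qpm : q^-1 * p = p - 1 by rewrite /q; field; apply/andP.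
move=> mQ mf f0; set F := (\int[mu]_(x in Q) (f x `^ p * w x)%:E)%E.
set S := (\int[mu]_(x in Q) (dual x)%:E)%E => Foo Soo.
(* The indicator is put into both factors because [hoelder] is stated over the whole space. *)
pose f1 x := f x * w x `^ p^-1 * \1_Q x.
pose g1 x := w x `^ (- p^-1) * \1_Q x.
have mI : measurable_fun setT (\1_Q : _ -> R) by exact: measurable_indic.
have mf1 : measurable_fun setT f1.
  by do 2 (apply: measurable_funM => //); exact: measurable_fun_powRc.
have mg1 : measurable_fun setT g1.
  by apply: measurable_funM => //; exact: measurable_fun_powRc.
have := hoelder mu mf1 mg1 p0 q0 pq.
have ind01 (x : 'rV[R]_n) : \1_Q x = 1 :> R \/ \1_Q x = 0 :> R.
  by rewrite indicE; case: (x \in Q); [left|right].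
have setQ (u : 'rV[R]_n -> R) : (\int[mu]_(x in Q) (u x)%:E = \int[mu]_x (u x * \1_Q x)%:E)%E.
  rewrite integral_mkcond; apply: eq_integral => x _.
  by rewrite patchE indicE; case: ifP; rewrite ?mulr1 ?mulr0.
have -> : (Lnorm mu 1 (EFin \o (f1 \* g1)%R) = \int[mu]_(x in Q) (f x)%:E)%E.
  rewrite Lnorm1 setQ; apply: eq_integral => x _ /=; congr _%:E.
  rewrite /f1 /g1; have [->|->] := ind01 x; last by rewrite !mulr0 normr0.
  rewrite !mulr1 -mulrA -powRD; last by apply/implyP => _; rewrite gt_eqF.
  by rewrite subrr powRr0 mulr1 ger0_norm.
have -> : (Lnorm mu p%:E (EFin \o f1) = F `^ p^-1)%E.
  rewrite unlock /= /F setQ; congr (_ `^ _)%E; apply: eq_integral => x _ /=.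
  congr _%:E.
  rewrite /f1; have [->|->] := ind01 x; last by rewrite !mulr0 normr0 powR0.
  rewrite !mulr1 ger0_norm; last by rewrite mulr_ge0// powR_ge0.
  by rewrite powRM ?powR_ge0// -powRrM mulVf ?powRr1.
have -> : (Lnorm mu q%:E (EFin \o g1) = S `^ q^-1)%E.
  rewrite unlock /= /S setQ; congr (_ `^ _)%E; apply: eq_integral => x _ /=.
  congr _%:E.
  rewrite /g1; have [->|->] := ind01 x; last by rewrite !mulr0 normr0 powR0.
  by rewrite !mulr1 ger0_norm ?powR_ge0// -powRrM pqm.
have F0 : (0 <= F)%E.
  by apply: integral_ge0 => x _; rewrite lee_fin mulr_ge0 ?powR_ge0.
have S0 : (0 <= S)%E by apply: integral_ge0 => x _; rewrite lee_fin powR_ge0.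
have Ff : F \is a fin_num by rewrite ge0_fin_numE.
have Sf : S \is a fin_num by rewrite ge0_fin_numE.
rewrite -(fineK Ff) -(fineK Sf) !poweR_EFin -EFinM => h.
have v0 : (0 <= \int[mu]_(x in Q) (f x)%:E)%E.
  by apply: integral_ge0 => x _; rewrite lee_fin.
have voo : (\int[mu]_(x in Q) (f x)%:E < +oo)%E by apply: (le_lt_trans h); exact: ltry.
have vf : (\int[mu]_(x in Q) (f x)%:E)%E \is a fin_num by rewrite ge0_fin_numE.
split => //; move: h; rewrite -(fineK vf) lee_fin /= => h.
apply: le_trans (_ : ((fine F) `^ p^-1 * (fine S) `^ q^-1) `^ p <= _).
  apply: ge0_ler_powR; rewrite ?nnegrE ?(ltW p0) ?mulr_ge0 ?powR_ge0 ?fine_ge0//.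
have aux (a t : R) : 0 <= a -> 0 <= t -> (a `^ p^-1 * t `^ q^-1) `^ p = a * t `^ (p - 1).
  by move=> a0 t0; rewrite powRM ?powR_ge0// -!powRrM mulVf// powRr1// qpm.
by rewrite aux ?fine_ge0.
Qed.

(** Hoelder's inequality is applied on [Q]; then w over [K] and the dual weight over [Q] are both
    enlarged to the common cube, where A_p bounds their product. *)
Lemma Ap_pair (f : 'rV[R]_n -> R) (x : 'rV[R]_n) (l : R) (K Q : set 'rV[R]_n) : 0 < l ->
  measurable K -> measurable Q -> K `<=` cube x l -> Q `<=` cube x l ->
  measurable_fun setT f -> (forall x, 0 <= f x) ->
  (\int[mu]_(x in Q) (f x `^ p * w x)%:E < +oo)%E ->
  (\int[mu]_(x in Q) (f x)%:E < +oo)%E /\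
  fine (\int[mu]_(x in K) (w x)%:E) * (fine (\int[mu]_(x in Q) (f x)%:E)) `^ p <=
    A * (l ^+ n) `^ p * fine (\int[mu]_(x in Q) (f x `^ p * w x)%:E).
Proof.
move=> l0 mK mQ KB QB mf f0 Foo.
have mB := measurable_cube x l.
have [Soo hA] := Ap_real x l0.
have dual0 y : 0 <= dual y by exact: powR_ge0.
have SQ := ge0_integral_le_set mQ mB QB mdual dual0.
have WK := ge0_integral_le_set mK mB KB mw w_ge0.
have [voo hv] := hoelder_weight mQ mf f0 Foo (le_lt_trans SQ Soo).
split => //.
have fint (u : 'rV[R]_n -> R) D : (forall y, 0 <= u y) -> (\int[mu]_(y in D) (u y)%:E < +oo)%E ->
    (\int[mu]_(y in D) (u y)%:E)%E \is a fin_num.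
  by move=> u0 h; rewrite ge0_fin_numE//; apply: integral_ge0 => y _; rewrite lee_fin.
have W1 : fine (\int[mu]_(y in K) (w y)%:E) <= fine (\int[mu]_(y in cube x l) (w y)%:E).
  by rewrite fine_le ?fint//; exact: le_lt_trans WK (locw x l).
have S1 : fine (\int[mu]_(y in Q) (dual y)%:E) <= fine (\int[mu]_(y in cube x l) (dual y)%:E).
  by rewrite fine_le// fint//; exact: le_lt_trans SQ Soo.
have i0 (u : 'rV[R]_n -> R) D : (forall y, 0 <= u y) -> 0 <= fine (\int[mu]_(y in D) (u y)%:E).
  by move=> u0; rewrite fine_ge0// integral_ge0// => y _; rewrite lee_fin.
have F0 : 0 <= fine (\int[mu]_(x in Q) (f x `^ p * w x)%:E).
  by apply: i0 => y; rewrite mulr_ge0 ?powR_ge0.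
have aux (a b F t S v X : R) : 0 <= a -> a <= b -> 0 <= F -> 0 <= t -> t <= S ->
    v <= F * t `^ (p - 1) -> b * S `^ (p - 1) <= X -> a * v <= X * F.
  move=> a0 ab F0' t0 tS vF bS; apply: (le_trans (ler_wpM2l a0 vF)).
  rewrite mulrCA mulrC ler_wpM2r//; apply: le_trans bS; apply: ler_pM; rewrite ?powR_ge0//.
  by apply: ge0_ler_powR => //; rewrite ?nnegrE ?subr_ge0 ?(ltW p1) ?(le_trans t0).
exact: (aux _ _ _ _ _ _ _ (i0 _ _ w_ge0) W1 F0 (i0 _ _ dual0) S1 hv hA).
Qed.

(** [Ap_pair] with f = 1 and both sets equal to the unit cube, whose mass is positive and finite. *)
Lemma Ap_ge1 : 1 <= A.
Proof.
have l1 : (0 < 1 :> R) by [].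
have mB := measurable_cube (0 : 'rV[R]_n) (1 : R).
have E : (\int[mu]_(x in cube (0 : 'rV[R]_n) (1 : R)) ((1 : R) `^ p * w x)%:E =
   \int[mu]_(x in cube (0 : 'rV[R]_n) (1 : R)) (w x)%:E)%E.
  by apply: eq_integral => x _; rewrite powR1 mul1r.
have := @Ap_pair (cst 1) 0 1 _ _ l1 mB mB (@subset_refl _ _) (@subset_refl _ _)
  (@measurable_cst _ _ _ _ _ _) (fun _ => ler01).
rewrite /cst E => /(_ (locw _ _)) [_].
rewrite integral_cst// lebesgue_rV_cube// expr1n mule1 /= !powR1 !mulr1.
have W0 := mass_gt0 0 l1; have Woo := locw 0 1.
by rewrite -[X in X <= _]mul1r ler_pM2r// fine_gt0// W0 Woo.
Qed.

End Ap_pair.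

(** * Exhaustion by finite unions of dyadic cubes *)

Section box_exhaustion.
Context {R : realType} {n : nat}.
Local Notation mu := (@lebesgue_rV R n).

Definition dyadic_box j N : set 'rV[R]_n := dyadic_set j [set` box_seq N].

Lemma measurable_dyadic_box j N : measurable (dyadic_box j N).
Proof. exact: measurable_dyadic_set. Qed.

Lemma subset_dyadic_box j N M : (N <= M)%N -> dyadic_box j N `<=` dyadic_box j M.
Proof.
move=> NM x; rewrite /dyadic_box /dyadic_set/= !mem_box_seq => /forallP h.
by apply/forallP => i; have := h i; lia.
Qed.

Lemma bigcup_dyadic_box j : \bigcup_N dyadic_box j N = setT.
Proof.
apply/seteqP; split => // x _; exists (supn (dyadic_index j x)).+1 => //.
rewrite /dyadic_box /dyadic_set/= mem_box_seq; apply/forallP => i.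
by have := le_supn (dyadic_index j x) i; lia.
Qed.

Lemma integral_dyadic_box (f : 'rV[R]_n -> R) j N : measurable_fun setT f ->
  (forall x, 0 <= f x) ->
  (\int[mu]_(x in dyadic_box j N) (f x)%:E =
   \sum_(m <- box_seq N) \int[mu]_(x in dyadic_cube j m) (f x)%:E)%E.
Proof.
move=> mf f0; rewrite /dyadic_box dyadic_setE.
pose m := density_measure mu mf f0.
transitivity (m (\bigcup_(k in [set` box_seq N]) dyadic_cube j k)); first by [].
rewrite measure_fin_bigcup//=.
- by rewrite -fsbig_seq//; exact: box_seq_uniq.
- exact: trivIset_dyadic_cube.
- by move=> k _; exact: measurable_dyadic_cube.
Qed.

Lemma cvg_integral_dyadic_box (f : 'rV[R]_n -> R) j : measurable_fun setT f ->
  (forall x, 0 <= f x) ->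
  (\int[mu]_(x in dyadic_box j N) (f x)%:E @[N --> \oo] --> \int[mu]_x (f x)%:E)%E.
Proof.
move=> mf f0; pose m := density_measure mu mf f0.
have : m (dyadic_box j N) @[N --> \oo] --> m (\bigcup_N dyadic_box j N).
  apply: nondecreasing_cvg_mu.
  - by move=> N; exact: measurable_dyadic_box.
  - by rewrite bigcup_dyadic_box; exact: measurableT.
  - by move=> N M NM; apply/subsetPset; exact: subset_dyadic_box.
by rewrite bigcup_dyadic_box.
Qed.

Lemma integral_le_dyadic_box (f : 'rV[R]_n -> R) j (X : \bar R) : measurable_fun setT f ->
  (forall x, 0 <= f x) ->
  (forall N, (\int[mu]_(x in dyadic_box j N) (f x)%:E <= X)%E) ->
  (\int[mu]_x (f x)%:E <= X)%E.
Proof.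
move=> mf f0 h; have c := cvg_integral_dyadic_box j mf f0.
rewrite -(cvg_lim _ c)//; apply: lime_le; first by apply/cvg_ex; eexists; exact: c.
exact: nearW.
Qed.

(** The corner is the coordinatewise minimum of the two corners; the summand 1 in the side accounts
    for the cubes themselves. *)
Lemma dyadic_cubes_sub_cube j (k m : 'rV[int]_n) : exists x : 'rV[R]_n,
  let l := (2 : R) ^ (- j) * (1 + (supn (k - m))%:R) in
  dyadic_cube j k `<=` cube x l /\ dyadic_cube j m `<=` cube x l.
Proof.
pose x : 'rV[R]_n := (2 : R) ^ (- j) *: zvec (\row_i Num.min (k ord0 i) (m ord0 i)).
exists x => l; have p0 : 0 < (2 : R) ^ (- j) by exact: pow2_gt0.
have key (a b : 'rV[int]_n) y i : (Num.min (k ord0 i) (m ord0 i) = Num.min (a ord0 i) (b ord0 i)) ->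
    (absz (k ord0 i - m ord0 i) = absz (a ord0 i - b ord0 i))%N ->
    cube ((2 : R) ^ (- j) *: zvec a) ((2 : R) ^ (- j)) y ->
    x ord0 i <= y ord0 i < x ord0 i + l.
  move=> e1 e2 hy; have := hy i; rewrite !mxE e1 /l.
  set q := (2 : R) ^ (- j) in p0 *; set u := (a ord0 i)%:~R : R.
  set v := (Num.min (a ord0 i) (b ord0 i))%:~R : R => /andP[h1 h2].
  have vu : v <= u by rewrite ler_int ge_min lexx.
  have uv : u <= v + (absz (a ord0 i - b ord0 i))%:R.
    by rewrite pmulrn -intrD ler_int; have [ab|ab] := leP (a ord0 i) (b ord0 i); lia.
  have := le_supn (k - m) i; rewrite !mxE e2 -(ler_nat R) => h3.
  apply/andP; split; first by apply: le_trans h1; rewrite ler_pM2l.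
  apply: (lt_le_trans h2); rewrite -{2}[q]mulr1 -!mulrDr ler_pM2l//.
  by rewrite addrCA [u + 1]addrC lerD2l; apply: (le_trans uv); rewrite lerD2l.
rewrite !dyadic_cube_cube; split => y hy i.
  exact: (key k m).
apply: (key m k) => //; first by rewrite minC.
by rewrite -abszN opprB.
Qed.

End box_exhaustion.

(** * Weighted inequalities at a fixed dyadic scale *)

Section weighted.
Context {R : realType} {n : nat}.
Local Notation mu := (@lebesgue_rV R n).
Variables (p A : R) (w : 'rV[R]_n -> R).
Hypotheses (p1 : 1 < p) (w0 : forall x, 0 < w x) (mw : measurable_fun setT w).
Hypothesis locw : forall x l, (\int[mu]_(y in cube x l) (w y)%:E < +oo)%E.
Hypothesis ApA : forall x l, 0 < l ->
  (average (cube x l) w * (average (cube x l) (fun x => w x `^ (- (p - 1)^-1))%R) `^ (p - 1)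
    <= A%:E)%E.

Let w_ge0 x : 0 <= w x. Proof. exact: ltW. Qed.

Definition cube_mass j k : R := fine (\int[mu]_(x in dyadic_cube j k) (w x)%:E).

Lemma cube_mass_ge0 j k : 0 <= cube_mass j k.
Proof. by rewrite fine_ge0// integral_ge0// => x _; rewrite lee_fin. Qed.

Lemma cube_massE j k : (\int[mu]_(x in dyadic_cube j k) (w x)%:E = (cube_mass j k)%:E)%E.
Proof.
rewrite fineK// ge0_fin_numE.
  by rewrite dyadic_cube_cube; exact: locw.
by rewrite integral_ge0// => x _; rewrite lee_fin.
Qed.

Lemma dyadic_pair (f : 'rV[R]_n -> R) j k m : measurable_fun setT f ->
  (forall x, 0 <= f x) ->
  (\int[mu]_(x in dyadic_cube j m) (f x `^ p * w x)%:E < +oo)%E ->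
  (\int[mu]_(x in dyadic_cube j m) (f x)%:E < +oo)%E /\
  cube_mass j k * (fine (\int[mu]_(x in dyadic_cube j m) (f x)%:E)) `^ p <=
    A * (((2 : R) ^ (- j)) ^+ n) `^ p * (1 + (supn (k - m))%:R) `^ (n%:R * p) *
      fine (\int[mu]_(x in dyadic_cube j m) (f x `^ p * w x)%:E).
Proof.
move=> mf f0 Foo; have [x [hk hm]] := @dyadic_cubes_sub_cube R n j k m.
have p0 : 0 < (2 : R) ^ (- j) by exact: pow2_gt0.
have d0 : 0 < 1 + (supn (k - m))%:R :> R by rewrite ltr_pwDl.
have := @Ap_pair R n p A w p1 w0 mw locw ApA f x _ (dyadic_cube j k) (dyadic_cube j m)
  (mulr_gt0 p0 d0) (measurable_dyadic_cube _ _) (measurable_dyadic_cube _ _) hk hm mf f0 Foo.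
rewrite exprMn powRM ?exprn_ge0 ?(ltW d0) ?(ltW p0)// powRrM powR_mulrn ?(ltW d0)//.
by rewrite mulrA.
Qed.

(** The case f = 1 of [dyadic_pair], where the p-th power of the volume of the cube cancels. *)
Lemma dyadic_pair_mass j k m :
  cube_mass j k <= A * (1 + (supn (k - m))%:R) `^ (n%:R * p) * cube_mass j m.
Proof.
have s0 : 0 < ((2 : R) ^ (- j)) ^+ n by rewrite exprn_gt0// pow2_gt0.
have E : (\int[mu]_(x in dyadic_cube j m) ((1 : R) `^ p * w x)%:E = (cube_mass j m)%:E)%E.
  by rewrite -cube_massE; apply: eq_integral => x _; rewrite powR1 mul1r.
have := @dyadic_pair (cst 1) j k m (@measurable_cst _ _ _ _ _ _) (fun _ => ler01).
rewrite /cst E => /(_ (ltry _)) [_].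
rewrite integral_cst ?measurable_dyadic_cube//; last exact: measurable_dyadic_cube.
rewrite lebesgue_rV_dyadic mul1e /=.
set S := ((2 : R) ^ (- j)) ^+ n in s0 *; have sp : 0 < S `^ p by exact: powR_gt0.
set V := _ `^ (n%:R * p) => h; rewrite -(ler_pM2l sp) mulrC.
by apply: (le_trans h); rewrite -!mulrA [A * _]mulrCA.
Qed.

Lemma ge0_integral_bound (g : 'rV[R]_n -> R) (c : R) (D : set 'rV[R]_n) : measurable D ->
  measurable_fun setT g -> (forall x, 0 <= g x) -> 0 <= c -> (forall x, D x -> g x <= c) ->
  (\int[mu]_(x in D) (g x `^ p * w x)%:E <= (c `^ p)%:E * \int[mu]_(x in D) (w x)%:E)%E.
Proof.
move=> mD mg g0 c0 gc; rewrite -ge0_integralZl//.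
- apply: ge0_le_integral => //.
  + by move=> x _; rewrite lee_fin mulr_ge0 ?powR_ge0.
  + apply/measurable_EFinP; apply: measurable_funTS; apply: measurable_funM => //.
    exact: measurable_fun_powRc.
  + apply/measurable_EFinP; apply: measurable_funTS; apply: measurable_funM => //.
  + move=> x Dx; rewrite -EFinM lee_fin ler_wpM2r//.
    by apply: ge0_ler_powR; rewrite ?nnegrE// ?gc// (le_trans ler01)// ltW.
- by apply/measurable_EFinP; exact: measurable_funTS.
- by move=> x _; rewrite lee_fin.
- by rewrite lee_fin powR_ge0.
Qed.

(* The conclusion of [lattice_schur], as a hypothesis because its constant [Z] must
   not depend on the weight. *)
Variables (e Z : R).
Hypothesis schur : forall (G : R) (W v F : 'rV[int]_n -> R) (s t : seq 'rV[int]_n),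
    0 <= G -> (forall k, 0 <= W k) -> (forall k, 0 <= v k) -> (forall k, 0 <= F k) ->
    uniq s -> uniq t ->
    (forall k m, W k * v m `^ p <= G * (1 + (supn (k - m))%:R) `^ (n%:R * p) * F m) ->
    \sum_(k <- s) W k *
       (\sum_(m <- t) (1 + (supn (k - m))%:R) `^ (- (2 * n%:R + e)) * v m) `^ p <=
    Z * G * \sum_(m <- t) F m.
Hypothesis A0 : 0 <= A.

(** The majorant of [g] is constant on each cube of scale j, so the integral becomes a lattice sum
    with weights w(Q_m). The Schur test applies with v = c and F = c^p w(Q_k), its growth hypothesis
    being [dyadic_pair_mass]; finite boxes suffice by monotone convergence. *)
Lemma weighted_upper (g : 'rV[R]_n -> R) (c : 'rV[int]_n -> R) (K : R)
    (La : seq 'rV[int]_n) j :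
  uniq La -> measurable_fun setT g -> (forall x, 0 <= g x) -> (forall k, 0 <= c k) -> 0 <= K ->
  (forall x, g x <= K * \sum_(k <- La)
     (1 + (supn (dyadic_index j x - k))%:R) `^ (- (2 * n%:R + e)) * c k) ->
  (\int[mu]_x (g x `^ p * w x)%:E <=
    (K `^ p * (Z * A * \sum_(k <- La) c k `^ p * cube_mass j k))%:E)%E.
Proof.
move=> uLa mg g0 c0 K0 hg.
have mgp : measurable_fun setT (fun x => g x `^ p * w x).
  by apply: measurable_funM => //; exact: measurable_fun_powRc.
have gp0 x : 0 <= g x `^ p * w x by rewrite mulr_ge0 ?powR_ge0.
apply: (@integral_le_dyadic_box _ _ _ j) => // N; rewrite integral_dyadic_box//.
pose T m := \sum_(k <- La) (1 + (supn (m - k))%:R) `^ (- (2 * n%:R + e)) * c k.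
have T0 m : 0 <= T m by apply: sumr_ge0 => k _; rewrite mulr_ge0 ?powR_ge0.
apply: (@le_trans _ _ (\sum_(m <- box_seq N) (K `^ p * (cube_mass j m * T m `^ p))%:E)%E).
  apply: lee_sum => m _.
  have -> : (K `^ p * (cube_mass j m * T m `^ p))%:E =
      (((K * T m) `^ p)%:E * \int[mu]_(x in dyadic_cube j m) (w x)%:E)%E.
    by rewrite cube_massE -EFinM powRM// [cube_mass j m * _]mulrC mulrA.
  apply: ge0_integral_bound => //.
  - exact: measurable_dyadic_cube.
  - by rewrite mulr_ge0.
  - by move=> x /dyadic_cubeP <-; exact: hg.
rewrite sumEFin lee_fin -mulr_sumr ler_wpM2l ?powR_ge0//.
have := schur (G := A) (W := cube_mass j) (v := c) (F := fun k => c k `^ p * cube_mass j k)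
  (s := box_seq N) (t := La) A0 (cube_mass_ge0 j) c0.
apply => //.
- by move=> k; rewrite mulr_ge0 ?powR_ge0 ?cube_mass_ge0.
- exact: box_seq_uniq.
- move=> k m; rewrite mulrC mulrCA ler_wpM2l ?powR_ge0//.
  exact: dyadic_pair_mass.
Qed.

(** Here the Schur test is fed with the integrals of [f] over the cubes Q_m as [v] and those of f^p
    w as [F]; its growth hypothesis is [dyadic_pair], with the p-th power of the volume of a cube as
    an extra factor. *)
Lemma weighted_lower (f : 'rV[R]_n -> R) (h : 'rV[int]_n -> 'rV[R]_n -> R)
    (T : 'rV[int]_n -> R) (K : R) (La : seq 'rV[int]_n) j :
  uniq La -> measurable_fun setT f -> (forall x, 0 <= f x) -> 0 <= K ->
  (\int[mu]_x (f x `^ p * w x)%:E < +oo)%E ->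
  (forall k, measurable_fun setT (h k)) -> (forall k x, 0 <= h k x) ->
  (forall k, {ae mu, forall x, h k x <=
     K * (1 + (supn (k - dyadic_index j x))%:R) `^ (- (2 * n%:R + e))}) ->
  (forall k, \int[mu]_x (f x * h k x)%:E = (T k)%:E)%E ->
  \sum_(k <- La) cube_mass j k * T k `^ p <=
    2 `^ p * K `^ p * (Z * (A * (((2 : R) ^ (- j)) ^+ n) `^ p) *
      fine (\int[mu]_x (f x `^ p * w x)%:E)).
Proof.
move=> uLa mf f0 K0 Foo mh h0 hK hT.
have p0 : 0 <= p by rewrite (le_trans ler01)// ltW.
set s := ((2 : R) ^ (- j)) ^+ n.
have s0 : 0 <= s by rewrite exprn_ge0// ltW// pow2_gt0.
have mfp : measurable_fun setT (fun x => f x `^ p * w x).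
  by apply: measurable_funM => //; exact: measurable_fun_powRc.
have fp0 x : 0 <= f x `^ p * w x by rewrite mulr_ge0 ?powR_ge0.
have mfh k : measurable_fun setT (fun x => f x * h k x) by exact: measurable_funM.
have fh0 k x : 0 <= f x * h k x by rewrite mulr_ge0.
have T0 k : 0 <= T k.
  by rewrite -lee_fin -hT; apply: integral_ge0 => x _; rewrite lee_fin.
pose X N k := fine (\int[mu]_(x in dyadic_box j N) (f x * h k x)%:E)%E.
have XE N k : (\int[mu]_(x in dyadic_box j N) (f x * h k x)%:E = (X N k)%:E)%E.
  rewrite fineK// ge0_fin_numE; last by apply: integral_ge0 => x _; rewrite lee_fin.
  apply: le_lt_trans (_ : ((T k)%:E < +oo)%E); last exact: ltry.
  rewrite -hT; apply: ge0_integral_le_set => //; exact: measurable_dyadic_box.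
have X0 N k : 0 <= X N k.
  by rewrite fine_ge0//; apply: integral_ge0 => x _; rewrite lee_fin.
have cX k : X N k @[N --> \oo] --> T k.
  have := cvg_integral_dyadic_box j (mfh k) (fh0 k); rewrite hT => /fine_cvgP[_].
  by [].
(* The Schur test concerns finite sums, so the integrals T k are truncated to a large box, at the
   price of a factor 2; [La] is finite, so one box serves all its indices. *)
have near1 k : \forall N \near \oo, T k <= 2 * X N k.
  have [Tz|Tn] := eqVneq (T k) 0.
    by apply: nearW => N; rewrite Tz mulr_ge0.
  have Tp : 0 < T k by rewrite lt0r Tn T0.
  have : \forall N \near \oo, T k / 2 < X N k.
    by apply: (cvgr_gt _ (cX k)); lra.
  by apply: filterS => N; lra.
have nearall : \forall N \near \oo, all (fun k => T k <= 2 * X N k) La.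
  elim: (La) => [|k r ih]; first by apply: nearW.
  by apply: filterS2 (near1 k) ih => N /= -> ->.
have [N _ /(_ N (leqnn _)) /= /allP hN] := nearall.
pose v m := fine (\int[mu]_(x in dyadic_cube j m) (f x)%:E)%E.
pose F m := fine (\int[mu]_(x in dyadic_cube j m) (f x `^ p * w x)%:E)%E.
have Fm m : (\int[mu]_(x in dyadic_cube j m) (f x `^ p * w x)%:E < +oo)%E.
  apply: le_lt_trans Foo; apply: ge0_integral_le_set => //; exact: measurable_dyadic_cube.
have F0 m : 0 <= F m by rewrite fine_ge0//; apply: integral_ge0 => x _; rewrite lee_fin.
have v0 m : 0 <= v m by rewrite fine_ge0//; apply: integral_ge0 => x _; rewrite lee_fin.
have vE m : (\int[mu]_(x in dyadic_cube j m) (f x)%:E = (v m)%:E)%E.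
  rewrite fineK// ge0_fin_numE; last by apply: integral_ge0 => x _; rewrite lee_fin.
  by have [] := dyadic_pair m mf f0 (Fm m).
have FE m : (\int[mu]_(x in dyadic_cube j m) (f x `^ p * w x)%:E = (F m)%:E)%E.
  by rewrite fineK// ge0_fin_numE//; apply: integral_ge0 => x _; rewrite lee_fin.
pose kap (d : 'rV[int]_n) : R := (1 + (supn d)%:R) `^ (- (2 * n%:R + e)).
have kap0 d : 0 <= kap d by exact: powR_ge0.
have hX k : X N k <= K * \sum_(m <- box_seq N) kap (k - m) * v m.
  rewrite -lee_fin -XE integral_dyadic_box// mulr_sumr -sumEFin.
  apply: lee_sum => m _.
  have -> : (K * (kap (k - m) * v m))%:E =
      (\int[mu]_(x in dyadic_cube j m) (K * kap (k - m) * f x)%:E)%E.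
    under eq_integral do rewrite EFinM; rewrite ge0_integralZl//.
    - by rewrite vE -EFinM mulrA.
    - exact: measurable_dyadic_cube.
    - by apply/measurable_EFinP; exact: measurable_funTS.
    - by move=> x _; rewrite lee_fin.
    - by rewrite lee_fin mulr_ge0.
  apply: ae_ge0_le_integral.
  - exact: measurable_dyadic_cube.
  - by move=> x _; rewrite lee_fin.
  - by apply/measurable_EFinP; exact: measurable_funTS.
  - by move=> x _; rewrite lee_fin !mulr_ge0.
  - by apply/measurable_EFinP; apply: measurable_funTS; exact: measurable_funM.
  apply: filterS (hK k) => x hx /dyadic_cubeP ex; rewrite lee_fin mulrC ler_wpM2r//.
  by rewrite /kap -ex.
have step : \sum_(k <- La) cube_mass j k * T k `^ p <=
    2 `^ p * K `^ p * \sum_(k <- La) cube_mass j k * (\sum_(m <- box_seq N) kap (k - m) * v m) `^ p.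
  rewrite mulr_sumr big_seq [leRHS]big_seq; apply: ler_sum => k kLa.
  rewrite mulrCA ler_wpM2l ?cube_mass_ge0//.
  have S0 : 0 <= \sum_(m <- box_seq N) kap (k - m) * v m.
    by apply: sumr_ge0 => m _; rewrite mulr_ge0.
  rewrite -powRM// -powRM ?mulr_ge0//.
  apply: ge0_ler_powR; rewrite ?nnegrE ?mulr_ge0//.
  by apply: (le_trans (hN k kLa)); rewrite -mulrA ler_pM2l.
apply: (le_trans step); rewrite ler_wpM2l ?mulr_ge0 ?powR_ge0//.
apply: (le_trans (schur (G := A * s `^ p) (W := cube_mass j) (v := v) (F := F)
   (s := La) (t := box_seq N) _ (cube_mass_ge0 j) v0 F0 uLa (box_seq_uniq _) _)).
- by rewrite mulr_ge0 ?powR_ge0.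
- by move=> k m; have [_] := dyadic_pair k mf f0 (Fm m).
(* The sign of Z times G is read off [schur] itself, with an empty sum on the left and a single term
   1 on the right. *)
have ZG : 0 <= Z * (A * s `^ p).
  have := schur (G := A * s `^ p) (W := fun=> 0) (v := fun=> 0) (F := fun=> 1)
    (s := [::]) (t := [:: 0]).
  rewrite big_nil big_seq1 mulr1; apply => //; first by rewrite mulr_ge0 ?powR_ge0.
  by move=> k m; rewrite mul0r mulr1 !mulr_ge0 ?powR_ge0.
rewrite ler_wpM2l//.
have Ff : (\int[mu]_x (f x `^ p * w x)%:E)%E \is a fin_num.
  by rewrite ge0_fin_numE//; apply: integral_ge0 => x _; rewrite lee_fin.
rewrite -lee_fin (fineK Ff) -sumEFin; under eq_bigr do rewrite -FE.
rewrite -integral_dyadic_box//; apply: ge0_integral_le_set => //.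
exact: measurable_dyadic_box.
Qed.

End weighted.

(** * Two-sided estimates *)

Section wavelet_estimates.
Context {R : realType} {n : nat}.
Local Notation mu := (@lebesgue_rV R n).

(** The coordinate [i] realises the maximum, which exists since n > 0. Rounding down changes 2^j x_i
    by at most 1, and 1 + (|y_i| + 1) <= 2 (1 + |y_i|). *)
Lemma supn_dyadic_index j (k : 'rV[int]_n) (x : 'rV[R]_n) : (0 < n)%N -> exists i,
  1 + (supn (dyadic_index j x - k))%:R <= 2 * (1 + `|((2 : R) ^ j *: x - zvec k) ord0 i|).
Proof.
move=> n0; pose d := dyadic_index j x - k.
have [|i e] := @bigop.eq_bigmax 'I_n (fun i => absz (d ord0 i)).
  by rewrite card_ord.
exists i; rewrite /supn -/d e (_ : d ord0 i = dyadic_index j x ord0 i - k ord0 i); last by rewrite !mxE.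
have /dyadic_indexP /(_ i) := erefl (dyadic_index j x).
rewrite [(_ - zvec k) _ _]mxE [X in _ <= 2 * (1 + `|X + _|)]mxE [X in _ <= 2 * (1 + `|_ + X|)]mxE [zvec k _ _]mxE.
move: (dyadic_index j x ord0 i) (k ord0 i) => {e}u v /andP[h1 h2].
rewrite natr_absz intr_norm rmorphB/=.
have := ler_normD (2 ^ j * x ord0 i - v%:~R) (u%:~R - 2 ^ j * x ord0 i).
rewrite [X in `|X| <= _ -> _]addrC addrA subrK => h.
have : `|u%:~R - 2 ^ j * x ord0 i| <= 1 by rewrite ler_norml; lra.
by have := normr_ge0 (2 ^ j * x ord0 i - v%:~R); lra.
Qed.

(** Decay is assumed only at the one point concerned, so the lemma serves both generators, one
    decaying everywhere and the other almost everywhere. *)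
Lemma dilate_decay (h : 'rV[R]_n -> R[i]) (s K : R) j k (x : 'rV[R]_n) : (0 < n)%N -> 0 <= s ->
  (forall i, (1 + `|((2 : R) ^ j *: x - zvec k) ord0 i|) `^ s *
    absC (h ((2 : R) ^ j *: x - zvec k)) <= K) ->
  absC (dilate h j k x) <= 2 `^ (j%:~R * n%:R / 2) * (2 `^ s * K) *
    (1 + (supn (dyadic_index j x - k))%:R) `^ (- s).
Proof.
move=> n0 s0 hK; have [i hi] := supn_dyadic_index j k x n0.
rewrite /dilate absCM absC_real (ger0_norm (powR_ge0 _ _)).
set q := 2 `^ _; rewrite -[leRHS]mulrA ler_wpM2l ?powR_ge0// => {q}.
set y := 2 ^ j *: x - zvec k in hi hK *; set d := 1 + _ in hi *.
have d0 : 0 < d by rewrite ltr_pwDl.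
rewrite powRN ler_pdivlMr ?powR_gt0// mulrC.
apply: (le_trans _ (ler_wpM2l (powR_ge0 2 s) (hK i))).
rewrite mulrA ler_wpM2r ?absC_ge0// -powRM ?addr_ge0//.
by apply: ge0_ler_powR; rewrite ?nnegrE ?mulr_ge0 ?addr_ge0// ltW.
Qed.

Lemma integrable_sqr_absC (f : 'rV[R]_n -> R[i]) : L2 f -> mu.-integrable setT (EFin \o (fun x => absC (f x) ^+ 2)).
Proof.
move=> [mf hf]; apply/integrableP; split.
  by apply/measurable_EFinP; apply: measurable_funX; exact: measurable_absC.
have -> : (\int[mu]_x `|(EFin \o (fun x => absC (f x) ^+ 2)%R) x| = L2norm f `^ 2)%E.
  rewrite /L2norm poweR_Lnorm ?pnatr_eq0//; apply: eq_integral => x _ /=.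
  by rewrite powR_mulrn// !ger0_norm ?sqr_ge0 ?absC_ge0.
exact: poweR_lty.
Qed.

Lemma cintegrable_inner (f g : 'rV[R]_n -> R[i]) : L2 f -> L2 g ->
  cintegrable (fun x => f x * (g x)^*).
Proof.
move=> Lf Lg; apply: (@le_cintegrable _ _ _ (fun x => absC (f x) ^+ 2 + absC (g x) ^+ 2)).
- by apply: cmeasurableM; [exact: Lf.1|apply: cmeasurable_conj; exact: Lg.1].
- move=> x; rewrite absCM absCJ; move: (absC (f x)) (absC (g x)) (sqr_ge0 (absC (f x) - absC (g x))) (sqr_ge0 (absC (f x) + absC (g x))) => u v.
  by nra.
- exact: (integrableD measurableT (integrable_sqr_absC Lf) (integrable_sqr_absC Lg)).
Qed.

Lemma cintegrable_inner_sum (I : Type) (s : seq I) (c : I -> R[i])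
    (F : I -> 'rV[R]_n -> R[i]) g : (forall i, L2 (F i)) -> L2 g ->
  cintegrable (fun x => (\sum_(i <- s) c i * F i x) * (g x)^*) /\
  inner (fun x => \sum_(i <- s) c i * F i x) g = \sum_(i <- s) c i * inner (F i) g.
Proof.
move=> LF Lg; rewrite /inner.
have ci i : cintegrable (fun x => F i x * (g x)^* * c i).
  by apply: cintegrableZr; exact: cintegrable_inner.
have -> : (fun x => (\sum_(i <- s) c i * F i x) * (g x)^*) =
    (fun x => \sum_(i <- s) (F i x * (g x)^*) * c i).
  by apply/funext => x; rewrite mulr_suml; apply: eq_bigr => i _; rewrite -mulrA mulrC.
split; first exact: cintegrable_sum.
rewrite cintegral_sum//.
by apply: eq_bigr => i _; rewrite (cintegralZr (c i) (cintegrable_inner (LF i) Lg)) mulrC.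
Qed.

End wavelet_estimates.

(** * Norm of a wavelet sum against its coefficients *)

Section sequence_bounds.
Context {R : realType} {n : nat}.
Local Notation mu := (@lebesgue_rV R n).
Variables (p A : R) (w : 'rV[R]_n -> R).
Hypotheses (p1 : 1 < p) (w0 : forall x, 0 < w x) (mw : measurable_fun setT w).
Hypothesis locw : forall x l, (\int[mu]_(y in cube x l) (w y)%:E < +oo)%E.
Hypothesis ApA : forall x l, 0 < l ->
  (average (cube x l) w * (average (cube x l) (fun x => w x `^ (- (p - 1)^-1))%R) `^ (p - 1)
    <= A%:E)%E.
Variables (e Z : R).
Hypothesis schur : forall (G : R) (W v F : 'rV[int]_n -> R) (s t : seq 'rV[int]_n),
    0 <= G -> (forall k, 0 <= W k) -> (forall k, 0 <= v k) -> (forall k, 0 <= F k) ->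
    uniq s -> uniq t ->
    (forall k m, W k * v m `^ p <= G * (1 + (supn (k - m))%:R) `^ (n%:R * p) * F m) ->
    \sum_(k <- s) W k *
       (\sum_(m <- t) (1 + (supn (k - m))%:R) `^ (- (2 * n%:R + e)) * v m) `^ p <=
    Z * G * \sum_(m <- t) F m.
Hypotheses (n0 : (0 < n)%N) (e0 : 0 < e).
Local Notation s := (2 * n%:R + e).
Local Notation q j := ((2 : R) `^ (j%:~R * n%:R / 2)).

Let s0 : 0 <= s. Proof. by rewrite addr_ge0 ?mulr_ge0// ltW. Qed.

Let A0 : 0 <= A. Proof. by apply: le_trans ler01 _; exact: (Ap_ge1 p1 w0 mw locw ApA). Qed.

Lemma wavelet_sum_upper (h : 'rV[R]_n -> R[i]) j (La : seq 'rV[int]_n) coef M : uniq La ->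
  0 <= M -> (forall k, cmeasurable (dilate h j k)) ->
  (forall y, (1 + enorm y) `^ s * absC (h y) <= M) ->
  (\int[mu]_x (absC (\sum_(k <- La) coef k * dilate h j k x) `^ p * w x)%:E <=
   ((q j * (2 `^ s * M)) `^ p * (Z * A * \sum_(k <- La) absC (coef k) `^ p * cube_mass w j k))%:E)%E.
Proof.
move=> uLa M0 mh hM.
apply: (weighted_upper p1 w0 mw locw ApA schur A0 (g := fun x => absC (\sum_(k <- La) coef k * dilate h j k x))) => //.
- apply: measurable_absC; apply: cmeasurable_sum => k; apply: cmeasurableM => //.
  exact: cmeasurable_cst.
- by move=> x; exact: absC_ge0.
- by move=> k; exact: absC_ge0.
- by rewrite !mulr_ge0 ?powR_ge0.
move=> x; rewrite (le_trans (absC_sum _ _ _))// mulr_sumr; apply: ler_sum => k _.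
rewrite absCM mulrC mulrA ler_wpM2r ?absC_ge0//.
apply: dilate_decay => // i.
apply: le_trans (hM ((2 : R) ^ j *: x - zvec k)); rewrite ler_wpM2r ?absC_ge0//.
apply: ge0_ler_powR; rewrite ?nnegrE ?addr_ge0 ?enorm_ge0 ?(ltW e0)//.
by rewrite lerD2l; exact: le_coord_enorm.
Qed.

(** Biorthogonality recovers each coefficient as an inner product with a dual wavelet. The factor 4
    is 2 from [absC_cintegral_le] times 2 from the truncation in [weighted_lower]; the division by
    [q j] combines the normalisation [q j] of the dual wavelets with the volume (q j)^-2 of a
    cube. *)
Lemma wavelet_sum_lower (h ht : 'rV[R]_n -> R[i]) j (La : seq 'rV[int]_n) coef K : uniq La ->
  0 <= K -> (forall k, L2 (dilate h j k)) -> (forall k, L2 (dilate ht j k)) ->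
  (forall k k', inner (dilate h j k) (dilate ht j k') = (k == k')%:R) ->
  {ae mu, forall y : 'rV[R]_n, forall i, (1 + `|y ord0 i|) `^ s * absC (ht y) <= K} ->
  let r := fun x => \sum_(k <- La) coef k * dilate h j k x in
  (\int[mu]_x (absC (r x) `^ p * w x)%:E < +oo)%E ->
  \sum_(k <- La) absC (coef k) `^ p * cube_mass w j k <=
   (4 * (2 `^ s * K) / q j) `^ p * (Z * A * fine (\int[mu]_x (absC (r x) `^ p * w x)%:E)).
Proof.
move=> uLa K0 Lh Lht bio aeK r Ioo.
have q0 : 0 < q j by exact: powR_gt0.
have mr : cmeasurable r.
  apply: cmeasurable_sum => k; apply: cmeasurableM => //; first exact: cmeasurable_cst.
  exact: (Lh k).1.
pose T k := \int[mu]_x (absC (r x) * absC (dilate ht j k x)).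
have ir k : cintegrable (fun x => r x * (dilate ht j k x)^*) by apply: (cintegrable_inner_sum _ _ _ _).1.
have TE k : (\int[mu]_x (absC (r x) * absC (dilate ht j k x))%:E = (T k)%:E)%E.
  have := integrable_fin_num measurableT (cintegrable_absC (ir k)).
  under eq_integral do rewrite /= absCM absCJ.
  by move=> fi; rewrite /T /Rintegral fineK.
have cT k : k \in La -> absC (coef k) <= 2 * T k.
  move=> kLa; have := absC_cintegral_le (ir k).
  rewrite -[cintegral _]/(inner r (dilate ht j k)) (cintegrable_inner_sum _ _ _ _).2//.
  rewrite (bigD1_seq k)//= bio eqxx mulr1 big1 ?addr0 => [|i /negbTE ik].
    have -> // : \int[mu]_x absC (r x * (dilate ht j k x)^*) = T k.
    by apply: eq_Rintegral => x _; rewrite absCM absCJ.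
  by rewrite bio ik mulr0.
have T0 k : 0 <= T k.
  by rewrite -lee_fin -TE; apply: integral_ge0 => x _; rewrite lee_fin mulr_ge0 ?absC_ge0.
have low := weighted_lower p1 w0 mw locw ApA schur A0 (K := q j * (2 `^ s * K)) (j := j) (T := T)
  (f := fun x => absC (r x)) (h := fun k x => absC (dilate ht j k x)) uLa (measurable_absC mr).
have {low} : \sum_(k <- La) cube_mass w j k * T k `^ p <=
    2 `^ p * (q j * (2 `^ s * K)) `^ p * (Z * (A * (((2 : R) ^ (- j)) ^+ n) `^ p) *
      fine (\int[mu]_x (absC (r x) `^ p * w x)%:E)).
  apply: low => //.
  - by move=> x; exact: absC_ge0.
  - by rewrite !mulr_ge0 ?powR_ge0.
  - by move=> k; apply: measurable_absC; exact: (Lht k).1.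
  - by move=> k x; exact: absC_ge0.
  - move=> k; have s2 : 0 < (2 : R) ^ j by exact: pow2_gt0.
    (* The almost everywhere decay of [ht] is pulled back along x |-> 2^j x - k, which preserves
       null sets. *)
    apply: filterS (ae_lebesgue_rV_affine (zvec k) s2 aeK) => x hx.
    by rewrite -supnN opprB; exact: dilate_decay.
set I := fine _; set a := (_ ^ (- j)) ^+ n; have a0 : 0 <= a.
  by rewrite exprn_ge0// ltW// pow2_gt0.
have aq : a = (q j)^-1 * (q j)^-1.
  rewrite -!powRN -powRD; last by rewrite pnatr_eq0 implybT.
  rewrite /a -powR_intmul// -powR_mulrn ?powR_ge0// -powRrM rmorphN.
  by congr (_ `^ _); field.
move=> low; apply: (@le_trans _ _ (2 `^ p * \sum_(k <- La) cube_mass w j k * T k `^ p)).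
  rewrite mulr_sumr big_seq [leRHS]big_seq; apply: ler_sum => k kLa.
  rewrite mulrC mulrCA ler_wpM2l ?cube_mass_ge0// -powRM//.
  by apply: ge0_ler_powR; rewrite ?nnegrE ?mulr_ge0 ?absC_ge0 ?cT// (le_trans ler01)// ltW.
apply: (le_trans (ler_wpM2l (powR_ge0 2 p) low)).
rewrite le_eqVlt; apply/orP; left; apply/eqP.
have X0 : 0 <= 2 `^ s * K by rewrite mulr_ge0 ?powR_ge0.
have qi0 : 0 <= (q j)^-1 by rewrite invr_ge0 ltW.
rewrite (_ : 4 * (2 `^ s * K) / q j = 2 * (2 * ((q j * (2 `^ s * K)) * a))); last first.
  by rewrite aq; field; rewrite gt_eqF.
have qX0 := mulr_ge0 (ltW q0) X0.
rewrite (powRM p (x := 2)) ?mulr_ge0// (powRM p (x := 2)) ?mulr_ge0// (powRM p qX0 a0).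
by move: (2 `^ p) (_ `^ p) (a `^ p) => *; ring.
Qed.

End sequence_bounds.

(** * Reduction to everywhere positive weights *)

Section weights.
Context {R : realType} {n : nat}.
Local Notation mu := (@lebesgue_rV R n).

(** Local integrability is stated on compact sets, whereas [cube] is half-open; its closed version
    mediates. *)
Lemma compact_closed_cube (x : 'rV[R]_n) (l : R) :
  compact [set y : 'rV[R]_n | forall i, x ord0 i <= y ord0 i <= x ord0 i + l].
Proof.
have := @rV_compact R n (fun i => `[x ord0 i, x ord0 i + l]%classic)
  (fun i => @segment_compact R _ _).
by congr compact; apply/seteqP; split => y h i; have := h i; rewrite /= in_itv.
Qed.

Lemma measurable_closed_cube (x : 'rV[R]_n) (l : R) :
  measurable [set y : 'rV[R]_n | forall i, x ord0 i <= y ord0 i <= x ord0 i + l].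
Proof.
rewrite (_ : mkset _ = \big[setI/setT]_(i < n)
    ((fun y : 'rV[R]_n => y ord0 i) @^-1` `[x ord0 i, x ord0 i + l]%classic)).
  elim/big_ind: _ => [|X Y mX mY|i _]; [exact: measurableT|exact: measurableI|].
  rewrite -[X in measurable X]setTI; apply: measurable_rV_coord => //.
rewrite -bigcap_seq; apply/seteqP; split => y h.
  by move=> i _ /=; rewrite in_itv/=; exact: h.
by move=> i; have := h i (mem_index_enum _); rewrite /= in_itv.
Qed.

(* A weight may vanish or be negative on a null set, where the junk values of [powR]
   would interfere. *)
Definition posw (w : 'rV[R]_n -> R) x := if 0 < w x then w x else 1.

Lemma posw_gt0 w x : 0 < posw w x.
Proof. by rewrite /posw; case: ifPn. Qed.

Lemma measurable_posw w : measurable_fun setT w -> measurable_fun setT (posw w).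
Proof.
move=> mw; apply: measurable_fun_ifT => //; exact: measurable_fun_ltr.
Qed.

Lemma ae_posw w : weight w -> {ae mu, forall x, posw w x = w x}.
Proof. by move=> [_ _]; apply: filterS => x wx; rewrite /posw wx. Qed.

(** Stated for a general [F] so as to cover the mass, the dual weight and the weighted norm
    alike. *)
Lemma integral_posw w (D : set 'rV[R]_n) (F : 'rV[R]_n -> R -> R) : weight w -> measurable D ->
  (forall v, measurable_fun setT v -> measurable_fun setT (fun x => F x (v x))) ->
  (\int[mu]_(x in D) (F x (posw w x))%:E = \int[mu]_(x in D) (F x (w x))%:E)%E.
Proof.
move=> ww mD mF; have mw := weight_measurable ww; apply: ae_eq_integral => //.
- by apply/measurable_EFinP; apply: measurable_funTS; apply: mF; exact: measurable_posw.
- by apply/measurable_EFinP; apply: measurable_funTS; exact: mF.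
- by apply: filterS (ae_posw ww) => x ->.
Qed.

Lemma posw_cube_lty w x l : weight w -> (\int[mu]_(y in cube x l) (posw w y)%:E < +oo)%E.
Proof.
move=> ww; have mc := measurable_cube x l; have mw := weight_measurable ww.
under eq_integral do rewrite -[posw w _]gtr0_norm ?posw_gt0//.
rewrite (integral_posw (F := fun _ v => `|v|))//; last by move=> v mv; exact: measurableT_comp.
apply: le_lt_trans (weight_locally_integrable ww (@compact_closed_cube x l)).
apply: ge0_integral_le_set => //; first exact: measurable_closed_cube.
  by move=> y h i; have /andP[-> /ltW ->] := h i.
exact: measurableT_comp.
Qed.

Lemma average_posw p w x l : weight w ->
  (average (cube x l) (posw w) * (average (cube x l) (fun x => posw w x `^ (- (p - 1)^-1))%R) `^ (p - 1)
  = average (cube x l) w * (average (cube x l) (fun x => w x `^ (- (p - 1)^-1))%R) `^ (p - 1))%E.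
Proof.
move=> ww; have mc := measurable_cube x l.
have e1 := integral_posw (F := fun _ v => v) ww mc (fun _ => id).
have e2 := integral_posw (F := fun _ v => v `^ (- (p - 1)^-1)) ww mc
  (fun v mv => measurable_fun_powRc _ mv).
by rewrite /average e1 e2.
Qed.

End weights.

(** For p >= 2 compare 1/p with 1/2; for p < 2 compare it with 1/(2(p-1)), as 2(p-1) <= p. *)
Lemma theta_ge (R : realType) (p : R) : 1 < p -> p^-1 <= theta p.
Proof.
move=> p1; have p0 : 0 < p by lra.
rewrite /theta; have [p2|p2] := leP 2 p.
  apply: (@le_trans _ _ (2^-1 * 1)); first by rewrite mulr1 lef_pV2 ?posrE.
  by rewrite ler_pM2l// le_max lexx.
apply: (@le_trans _ _ (2^-1 * (p - 1)^-1)); last by rewrite ler_pM2l// le_max lexx orbT.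
by rewrite -invfM lef_pV2 ?posrE//; lra.
Qed.

Lemma powR_inv_le (R : realType) (p T Z A X Y : R) : 0 < p -> 0 <= X -> 0 <= T -> 0 <= Z ->
  0 <= A -> 0 <= Y -> X <= T `^ p * (Z * A * Y) ->
  X `^ p^-1 <= T * (Z `^ p^-1 * A `^ p^-1 * Y `^ p^-1).
Proof.
move=> p0 X0 T0 Z0 A0 Y0 h.
have -> : T * (Z `^ p^-1 * A `^ p^-1 * Y `^ p^-1) = (T `^ p * (Z * A * Y)) `^ p^-1.
  rewrite powRM ?powR_ge0 ?mulr_ge0// -powRrM divff ?gt_eqF// powRr1//.
  by rewrite powRM ?mulr_ge0// powRM.
by apply: ge0_ler_powR; rewrite ?nnegrE ?mulr_ge0 ?powR_ge0// invr_ge0 ltW.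
Qed.

Lemma scaled_lower (R : realFieldType) (E z q t a X Y : R) : 0 < E -> 0 < z -> 0 < q -> 0 < t ->
  a <= t -> 0 <= Y -> X <= E / q * (z * a * Y) -> (E * z)^-1 * t^-1 * (q * X) <= Y.
Proof.
move=> E0 z0 q0 t0 at' Y0 h; rewrite -invfM mulrC ler_pdivrMr ?mulr_gt0// mulrC.
apply: (@le_trans _ _ (E * z * (a * Y))).
  by apply: (le_trans (ler_wpM2r (ltW q0) h)); rewrite le_eqVlt; apply/orP; left; apply/eqP; field; rewrite gt_eqF.
by rewrite [leRHS]mulrC -!mulrA !ler_pM2l// ler_wpM2r.
Qed.

Lemma scaled_upper (R : realFieldType) (E z q t a X Y : R) : 0 <= E -> 0 <= z -> 0 <= q ->
  a <= t -> 0 <= Y -> X <= q * E * (z * a * Y) -> X <= E * z * t * (q * Y).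
Proof.
move=> E0 z0 q0 at' Y0 /le_trans; apply.
have -> : E * z * t * (q * Y) = q * E * (z * t * Y) by ring.
by rewrite ler_wpM2l ?mulr_ge0// ler_wpM2r// ler_wpM2l.
Qed.

(** [M] and [D] stand for the maximal decay norms and are quantified before [c] and [C]: this
    expresses that the constants depend on the wavelets only through the listed parameters. *)
Theorem lemma1 (R : realType) (n : nat) (p A B tau sigma a b M D : R) :
  (1 <= n)%N -> 1 < p -> 0 < A -> 0 < B -> 0 < tau -> 2 * n%:R < sigma ->
  0 < a -> a < b ->
  exists c C : R, [/\ 0 < c, 0 < C &
    forall (L : nat) (psi psit : 'I_L -> 'rV[R]_n -> R[i]),
    wavelet_system a b A B psi psit ->
    (forall e, in_M tau (psi e)) -> (forall e, in_D sigma (psit e)) ->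
    (\big[maxe/0]_(e < L) Mnorm tau (psi e) = M%:E)%E ->
    (\big[maxe/0]_(e < L) Dnorm sigma (psit e) = D%:E)%E ->
    forall (e : 'I_L) (j : int) (Lambda : {fset 'rV[int]_n})
      (coef : 'rV[int]_n -> R[i]) (w : 'rV[R]_n -> R),
    Ap p w ->
    let r := fun x => \sum_(k <- Lambda) coef k * dilate (psi e) j k x in
    let S := ((2 `^ (j%:~R * n%:R / 2))%:E *
      (\sum_(k <- Lambda) (absC (coef k) `^ p)%:E
         * weight_mass w (dyadic_cube j k)) `^ p^-1)%E in
    (c%:E * Ap_const p w `^ (- theta p) * S <= Lpw_norm p w r)%E /\
    (Lpw_norm p w r <= C%:E * Ap_const p w `^ theta p * S)%E].
Proof.
move=> n0 p1 _ _ tau0 sig a0 ab.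
have p0 : 0 < p by rewrite (lt_trans ltr01).
have [d d0 sE] : exists2 d, 0 < d & sigma = 2 * n%:R + d.
  by exists (sigma - 2 * n%:R); rewrite ?subr_gt0// addrC subrK.
have sigma0 : 0 < sigma by rewrite sE ltr_wpDl// mulr_ge0.
have [Zt Zt0 schurt] := @lattice_schur R n p tau tau0 n0 p1.
have [Zs Zs0 schurs] := @lattice_schur R n p d d0 n0 p1.
(* Absolute value plus 1 makes the constants positive for all real [M] and [D], since [c] and [C]
   are chosen before any wavelet is given. *)
set M' := `|M| + 1; have M'0 : 0 < M' by rewrite ltr_wpDl.
set K := `|@decay_const R n b sigma D| + 1; have K0 : 0 < K by rewrite ltr_wpDl.
set Et := 2 `^ (2 * n%:R + tau) * M'; have Et0 : 0 < Et by rewrite mulr_gt0// powR_gt0.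
set Es := 4 * (2 `^ sigma * K); have Es0 : 0 < Es by rewrite !mulr_gt0// powR_gt0.
have zt0 : 0 < Zt `^ p^-1 by exact: powR_gt0.
have zs0 : 0 < Zs `^ p^-1 by exact: powR_gt0.
exists (Es * Zs `^ p^-1)^-1, (Et * Zt `^ p^-1); split; rewrite ?invr_gt0 ?mulr_gt0//.
move=> L psi psit sys _ _ hM hD e j La coef w [ww Aoo] r S.
have [Lpsi _ _] := wavelet_Riesz sys; have [Lpsit _ _] := wavelet_Riesz_dual sys.
pose v := posw w; have v0 : forall x, 0 < v x by exact: posw_gt0.
have mv : measurable_fun setT v by apply: measurable_posw; exact: weight_measurable ww.
have locv x l : (\int[lebesgue_rV n]_(y in cube x l) (v y)%:E < +oo)%E by exact: posw_cube_lty.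
pose A' := fine (Ap_const p w).
have Apx x l : 0 < l -> (average (cube x l) v * (average (cube x l) (fun y => v y `^ (- (p - 1)^-1))%R) `^ (p - 1)
    <= Ap_const p w)%E.
  by move=> l0; rewrite average_posw//; apply: ereal_sup_ubound; exists (cube x l) => //; exists x, l.
have A'E : (Ap_const p w = A'%:E)%E.
  (* One cube already bounds the supremum from below by a nonnegative number, which excludes the
     value -oo. *)
  rewrite fineK// ge0_fin_numE//; apply: le_trans (Apx 0 1 ltr01).
  have av u : (forall x, 0 <= u x) -> (0 <= average (cube (0 : 'rV[R]_n) 1) u)%E.
    move=> u0; rewrite mule_ge0 ?lee_fin ?invr_ge0 ?fine_ge0//.
    by apply: integral_ge0 => x _; rewrite lee_fin.
  by rewrite mule_ge0 ?poweR_ge0// av// => x; rewrite ltW.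
have ApA x l : 0 < l -> (average (cube x l) v * (average (cube x l) (fun y => v y `^ (- (p - 1)^-1))%R) `^ (p - 1)
    <= A'%:E)%E by rewrite -A'E; exact: Apx.
have A'1 : 1 <= A' := Ap_ge1 p1 v0 mv locv ApA.
have A'0 : 0 < A' by rewrite (lt_le_trans ltr01).
set t := A' `^ theta p; have t0 : 0 < t by exact: powR_gt0.
have At : A' `^ p^-1 <= t by apply: ler_powR => //; exact: theta_ge.
set q := 2 `^ (j%:~R * n%:R / 2) in S *; have q0 : 0 < q by exact: powR_gt0.
pose Ss := \sum_(k <- La) absC (coef k) `^ p * cube_mass v j k.
have Ss0 : 0 <= Ss by apply: sumr_ge0 => k _; rewrite mulr_ge0 ?powR_ge0// cube_mass_ge0.
have SE : S = (q * Ss `^ p^-1)%:E.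
  rewrite EFinM -[(Ss `^ _)%:E]poweR_EFin /Ss -sumEFin /S.
  congr (_ * _ `^ _)%E; apply: eq_bigr => k _; rewrite EFinM -cube_massE//.
  by rewrite (integral_posw (F := fun _ v => v))//; exact: measurable_dyadic_cube.
have mpsi k : cmeasurable (dilate (psi e) j k) := (Lpsi (e, j, k)).1.
have mr : cmeasurable r.
  by apply: cmeasurable_sum => k; apply: cmeasurableM => //; exact: cmeasurable_cst.
pose I := (\int[lebesgue_rV n]_x (absC (r x) `^ p * v x)%:E)%E.
have I0 : (0 <= I)%E.
  by apply: integral_ge0 => x _; rewrite lee_fin mulr_ge0 ?powR_ge0// ltW.
have IE : Lpw_norm p w r = (I `^ p^-1)%E.
  rewrite /Lpw_norm /I (integral_posw (F := fun x v => absC (r x) `^ p * v))//.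
  move=> u mu'; apply: measurable_funM => //; apply: measurable_fun_powRc.
  exact: measurable_absC.
have uLa : uniq La := fset_uniq La.
rewrite IE A'E SE !poweR_EFin powRN -!EFinM; split.
  (* An infinite norm makes the lower bound trivial; a finite one is what [wavelet_sum_lower]
     requires. *)
  have [->|Ify] := eqVneq I +oo%E; first by rewrite poweRyr ?leey// invr_eq0 gt_eqF.
  have Ioo : (I < +oo)%E by rewrite ltey.
  have If : I \is a fin_num by rewrite ge0_fin_numE.
  rewrite -(fineK If) poweR_EFin lee_fin; apply: scaled_lower At (powR_ge0 _ _) _ => //.
  apply: (powR_inv_le p0 Ss0 _ (ltW Zs0) (ltW A'0) (fine_ge0 I0)).
    by rewrite divr_ge0// ltW.
  rewrite /Es sE; apply: (wavelet_sum_lower p1 v0 mv locv ApA schurs n0 d0 uLa (ltW K0)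
    (h := psi e) (ht := psit e)) => //.
  - by move=> k; exact: (Lpsi (e, j, k)).
  - by move=> k; exact: (Lpsit (e, j, k)).
  - move=> k k'; have := wavelet_biorthogonal sys (e, j, k) (e, j, k').
    by rewrite /wav/= => ->; rewrite xpair_eqE eqxx.
  rewrite -sE; have bb := band_limited_band (wavelet_band_dual sys e).
  have De : (Dnorm sigma (psit e) <= D%:E)%E by rewrite -hD; exact: le_bigmax.
  apply: filterS (band_decay (ltW (lt_trans a0 ab)) sigma0 bb De) => x hx i.
  by apply: (le_trans (hx i)); rewrite /K; apply: (le_trans (ler_norm _)); rewrite lerDl.
have up : (I <= ((q * Et) `^ p * (Zt * A' * Ss))%:E)%E.
  apply: (wavelet_sum_upper p1 v0 mv locv ApA schurt n0 tau0 _ uLa (ltW M'0)) => // y.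
  have Me : (Mnorm tau (psi e) <= M%:E)%E by rewrite -hM; exact: le_bigmax.
  rewrite -lee_fin; apply: (@le_trans _ _ M%:E).
    by apply: le_trans Me; apply: ereal_sup_ubound; exists y.
  by rewrite lee_fin /M'; apply: (le_trans (ler_norm _)); rewrite lerDl.
have If : I \is a fin_num by rewrite ge0_fin_numE// (le_lt_trans up)// ltry.
rewrite -(fineK If) poweR_EFin lee_fin.
apply: scaled_upper At (powR_ge0 _ _) _; rewrite ?(ltW Et0) ?(ltW zt0) ?(ltW q0)//.
apply: (powR_inv_le p0 (fine_ge0 I0) _ (ltW Zt0) (ltW A'0) Ss0).
  by rewrite mulr_ge0// ltW.
by rewrite -lee_fin fineK.
Qed.
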